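(* Fix $n\ge4$, let $v=n(n-3)/2$, and let $p\wedge q\to\infty$. Suppose that there are constants $a,b,a',b'$ not depending on $p,q$ with $0<a\le\inf_i \mathrm{var}(x_i)\le\sup_iE(x_i^2)\le b<\infty$ and $0<a'\le\inf_j \mathrm{var}(y_j)\le\sup_jE(y_j^2)\le b'<\infty$. Suppose also that, for fixed $n$, as $p\wedge q\to\infty$, the random vector formed by all $p^{-1/2}\sum_{i=1}^pk_{st}(i)$ $(s<t)$ and all $q^{-1/2}\sum_{j=1}^ql_{uv}(j)$ $(u<v)$ converges jointly in distribution to $\{c_{st},d_{uv}\}_{s<t,u<v}$, which are jointly Gaussian, and that moreover the following limits exist and are the corresponding (co)variances of the limit: $\mathrm{var}(c_{st})=\sigma_x^2=\lim_p\frac1p\sum_{i,j=1}^p\mathrm{cov}[k_{st}(i),k_{st}(j)]$, $\mathrm{var}(d_{st})=\sigma_y^2=\lim_q\frac1q\sum_{i,j=1}^q\mathrm{cov}[l_{st}(i),l_{st}(j)]$, $\mathrm{cov}(c_{st},d_{st})=\sigma_{xy}^2=\lim_{p,q}\frac1{\sqrt{pq}}\sum_{i=1}^p\sum_{j=1}^q\mathrm{cov}[k_{st}(i),l_{st}(j)]$. Then there is a projection matrix $\mathbf M$ of size $\frac{n(n-1)}2\times\frac{n(n-1)}2$ and rank $v$ such that $$uCov_n^2(\mathbf X,\mathbf Y)\overset{d}{\to}\frac1v\mathbf c^T\mathbf M\mathbf d,$$ $$uCov_n^2(\mathbf X,\mathbf X)\overset{d}{\to}\frac1v\mathbf c^T\mathbf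 M\mathbf c\overset{d}{=}\frac{\sigma_x^2}{v}\chi_v^2,\qquad uCov_n^2(\mathbf Y,\mathbf Y)\overset{d}{\to}\frac1v\mathbf d^T\mathbf M\mathbf d\overset{d}{=}\frac{\sigma_y^2}{v}\chi_v^2,$$ where $$\begin{pmatrix}\mathbf c\\ \mathbf d\end{pmatrix}\overset{d}{=}N\left(\mathbf 0,\begin{pmatrix}\sigma_x^2\mathbf I_{n(n-1)/2}&\sigma_{xy}^2\mathbf I_{n(n-1)/2}\\ \sigma_{xy}^2\mathbf I_{n(n-1)/2}&\sigma_y^2\mathbf I_{n(n-1)/2}\end{pmatrix}\right).$$
   Context: Setting. For each $p,q$, $(X,Y)$ is a pair of random vectors $X=(x_1,\dots,x_p)^T\in\mathbb R^p$, $Y=(y_1,\dots,y_q)^T\in\mathbb R^q$ (whose law may depend on $p,q$). $(X_1,Y_1),\dots,(X_n,Y_n)$ are i.i.d. copies of $(X,Y)$, with $X_s=(x_{s1},\dots,x_{sp})^T$, $Y_s=(y_{s1},\dots,y_{sq})^T$; $\mathbf X=(X_1,\dots,X_n)^T$, $\mathbf Y=(Y_1,\dots,Y_n)^T$. $\mathcal U$-centering. For an $n\times n$ matrix $\mathbf A=(a_{st})$ with zero diagonal, $\widetilde{\mathbf A}=(\tilde a_{st})$ has $\tilde a_{ss}=0$ and, for $s\neq t$, $\tilde a_{st}=a_{st}-\frac1{n-2}\sum_{v}a_{sv}-\frac1{n-2}\sum_{u}a_{ut}+\frac1{(n-1)(n-2)}\sum_{u,v}a_{uv}$; $(\widetilde{\mathbf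 A}\cdot\widetilde{\mathbf B})=\frac1{n(n-3)}\sum_{s\ne t}\tilde a_{st}\tilde b_{st}$. Unified quantity. Let $k,l$ be symmetric bivariate kernels on $\mathbb R$ (for instance $k(x,y)=l(x,y)=|x-y|$ or $k(x,y)=l(x,y)=|x-y|^2$). For $s\neq t$ put $k_{st}(i)=k(x_{si},x_{ti})-E[k(x_{si},x_{ti})|x_{si}]-E[k(x_{si},x_{ti})|x_{ti}]+E[k(x_{si},x_{ti})]$, and $l_{st}(j)=l(y_{sj},y_{tj})-E[l(y_{sj},y_{tj})|y_{sj}]-E[l(y_{sj},y_{tj})|y_{tj}]+E[l(y_{sj},y_{tj})]$. Let $\mathbf K(i)=(k_{st}(i))_{s,t}$, $\mathbf L(j)=(l_{st}(j))_{s,t}$ with zero diagonals, and $$uCov_n^2(\mathbf X,\mathbf Y)=\frac1{\sqrt{pq}}\sum_{i=1}^p\sum_{j=1}^q(\widetilde{\mathbf K}(i)\cdot\widetilde{\mathbf L}(j)).$$ $uCov_n^2(\mathbf X,\mathbf X)$ is the same expression with $(\mathbf Y,l,q)$ replaced by $(\mathbf X,k,p)$; similarly for $uCov_n^2(\mathbf Y,\mathbf Y)$. *)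

(* Defs.v *)
From HB Require Import structures.
From mathcomp Require Export all_boot all_order all_algebra.
From mathcomp Require Export all_classical all_reals all_analysis.
From mathcomp Require Import measurable_realfun.
Export Order.TTheory GRing.Theory Num.Theory.
Export numFieldNormedType.Exports.

Set Implicit Arguments.
Unset Strict Implicit.
Unset Printing Implicit Defensive.

Local Open Scope classical_set_scope.
Local Open Scope ring_scope.

Definition lt_pairs (n : nat) : pred ('I_n * 'I_n) :=
  fun st => (st.1 < st.2)%N.
Arguments lt_pairs : clear implicits.

Lemma card_lt_pairs n : #|lt_pairs n| = (n * n.-1)./2.
Proof.
rewrite -bin2 -sum1_card.
rewrite -(pair_big_dep xpredT (fun i j : 'I_n => (i < j)%N) (fun _ _ => 1%N)) /=.
rewrite (exchange_big_dep xpredT) //=.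
rewrite -bin2_sum big_mkord; apply: eq_bigr => j _.
rewrite sum1_card -[RHS]card_ord.
have h (i : 'I_j) : (i < n)%N by exact: ltn_trans (ltn_ord i) (ltn_ord j).
pose f (i : 'I_j) : 'I_n := Ordinal (h i).
have finj : injective f by move=> x y [] /val_inj.
rewrite -(fintype.card_image finj); apply: eq_card => i; rewrite unfold_in.
apply/idP/fintype.imageP => [ij|[k _ ->]]; last exact: (ltn_ord k).
by exists (Ordinal ij) => //; exact: val_inj.
Qed.

(** The [e]-th pair [(s, t)] with [s < t]; it indexes the coordinates of
    vectors of length [n (n - 1) / 2]. *)
Definition pair_of n (e : 'I_((n * n.-1)./2)) : 'I_n * 'I_n :=
  enum_val (cast_ord (esym (card_lt_pairs n)) e).

Section ucentering.
Context {R : realType} {n : nat}.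
Implicit Types A B : 'M[R]_n.

Definition ucenter A : 'M[R]_n := \matrix_(s, t)
  if s == t then 0 else
    A s t - (n%:R - 2)^-1 * \sum_v A s v - (n%:R - 2)^-1 * \sum_u A u t
    + ((n%:R - 1) * (n%:R - 2))^-1 * \sum_u \sum_v A u v.

Definition udot A B : R :=
  (n%:R * (n%:R - 3))^-1 * \sum_s \sum_(t | s != t) A s t * B s t.

Definition uCov2 {p q : nat} (K : 'I_p -> 'M[R]_n) (L : 'I_q -> 'M[R]_n) : R :=
  (Num.sqrt (p%:R * q%:R))^-1 *
  \sum_(i < p) \sum_(j < q) udot (ucenter (K i)) (ucenter (L j)).

(** [p^(-1/2) sum_i K(i)_{st}], [s < t], as a column vector. *)
Definition scaled_pair_sums {p : nat} (K : 'I_p -> 'M[R]_n) :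
    'cV[R]_((n * n.-1)./2) :=
  \col_e ((Num.sqrt p%:R)^-1 *
          \sum_(i < p) K i (pair_of e).1 (pair_of e).2).

End ucentering.

Section conditional_expectation.
Context {R : realType} {d : measure_display} {T : measurableType d}.
Variable P : probability T R.
Implicit Types X Z W : T -> R.

(** [W] is a version of [E[X | Z]]. *)
Definition is_condexp X Z W : Prop :=
  [/\ P.-integrable setT (EFin \o W),
      forall B : set R, measurable B -> g_sigma_algebra_preimage Z (W @^-1` B) &
      forall A : set T, g_sigma_algebra_preimage Z A ->
        (\int[P]_(w in A) (W w)%:E = \int[P]_(w in A) (X w)%:E)%E].

(** A chosen version; it depends on [X] and [Z] only. Junk value 0 when there
    is no version, which cannot happen for integrable [X]
    and measurable [Z]. *)
Definition condexp X Z : T -> R := xget (cst 0) (is_condexp X Z).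

Definition double_centered (k : R -> R -> R) (x y : T -> R) (w : T) : R :=
  let kxy := fun w' => k (x w') (y w') in
  kxy w - condexp kxy x w - condexp kxy y w + fine 'E_P[kxy]%E.

Definition kernel_mx {n : nat} (k : R -> R -> R) (x : 'I_n -> T -> R) (w : T) :
    'M[R]_n :=
  \matrix_(s, t) if s == t then 0 else double_centered k (x s) (x t) w.

End conditional_expectation.

Section laws.
Context {R : realType}.

Definition mutually_independent {d d' : measure_display} {T : measurableType d}
    {T' : measurableType d'} (P : probability T R) {n : nat}
    (Z : 'I_n -> {RV P >-> T'}) : Prop :=
  forall A : 'I_n -> set T', (forall s, measurable (A s)) ->
    P (\bigcap_(s in [set: 'I_n]) (Z s @^-1` A s)) =
    (\prod_(s < n) P (Z s @^-1` A s))%E.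

(** [Z p q] converges in distribution to [Zlim] as [min p q] tends to infinity. *)
Definition cvg_in_dist {V : topologicalType}
    {d : nat -> nat -> measure_display}
    {T : forall p q, measurableType (d p q)}
    (P : forall p q, probability (T p q) R) (Z : forall p q, T p q -> V)
    {d' : measure_display} {T' : measurableType d'}
    (Q : probability T' R) (Zlim : T' -> V) : Prop :=
  forall f : V -> R, continuous f -> bounded_fun f ->
    ('E_(P pq.1 pq.2)[fun w => f (Z pq.1 pq.2 w)])%E
      @[pq --> filter_prod \oo \oo] --> ('E_Q[fun w => f (Zlim w)])%E.

(** N(m, v), with [v] the variance; N(m, 0) is the point mass at [m].
    (The library's [normal_prob m 0] is the uniform law on [[0, 1]].) *)
Definition normal_law (m v : R) (B : set R) : \bar R :=
  if v == 0 then dirac m B else normal_prob m (Num.sqrt v) B.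

Section gaussian_vectors.
Context {d : measure_display} {T : measurableType d} (Q : probability T R).
Context {m : nat} (Z : T -> 'cV[R]_m).

(** Every linear combination of the coordinates is normal,
    possibly degenerate. *)
Definition jointly_gaussian : Prop :=
  forall a : 'cV[R]_m, exists mu v : R, 0 <= v /\
    forall B : set R, measurable B ->
      Q ((fun w => (a^T *m Z w) 0 0) @^-1` B) = normal_law mu v B.

Definition multinormal (mu : 'cV[R]_m) (Sigma : 'M[R]_m) : Prop :=
  forall a : 'cV[R]_m, 0 <= (a^T *m Sigma *m a) 0 0 /\
    forall B : set R, measurable B ->
      Q ((fun w => (a^T *m Z w) 0 0) @^-1` B) =
      normal_law ((a^T *m mu) 0 0) ((a^T *m Sigma *m a) 0 0) B.

End gaussian_vectors.

(* [normal_prob] lives on [measurableTypeR R], which has the same measurable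
   sets as [R] but a different display. *)
Definition add_square (z : R * measurableTypeR R) : R := z.1 + (z.2 : R) ^+ 2.

Lemma measurable_add_square :
  measurable_fun [set: (R * measurableTypeR R)%type] add_square.
Proof.
apply: measurable_funD; first exact: measurable_fst.
by apply: measurable_funX; exact: measurable_snd.
Qed.

HB.instance Definition _ :=
  isMeasurableFun.Build _ _ _ _ add_square measurable_add_square.

(** Law of a sum of [v] independent squared standard normal variables. *)
Fixpoint chi_square (v : nat) : probability R R :=
  if v is v'.+1 then
    distribution (chi_square v' \x normal_prob (0 : R) 1)%E add_square
  else \d_(0 : R).

(** Law of [a * chi^2_v]. *)
Definition scaled_chi_square (a : R) (v : nat) (B : set R) : \bar R :=
  chi_square v ((fun x => a * x) @^-1` B).

End laws.

(** Orthogonal projection. *)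
Definition is_projection_mx {R : realType} {m : nat} (M : 'M[R]_m) : Prop :=
  M *m M = M /\ M^T = M.

(* Main.v *)
(** U-centering is an orthogonal projection [M] of rank [v] on the vectors of
    entries above the diagonal, so that uCov is exactly [v^-1 a^T M b] in terms
    of the scaled sums [a], [b] of the kernels; the convergence statements
    follow by continuity. Doubly centered kernels are degenerate, so the sums at
    distinct pairs are uncorrelated, and at equal pairs their covariances
    converge by assumption. Fatou's lemma bounds the second moments of the
    limit by those of [Sigma]; as the variances of the limit reach this bound,
    its means vanish and [Sigma - E Z Z^T] is a positive semidefinite matrix
    with zero diagonal, hence 0.

    For the chi-square laws, write [M = O^T O] with [O O^T = 1]: the squared
    norm of [O c] has to be identified from the laws of the linear combinations
    [a . W] of a vector [W]. For a standard Gaussian [V] independent of [W],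
    [E u(V . W)] depends only on the law of [|W|^2] on the one hand (fix [W])
    and on the laws of the [a . W] on the other hand (fix [V]). With
    [u x = x^(2 k) exp(- x^2 / 2)] this yields the moments of [r / (1 + r)] with
    weight [(1 + r)^(- 1 / 2)], where [r = |W|^2]; a polynomial approximation
    of the inverse weight removes it, and the moments determine the law. *)
From HB Require Import structures.
From mathcomp Require Import ring lra measurable_realfun.
Require Import Defs.

Set Implicit Arguments.
Unset Strict Implicit.
Unset Printing Implicit Defensive.

Import HBNNSimple.

Local Open Scope classical_set_scope.
Local Open Scope ring_scope.

(** * U-centering as a projection *)

(** Convergence in distribution does not carry second moments to the limit, so the covariance matrix
    of the limit has to be forced by a one-sided bound together with its known diagonal. Before the
    limit, square integrability of the centered kernels is not assumed either: it is read off from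
    the finiteness of the covariance sums and holds for large [p], [q] only. Joint Gaussianity gives
    every linear form a normal law with unspecified parameters, which must be matched with
    integrals. Mean and variance of a normal law are obtained from [1 + x <= exp x], applied to
    exponentials that turn one normal density into a multiple of another. The factor
    [exp (- x^2 / 2)] in the test function avoids a moment problem on the half line: it replaces the
    unbounded [r] by [s = r / (1 + r)] in [[0, 1)], where explicit polynomials approximate the
    indicators of rays. The inverse weight [(1 - s)^(-1/2)] is unbounded near 1; its approximations
    [q] are therefore chosen with [(1 - s) q^2 <= 1], which keeps the weighted polynomials in
    [[0, 1]] and makes dominated convergence applicable. *)

Lemma sum_pair_of (V : nmodType) n (F : 'I_n -> 'I_n -> V) :
  \sum_(e < (n * n.-1)./2) F (pair_of e).1 (pair_of e).2 =
  \sum_(s < n) \sum_(t < n | (s < t)%N) F s t.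
Proof.
rewrite pair_big_dep /=.
transitivity (\sum_(p in lt_pairs n) F p.1 p.2); last exact: eq_bigl.
rewrite [RHS]big_enum_val [RHS](reindex (cast_ord (esym (card_lt_pairs n)))) //=.
by apply: onW_bij; exists (cast_ord (card_lt_pairs n)) => e;
  rewrite ?cast_ordK ?cast_ordKV.
Qed.

Lemma lt_pair_of n (e : 'I_((n * n.-1)./2)) : ((pair_of e).1 < (pair_of e).2)%N.
Proof. exact: (enum_valP (cast_ord (esym (card_lt_pairs n)) e)). Qed.

Lemma pair_of_inj n : injective (@pair_of n).
Proof. by move=> e e' /enum_val_inj/cast_ord_inj. Qed.

Lemma sum_offdiag (V : nmodType) n (F : 'I_n -> 'I_n -> V) :
  \sum_(s < n) \sum_(t < n | s != t) F s t =
  \sum_(e < (n * n.-1)./2) F (pair_of e).1 (pair_of e).2 +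
  \sum_(e < (n * n.-1)./2) F (pair_of e).2 (pair_of e).1.
Proof.
rewrite (sum_pair_of F) (sum_pair_of (fun s t => F t s)).
rewrite [X in _ = _ + X](exchange_big_dep xpredT) //= -big_split /=.
apply: eq_bigr => s _; rewrite (bigID (fun t : 'I_n => (s < t)%N)) /=.
congr +%R; apply: eq_bigl => t.
  by rewrite -val_eqE /=; case: ltngtP.
by rewrite -val_eqE /=; case: ltngtP.
Qed.

Section projection.
Context {R : realType} {n : nat} (hn : (4 <= n)%N).
Local Notation N := ((n * n.-1)./2).

(** The unsigned incidence matrix of the complete graph on [n] vertices, whose edges are the pairs
    [s < t]. Its column span is what U-centering projects away. *)
Definition pair_incidence : 'M[R]_(N, n) :=
  \matrix_(e, u) (((pair_of e).1 == u)%:R + ((pair_of e).2 == u)%:R).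

(** The inverse of [(n - 2) I + J] with [J] all ones: as [J^2 = n J], the coefficient of the
    correction is [1 / ((n - 2) + n) = 1 / (2 (n - 1))]. *)
Definition incidence_gram_inv : 'M[R]_n :=
  (n%:R - 2)^-1 *: (1%:M - ((n%:R - 1) * 2)^-1 *: const_mx 1).

Definition ucenter_proj : 'M[R]_N :=
  1%:M - pair_incidence *m incidence_gram_inv *m pair_incidence^T.

Local Notation H := pair_incidence.
Local Notation C := incidence_gram_inv.

Definition pair_vec (A : 'M[R]_n) : 'cV[R]_N :=
  \col_e A (pair_of e).1 (pair_of e).2.

Lemma natr_ge4 : 4 <= n%:R :> R. Proof. by rewrite ler_nat. Qed.

Definition hollow_symmetric (A : 'M[R]_n) :=
  (forall s, A s s = 0) /\ (forall s t, A s t = A t s).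

(** A row sum is an off-diagonal double sum weighted by the indicator of the row, so each pair
    contributes once from either end. *)
Lemma incidence_pair_vec (A : 'M[R]_n) : hollow_symmetric A ->
  H^T *m pair_vec A = \col_s \sum_t A s t.
Proof.
move=> [A0 As]; apply/matrixP => s j; rewrite !mxE.
have -> : \sum_t A s t = \sum_u \sum_(t | u != t) (u == s)%:R * A u t.
  rewrite (bigD1 s) //= A0 add0r [RHS](bigD1 s) //= [X in _ = _ + X]big1 ?addr0.
    apply: eq_big => [t|t _]; first by rewrite eq_sym.
    by rewrite eqxx mul1r.
  move=> u us; rewrite big1 // => t _; by rewrite (negbTE us) mul0r.
rewrite sum_offdiag -big_split /=; apply: eq_bigr => e _; rewrite !mxE.
by rewrite (As (pair_of e).2) mulrDl.
Qed.

(** Degree plus adjacency in the complete graph: [(n - 1) I + (J - I)]. Each column of [H] is itself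
    the pair vector of a hollow symmetric matrix, so the Gram matrix reduces to row sums. *)
Lemma incidence_gram : H^T *m H = (n%:R - 2)%:M + const_mx 1.
Proof.
have n4 := natr_ge4.
apply/matrixP => s u; pose A : 'M[R]_n := \matrix_(s, t)
  if s == t then 0 else (s == u)%:R + (t == u)%:R.
have hA : hollow_symmetric A.
  by split => [x|x y]; rewrite !mxE ?eqxx // eq_sym addrC.
have -> : (H^T *m H) s u = (H^T *m pair_vec A) s 0.
  rewrite !mxE; apply: eq_bigr => e _; rewrite !mxE; congr (_ * _).
  by rewrite ifN // neq_ltn lt_pair_of.
rewrite incidence_pair_vec // !mxE (bigD1 s) //= mxE eqxx add0r.
have -> : \sum_(i < n | i != s) A s i =
   \sum_(i < n | i != s) ((s == u)%:R + (i == u)%:R).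
  by apply: eq_bigr => i si; rewrite mxE eq_sym (negbTE si).
rewrite big_split /= sumr_const.
have -> : #|[pred i | i != s]| = n.-1 by rewrite cardC1 card_ord.
have hn1 : (n.-1)%:R = n%:R - 1 :> R.
  by rewrite -subn1 natrB //; apply: leq_trans hn.
rewrite -[_ *+ n.-1]mulr_natr hn1.
have [<-|su] := eqVneq s u.
  rewrite big1 => [|i /negbTE -> //]; rewrite ?mulr1n ?mulr1; lra.
rewrite (bigD1 u) 1?eq_sym //= eqxx big1 => [|i /andP[_ /negbTE ->] //].
by rewrite mul0r mulr0n addr0.
Qed.

Lemma incidence_gramK : C *m (H^T *m H) = 1%:M.
Proof.
have n4 := natr_ge4.
rewrite incidence_gram /incidence_gram_inv -scalemxAl mulmxBl mul1mx.
rewrite -scalemxAl mulmxDr scalar_mxC mul_scalar_mx.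
have -> : (const_mx 1 : 'M[R]_n) *m const_mx 1 = n%:R *: (const_mx 1 : 'M[R]_n).
  apply/matrixP => i j; rewrite !mxE; under eq_bigr do rewrite !mxE mulr1.
  by rewrite sumr_const card_ord mulr1.
rewrite -scalerDl scalerA.
apply/matrixP => i j; rewrite !mxE.
case: (i == j); rewrite ?mulr1n ?mulr0n; field; lra.
Qed.

Lemma tr_incidence_gram_inv : C^T = C.
Proof. by rewrite /C linearZ /= linearB /= linearZ /= trmx1 trmx_const. Qed.

Lemma ucenter_proj_projection : is_projection_mx ucenter_proj.
Proof.
have PP : H *m C *m H^T *m (H *m C *m H^T) = H *m C *m H^T.
  by rewrite -!mulmxA (mulmxA C) (mulmxA (C *m _)) -(mulmxA C) incidence_gramK mul1mx.
split; last first.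
  rewrite /ucenter_proj linearB /= trmx1 !trmx_mul trmxK tr_incidence_gram_inv.
  by rewrite mulmxA.
rewrite {1}/ucenter_proj mulmxBl mul1mx /ucenter_proj mulmxBr mulmx1 PP.
by rewrite subrr subr0.
Qed.

Lemma card_pairs_sub : ((n * (n - 3))./2 = (n * n.-1)./2 - n)%N.
Proof.
have -> : (n * n.-1 = n * (n - 3) + n.*2)%N.
  rewrite -muln2 -mulnDr; congr muln.
  by move: n hn => [|[|[|m]]] // _; rewrite /= !subSS subn0 addn2.
by rewrite halfD doubleK odd_double andbF add0n addnK.
Qed.

Lemma double_card_proj : ((n * (n - 3))./2)%:R * 2 = n%:R * (n%:R - 3) :> R.
Proof.
rewrite -natrM muln2 -[n%:R - 3](@natrB R n 3) ?(leq_trans _ hn) // -natrM.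
by rewrite -[in RHS](odd_double_half (n * (n - 3))) oddM oddB ?(leq_trans _ hn) //;
  case: (odd n).
Qed.

(** Cyclicity turns the trace of the removed part into that of the [n x n] identity. For a
    projection the trace is the rank, and [orthonormal_factor] takes it in this form. *)
Lemma trace_ucenter_proj : \tr ucenter_proj = ((n * (n - 3))./2)%:R.
Proof.
rewrite card_pairs_sub natrB; last first.
  rewrite -[leqLHS]half_double half_leq // -muln2 leq_mul2l; apply/orP; right.
  by move: n hn => [|[|[|m]]].
rewrite /ucenter_proj linearB /= mxtrace1 -mulmxA mxtrace_mulC -mulmxA.
by rewrite incidence_gramK mxtrace1.
Qed.

(** With [r] the row sums and [S] their total, [C] sends [r] to [(r u - S / (2 (n - 1))) / (n - 2)].
    Adding the values at both ends of a pair doubles the last term, which produces the coefficient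
    [1 / ((n - 1) (n - 2))] of U-centering. *)
Lemma ucenter_pair_vec (A : 'M[R]_n) : hollow_symmetric A ->
  pair_vec (ucenter A) = ucenter_proj *m pair_vec A.
Proof.
have n4 := natr_ge4.
move=> hA; rewrite /ucenter_proj mulmxBl mul1mx -!mulmxA incidence_pair_vec //.
apply/matrixP => e j; rewrite !mxE ifN ?neq_ltn ?lt_pair_of //.
have [A0 As] := hA.
set s := (pair_of e).1; set t := (pair_of e).2.
under [X in _ - _ - (_ * X)]eq_bigr do rewrite As.
set r := fun s => \sum_v A s v.
have Cr u : (C *m \col_s \sum_t A s t) u 0 =
    (n%:R - 2)^-1 * (r u - ((n%:R - 1) * 2)^-1 * \sum_v r v).
  rewrite /C -scalemxAl mulmxBl mul1mx -scalemxAl !mxE; congr (_ * (_ - _ * _)).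
  by apply: eq_bigr => v _; rewrite !mxE mul1r.
pose z u := (n%:R - 2)^-1 * (r u - ((n%:R - 1) * 2)^-1 * \sum_v r v).
rewrite [X in _ = _ - X](eq_bigr (fun u => (s == u)%:R * z u + (t == u)%:R * z u)).
  2: by move=> u _; rewrite ord1 Cr !mxE mulrDl.
rewrite big_split /=.
have sum1 w (F : 'I_n -> R) : \sum_i (w == i)%:R * F i = F w.
  rewrite (bigD1 w) //= eqxx mul1r big1 ?addr0 // => i.
  by rewrite eq_sym => /negbTE ->; rewrite mul0r.
rewrite !sum1 /z /r; set X := \sum_v A s v; set Y := \sum_v A t v; set Z := \sum_u _.
field; lra.
Qed.

Lemma ucenter_hollow_symmetric (A : 'M[R]_n) :
  hollow_symmetric A -> hollow_symmetric (ucenter A).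
Proof.
move=> [A0 As]; split=> [s|s t]; rewrite !mxE ?eqxx // eq_sym.
case: eqP => // _; rewrite As; congr (_ + _).
rewrite -!addrA [in RHS](addrC (- _)).
by congr (_ + (- (_ * _) - _ * _)); apply: eq_bigr => i _; rewrite As.
Qed.

(** Symmetry makes the off-diagonal sum twice the sum over pairs, which matches [n (n - 3) = 2 v];
    idempotence merges the two centerings into one factor. *)
Lemma udot_ucenter (A B : 'M[R]_n) : hollow_symmetric A -> hollow_symmetric B ->
  udot (ucenter A) (ucenter B) =
  ((n * (n - 3))./2)%:R^-1 * ((pair_vec A)^T *m ucenter_proj *m pair_vec B) 0 0.
Proof.
move=> hA hB; have n4 := natr_ge4.
have [MM MT] := ucenter_proj_projection.
have [_ As] := ucenter_hollow_symmetric hA.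
have [_ Bs] := ucenter_hollow_symmetric hB.
have -> : (pair_vec A)^T *m ucenter_proj *m pair_vec B =
    (pair_vec (ucenter A))^T *m pair_vec (ucenter B).
  by rewrite !ucenter_pair_vec // trmx_mul MT -!mulmxA (mulmxA ucenter_proj) MM.
rewrite /udot sum_offdiag mxE.
have -> : \sum_e ucenter A (pair_of e).2 (pair_of e).1 *
    ucenter B (pair_of e).2 (pair_of e).1 =
    \sum_e ucenter A (pair_of e).1 (pair_of e).2 *
    ucenter B (pair_of e).1 (pair_of e).2.
  by apply: eq_bigr => e _; rewrite As Bs.
rewrite [X in _ = _ * X](eq_bigr (fun e => ucenter A (pair_of e).1 (pair_of e).2 *
    ucenter B (pair_of e).1 (pair_of e).2)).
  2: by move=> e _; congr (_ * _); rewrite [LHS]mxE // [LHS]mxE.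
set X := \sum_(e < N) _.
have := double_card_proj; set w := (_./2)%:R => hw.
have -> : w = (n%:R * (n%:R - 3)) / 2 by rewrite -hw mulfK.
field; lra.
Qed.

End projection.

(** Induction on the trace: a nonzero column of [M], normalised to [u], is fixed by [M], and
    [M - u u^T] is again a projection with trace smaller by one. The row [u^T] is put on top of the
    factor of the latter. *)
Lemma orthonormal_factor {R : realType} (m r : nat) (M : 'M[R]_m) :
  is_projection_mx M -> \tr M = r%:R ->
  exists O : 'M[R]_(r, m), O *m O^T = 1%:M /\ O^T *m O = M.
Proof.
elim: r M => [|r IH] M [MM MT] trM.
  exists 0; split; first by apply/matrixP => -[].
  rewrite mulmx0; apply/esym/matrixP => i j; rewrite mxE; apply/eqP.
  (* This trace is the sum of the squares of all entries of [M]. *)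
  have : \tr (M^T *m M) = 0 by rewrite MT MM trM.
  rewrite /mxtrace => /eqP; rewrite psumr_eq0; last first.
    by move=> k _; rewrite mxE sumr_ge0 // => l _; rewrite mxE -expr2 sqr_ge0.
  move=> /allP /(_ j (mem_index_enum _)); rewrite mxE psumr_eq0; last first.
    by move=> k _; rewrite mxE -expr2 sqr_ge0.
  by move=> /allP /(_ i (mem_index_enum _)); rewrite mxE mulf_eq0 orbb.
have [j Mj0] : exists j, col j M != 0.
  apply/existsP; rewrite -[[exists _, _]]negbK negb_exists; apply/negP => /forallP h.
  have M0 : M = 0.
    apply/matrixP => i j; move: (h j); rewrite negbK => /eqP/matrixP/(_ i 0).
    by rewrite !mxE.
  by move/eqP: trM; rewrite M0 mxtrace0 eq_sym pnatr_eq0.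
pose q := ((col j M)^T *m col j M) 0 0.
have q0 : 0 < q.
  rewrite lt_neqAle /q mxE sumr_ge0 => [|k _]; last by rewrite mxE -expr2 sqr_ge0.
  rewrite andbT eq_sym psumr_eq0 => [|k _]; last by rewrite mxE -expr2 sqr_ge0.
  apply/negP => /allP h; move/negP: Mj0; apply; apply/eqP/matrixP => k l.
  move: (h k (mem_index_enum _)); rewrite mxE mulf_eq0 orbb ord1 => /eqP ->.
  by rewrite mxE.
pose u : 'cV[R]_m := (Num.sqrt q)^-1 *: col j M.
have uu : u^T *m u = 1%:M.
  rewrite /u -scalemxAr.
  rewrite (_ : (_ *: col j M)^T = (Num.sqrt q)^-1 *: (col j M)^T); last first.
    by rewrite linearZ.
  rewrite -scalemxAl scalerA.
  apply/matrixP => a b; rewrite !ord1 mxE -/q -invfM -expr2 sqr_sqrtr ?ltW //.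
  by rewrite mulVf ?gt_eqF // mxE eqxx.
have Mu : M *m u = u by rewrite /u -scalemxAr colE mulmxA MM.
have uM : u^T *m M = u^T by rewrite -{1}MT -trmx_mul Mu.
case: (IH (M - u *m u^T)).
- split; last by rewrite linearB /= trmx_mul trmxK MT.
  rewrite mulmxBl !mulmxBr MM (mulmxA M u) Mu -(mulmxA u _ M) uM.
  by rewrite -(mulmxA u u^T) (mulmxA u^T u) uu mul1mx subrr subr0.
- by rewrite linearB /= trM mxtrace_mulC uu mxtrace1 -natrB // subn1.
move=> O [OO1 OOM].
(* [O] equals [O *m (M - u *m u^T)] because [O *m O^T = 1], and [M - u *m u^T] kills [u]. *)
have Ou : O *m u = 0.
  rewrite -{1}(mul1mx O) -OO1 -!mulmxA (mulmxA _ O u) OOM mulmxBl Mu -(mulmxA u) uu.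
  by rewrite mulmx1 subrr mulmx0.
exists (col_mx u^T O); rewrite -[r.+1]/(1 + r)%N tr_col_mx trmxK; split.
  rewrite mul_col_row uu OO1 Ou -(trmxK O) -trmx_mul.
  rewrite trmxK Ou trmx0 -scalar_mx_block //.
by rewrite mul_row_col OOM addrC subrK.
Qed.

(** The identity of size [r] is [O *m (O^T *m O) *m O^T], so the middle factor has rank at least
    [r]. *)
Lemma rank_orthonormal_factor {R : realType} (m r : nat) (O : 'M[R]_(r, m)) :
  O *m O^T = 1%:M -> \rank (O^T *m O) = r.
Proof.
move=> OO; apply/eqP; rewrite eqn_leq; apply/andP; split.
  by rewrite (leq_trans (mxrankM_maxr _ _)) // rank_leq_row.
rewrite -[leqLHS](@mxrank1 R) -[1%:M]mul1mx -{1}OO -OO -mulmxA (mulmxA _ O).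
by rewrite (leq_trans (mxrankM_maxr _ _)) // mxrankM_maxl.
Qed.

(** * Gaussian laws *)

Section density.
Local Open Scope ereal_scope.
Context d (T : measurableType d) (R : realType).

(** Checked on simple functions and extended by monotone convergence. It is needed because normal
    laws are known through set integrals of their density. *)
Lemma ge0_integral_density (mu nu : {measure set T -> \bar R}) (g : T -> R) :
  measurable_fun [set: T] g -> (forall x, (0 <= g x)%R) ->
  (forall A, measurable A -> nu A = \int[mu]_(x in A) (g x)%:E) ->
  forall f : T -> \bar R, measurable_fun [set: T] f -> (forall x, 0 <= f x) ->
  \int[nu]_x f x = \int[mu]_x (f x * (g x)%:E).
Proof.
move=> mg g0 nuE f mf f0; have mgE : measurable_fun setT (EFin \o g) by exact/measurable_EFinP.
pose f_ := nnsfun_approx measurableT mf.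
have cvg_f x : (f_ n x)%:E @[n --> \oo] --> f x by exact: cvg_nnsfun_approx.
have nd_f x : {homo (fun n => (f_ n x)%:E) : m n / (m <= n)%N >-> m <= n}.
  by move=> m n mn; rewrite lee_fin; exact/lefP/nd_nnsfun_approx.
have mf_ n : measurable_fun [set: T] (fun x => (f_ n x)%:E).
  exact/measurable_EFinP.
transitivity (limn (fun n => \int[nu]_x (f_ n x)%:E)).
  rewrite -monotone_convergence //=.
  - by apply: eq_integral => x _; apply/esym/cvg_lim.
  - by move=> n x _; rewrite lee_fin.
have -> : limn (fun n => \int[nu]_x (f_ n x)%:E) =
    limn (fun n => \int[mu]_x ((f_ n x)%:E * (g x)%:E)).
  apply: congr_lim; apply/funext => n /=.
  under eq_integral do rewrite fimfunE -fsumEFin//.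
  rewrite ge0_integral_fsum//; last 2 first.
  - by move=> r; exact/measurable_EFinP/measurableT_comp.
  - by move=> r x _; rewrite EFinM nnfun_muleindic_ge0.
  under [RHS]eq_integral.
    move=> x _; rewrite fimfunE -fsumEFin// ge0_mule_fsuml; last first.
      by move=> r; rewrite EFinM nnfun_muleindic_ge0.
    over.
  rewrite [RHS]ge0_integral_fsum//; last 2 first.
  - move=> r; apply: emeasurable_funM => //.
    by apply/measurable_EFinP; do 2 apply/measurableT_comp => //.
  - move=> r x _; rewrite mule_ge0// ?lee_fin//.
    by rewrite -lee_fin EFinM nnfun_muleindic_ge0.
  apply: eq_fsbigr => r _; rewrite integralZl_indic_nnsfun// integral_indic//=.
  rewrite setIT nuE//.
  have [r0|r0] := ltP r 0%R.
    rewrite preimage_nnfun0// integral_set0 mule0 integral0_eq// => x _.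
    by rewrite indicE in_set0 mulr0 mul0e.
  rewrite integral_mkcond/= -ge0_integralZl//=.
  - apply: eq_integral => x _; rewrite patchE indicE.
    by case: ifP; rewrite ?mulr1 ?mulr0 ?mul0e ?mule0.
  - by apply/(measurable_restrictT _ _).1 => //; exact: measurable_funTS.
  - by move=> x _; rewrite patchE; case: ifP => // _; rewrite lee_fin.
rewrite -monotone_convergence //=.
- apply: eq_integral => x _; apply/cvg_lim => //.
  by apply: cvgeMr => //.
- by move=> n; apply: emeasurable_funM.
- by move=> n x _; rewrite mule_ge0 ?lee_fin.
- by move=> x _ m n mn; rewrite lee_wpmul2r ?lee_fin//; exact/lefP/nd_nnsfun_approx.
Qed.

End density.

(** Lebesgue measure is [|b|] times its image under the affine map: by uniqueness, half-open
    intervals are enough. *)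
Lemma ge0_integral_affine {R : realType} (h b : R) (f : R -> \bar R) : b != 0 ->
  measurable_fun [set: R] f -> (forall x, 0 <= f x)%E ->
  (\int[lebesgue_measure]_x f x =
   `|b|%:E * \int[lebesgue_measure]_x f (h + b * x)%R)%E.
Proof.
move=> b0 mf f0; pose aff (x : measurableTypeR R) : measurableTypeR R := h + b * x.
have maff : measurable_fun [set: measurableTypeR R] aff.
  by apply: measurable_funD => //; apply: measurable_funM.
pose pm := measure_function_pushforward__canonical__measure_function_Measure
  (@lebesgue_measure R) maff.
pose m' := mscale (NngNum (normr_ge0 b)) pm.
have mu_m' A : measurable A -> lebesgue_measure A = m' A.
  move=> mA; apply: lebesgue_measure_unique => // _ [[u v]] _ <-.
  transitivity (`|b|%:E * lebesgue_measure (aff @^-1` `]u, v]%classic))%E; last by [].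
  rewrite /=.
  have [b_gt0|b_le0] := ltP 0 b.
    have -> : aff @^-1` `]u, v] = `](u - h) / b, (v - h) / b]%classic.
      apply/seteqP; split => x /=; rewrite !in_itv /= /aff.
        by rewrite ltr_pdivrMr // ler_pdivlMr // (mulrC x) ltrBlDl lerBrDl.
      by rewrite ltr_pdivrMr // ler_pdivlMr // (mulrC x) ltrBlDl lerBrDl.
    rewrite !lebesgue_measure_itv /= !lte_fin ltr_pM2r ?invr_gt0 // ltrD2r.
    case: ifP => // _; rewrite ?mule0 // -!EFinB -EFinM; congr _%:E.
    rewrite gtr0_norm //; field; lra.
  (* A negative slope exchanges the ends, hence also the side on which the interval is closed; the
     length formula is the same. *)
  have b_lt0 : b < 0 by rewrite lt_neqAle b0.
  have -> : aff @^-1` `]u, v] = `[(v - h) / b, (u - h) / b[%classic.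
    apply/seteqP; split => x /=; rewrite !in_itv /= /aff.
      by rewrite ltr_ndivlMr // ler_ndivrMr // (mulrC x) ltrBlDl lerBrDl andbC.
    by rewrite ltr_ndivlMr // ler_ndivrMr // (mulrC x) ltrBlDl lerBrDl andbC.
  rewrite !lebesgue_measure_itv /= !lte_fin ltr_nM2r ?invr_lt0 // ltrD2r.
  case: ifP => // _; rewrite ?mule0 // -!EFinB -EFinM; congr _%:E.
  rewrite ltr0_norm //; field; lra.
transitivity (\int[m']_x f x)%E.
  by apply: eq_measure_integral => A mA _; exact: mu_m'.
rewrite ge0_integral_mscale //; congr *%E.
by rewrite ge0_integral_pushforward.
Qed.

Lemma Rintegral_prob_cst d (T : measurableType d) (R : realType)
  (P : probability T R) (c : R) : \int[P]_w c = c.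
Proof.
have := integral_cst P (@measurableT _ T) c%:E.
by rewrite /Rintegral => ->; rewrite /= probability_setT mule1.
Qed.

Lemma ge0_integral_law d d' (T : measurableType d) (U : measurableType d')
    (R : realType) (P : {measure set T -> \bar R}) (nu : {measure set U -> \bar R})
    (Y : T -> U) :
  measurable_fun [set: T] Y ->
  (forall B, measurable B -> P (Y @^-1` B) = nu B) ->
  forall g : U -> \bar R, measurable_fun [set: U] g -> (forall x, 0 <= g x)%E ->
  (\int[P]_w g (Y w) = \int[nu]_x g x)%E.
Proof.
move=> mY law g mg g0.
transitivity (\int[pushforward P Y]_x g x)%E.
  by rewrite [RHS]ge0_integral_pushforward.
by apply: eq_measure_integral => // B mB _; rewrite -law.
Qed.

Lemma ge0_integral_normal (R : realType) (m s : R) (f : R -> \bar R) :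
  measurable_fun [set: R] f -> (forall x, 0 <= f x)%E ->
  (\int[normal_prob m s]_x f x =
   \int[lebesgue_measure]_x (f x * (normal_pdf m s x)%:E))%E.
Proof.
move=> mf f0; apply: ge0_integral_density => //.
- exact: measurable_normal_pdf.
- by move=> x; exact: normal_pdf_ge0.
Qed.

(** * Exponential tilts of normal densities, and the mean and variance they yield *)

Section tilt.
Context {R : realType}.
Implicit Types m s t x : R.

Lemma normal_pdfE0 m s x : 0 < s -> normal_pdf m s x =
  (Num.sqrt (2 * pi))^-1 * (s^-1 * expR (- ((x - m) / s) ^+ 2 / 2)).
Proof.
move=> s0; rewrite normal_pdfE ?gt_eqF// /normal_peak /normal_fun.
rewrite -mulrnAr sqrtrM ?sqr_ge0// sqrtr_sqr gtr0_norm// invfM.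
rewrite mulrA (mulrC s^-1) (mulrC _%R pi) mulr_natr; congr (_ * expR _).
rewrite expr_div_n; field; lra.
Qed.

Lemma normal_pdf_shift m s t x : 0 < s ->
  normal_pdf (m + t * s ^+ 2) s x =
  expR (t * (x - m) - t ^+ 2 * s ^+ 2 / 2) * normal_pdf m s x.
Proof.
move=> s0; rewrite !normal_pdfE0// [RHS]mulrCA; congr (_ * _).
rewrite [RHS]mulrCA -expRD; congr (_ * expR _); field; lra.
Qed.

Lemma normal_pdf_rescale m s r x : 0 < s -> 0 < r ->
  normal_pdf m (s * r) x =
  r^-1 * expR (- (x - m) ^+ 2 * ((r ^+ 2)^-1 - 1) / (2 * s ^+ 2)) *
  normal_pdf m s x.
Proof.
move=> s0 r0; rewrite !normal_pdfE0 ?mulr_gt0// [RHS]mulrCA; congr (_ * _).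
rewrite invfM [RHS]mulrACA (mulrC s^-1) -expRD; congr (_ * expR _); field; lra.
Qed.

(** The expectation is [c] because the tilted density integrates to [c]; the whole computation lies
    in the pointwise identity of densities. *)
Lemma integral_exp_tilt m s (e : R -> R) c m' s' : 0 <= c ->
  measurable_fun [set: R] e ->
  (forall x, c * normal_pdf m' s' x = expR (e x) * normal_pdf m s x) ->
  (\int[normal_prob m s]_x (expR (e x))%:E = c%:E)%E.
Proof.
move=> c0 me h.
rewrite ge0_integral_normal//; last first.
  by apply/measurable_EFinP; apply: measurableT_comp.
under eq_integral do rewrite -EFinM -h EFinM.
rewrite ge0_integralZl//; last 2 first.
- by apply/measurable_EFinP; exact: measurable_normal_pdf.
- by move=> x _; rewrite lee_fin normal_pdf_ge0.
by rewrite integral_normal_pdf mule1.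
Qed.

End tilt.

Section normal_moments.
Context d (T : measurableType d) (R : realType) (P : probability T R).
Variables (Y : T -> R) (m s : R).
Hypotheses (mY : measurable_fun [set: T] Y) (s0 : 0 < s).
Hypothesis law : forall B, measurable B -> P (Y @^-1` B) = normal_prob m s B.
Hypothesis iY : P.-integrable setT (EFin \o Y).
Hypothesis iY2 : P.-integrable setT (EFin \o (fun w => Y w ^+ 2)).

Let iC c : P.-integrable setT (EFin \o (fun=> c : R)).
Proof. exact: finite_measure_integrable_cst. Qed.

Let iS : P.-integrable setT (EFin \o (fun w => (Y w - m) ^+ 2)).
Proof.
apply: (eq_integrable measurableT (fun w =>
   ((Y w ^+ 2)%:E + ((- 2 * m) * Y w)%:E) + (m ^+ 2)%:E)%E) => //.
  by move=> w _ /=; rewrite -!EFinD; congr _%:E; ring.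
apply: integrableD => //; last exact: iC.
by apply: integrableD => //; exact: (integrableZl measurableT (- 2 * m) iY).
Qed.

(** The inequality [1 + x <= expR x], integrated. A family of tilts with known masses [c] bounds an
    expectation, and varying the parameter turns the bounds into an equality. *)
Let tilt (e : R -> R) c m' s' : 0 <= c ->
  measurable_fun [set: R] e ->
  (forall x, c * normal_pdf m' s' x = expR (e x) * normal_pdf m s x) ->
  P.-integrable setT (EFin \o (fun w => e (Y w))) ->
  1 + \int[P]_w e (Y w) <= c.
Proof.
move=> c0 me h ie.
have E : (\int[P]_w (expR (e (Y w)))%:E = c%:E)%E.
  rewrite (@ge0_integral_law _ _ _ (measurableTypeR R) _ _ (normal_prob m s) _ mY law
    (fun x => (expR (e x))%:E)) //; first exact: integral_exp_tilt h.
  by apply/measurable_EFinP; apply: measurableT_comp.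
have iE : P.-integrable setT (EFin \o (fun w => expR (e (Y w)))).
  apply/integrableP; split.
    by apply/measurable_EFinP; do 2 apply: measurableT_comp => //.
  by under eq_integral do rewrite /= ger0_norm ?expR_ge0//; rewrite E ltry.
rewrite -[X in X + _](Rintegral_prob_cst P) -RintegralD//.
have -> : c = \int[P]_w expR (e (Y w)) by rewrite /Rintegral E.
apply: le_Rintegral => //; last by move=> w _; exact: expR_ge1Dx.
exact: (integrableD measurableT (iC 1) ie).
Qed.

Lemma normal_mean : \int[P]_w Y w = m.
Proof.
set M := \int[P]_w Y w.
have h t : t * (M - m) <= t ^+ 2 * s ^+ 2 / 2.
  have iL : P.-integrable setT (EFin \o (fun w => t * Y w)).
    exact: (integrableZl measurableT t iY).
  have := @tilt (fun x => t * (x - m) - t ^+ 2 * s ^+ 2 / 2) 1 (m + t * s ^+ 2) s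
    ler01.
  rewrite (_ : (fun w => _) = (fun w => t * Y w + (- (t * m) - t ^+ 2 * s ^+ 2 / 2)));
    last by apply/funext => w; ring.
  rewrite RintegralD// RintegralZl// Rintegral_prob_cst -/M.
  move=> H; suff : 1 + (t * M + (- (t * m) - t ^+ 2 * s ^+ 2 / 2)) <= 1 by lra.
  apply: H.
  - apply: measurable_funB => //; apply: measurable_funM => //.
    exact: measurable_funB.
  - by move=> x; rewrite mul1r normal_pdf_shift.
  - exact: (integrableD measurableT iL (iC _)).
have sn0 : s != 0 by rewrite gt_eqF.
(* This [t] maximises [t (M - m) - t^2 s^2 / 2]; the bound then says that a square is at most half
   of itself. *)
have := h ((M - m) / s ^+ 2).
have -> : (M - m) / s ^+ 2 * (M - m) = ((M - m) / s) ^+ 2 by field.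
have -> : ((M - m) / s ^+ 2) ^+ 2 * s ^+ 2 / 2 = ((M - m) / s) ^+ 2 / 2.
  by field.
move=> H; have : ((M - m) / s) ^+ 2 == 0 by rewrite eq_le sqr_ge0 andbT; lra.
by rewrite sqrf_eq0 mulf_eq0 invr_eq0 (gt_eqF s0) orbF subr_eq0 => /eqP.
Qed.

(** Tilting by a multiple of [(x - m)^2] multiplies the standard deviation by [r] and has mass [r];
    the equality comes from letting [r] approach 1 from both sides. *)
Lemma normal_variance : \int[P]_w (Y w - m) ^+ 2 = s ^+ 2.
Proof.
set V := \int[P]_w _.
have s20 : 0 < s ^+ 2 by rewrite exprn_gt0.
have h (r : R) : 0 < r -> 1 - V * ((r ^+ 2)^-1 - 1) / (2 * s ^+ 2) <= r.
  move=> r0; set k := - ((r ^+ 2)^-1 - 1) / (2 * s ^+ 2).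
  have := @tilt (fun x => k * (x - m) ^+ 2) r m (s * r) (ltW r0).
  rewrite RintegralZl// -/V => H; rewrite (_ : _ - _ = 1 + k * V); last by rewrite /k; ring.
  apply: H.
  - apply: measurable_funM => //; apply: measurable_funX; exact: measurable_funB.
  - move=> x; rewrite normal_pdf_rescale// -(mulrA r^-1) mulVKf ?gt_eqF//.
    by congr (expR _ * _); rewrite /k; ring.
  - exact: (integrableZl measurableT k iS).
set W := V / s ^+ 2.
have h2 (r : R) : 0 < r -> 1 - r <= W * ((r ^+ 2)^-1 - 1) / 2.
  move=> r0; have := h r r0.
  rewrite (_ : V * _ / _ = W * ((r ^+ 2)^-1 - 1) / 2); last first.
    by rewrite /W; field; rewrite !gt_eqF.
  lra.
(* Both sides contain the factor [1 - r], which changes sign at 1: some [r] above 1 refutes [1 < W],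
   and some [r] below 1 refutes [W < 1]. *)
have h3 (r : R) : 0 < r -> (1 - r) * (2 * r ^+ 2) <= W * ((1 - r) * (1 + r)).
  move=> r0; have := h2 r r0; have r20 : 0 < r ^+ 2 by rewrite exprn_gt0.
  rewrite -(ler_pM2r (mulr_gt0 (ltr0n _ 2) r20)).
  suff -> : W * ((r ^+ 2)^-1 - 1) / 2 * (2 * r ^+ 2) = W * ((1 - r) * (1 + r)) by [].
  by field; rewrite gt_eqF.
suff W1 : W = 1 by rewrite -[RHS]mul1r -W1 /W divfK// gt_eqF.
apply/eqP; rewrite eq_le; apply/andP; split; rewrite leNgt; apply/negP => Wlt.
- have [e0 e1] : 0 < (W - 1) /\ 0 <= W by split; lra.
  (* Then [W >= 1 + 8 q], so [W (2 + q)] exceeds [2 (1 + q)^2], against [h3] at [1 + q]. *)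
  pose q := Num.min 1 ((W - 1) / 8).
  have q0 : 0 < q by rewrite lt_min ltr01 divr_gt0.
  have q1 : q <= 1 by rewrite ge_min lexx.
  have q2 : q <= (W - 1) / 8 by rewrite ge_min lexx orbT.
  have := h3 (1 + q) ltac:(lra).
  have -> : (1 - (1 + q)) * (2 * (1 + q) ^+ 2) = q * (- (2 * (1 + q) ^+ 2)) by ring.
  have -> : W * ((1 - (1 + q)) * (1 + (1 + q))) = q * (- (W * (2 + q))) by ring.
  rewrite ler_pM2l//.
  have := mulr_ge0 (ltW q0) e1; have := ler_wpM2l (ltW q0) q1; nra.
- pose q := Num.min (1 / 2) ((1 - W) / 8).
  have q0 : 0 < q by rewrite lt_min !divr_gt0//; lra.
  have q1 : q <= 1 / 2 by rewrite ge_min lexx.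
  have q2 : q <= (1 - W) / 8 by rewrite ge_min lexx orbT.
  have := h3 (1 - q) ltac:(lra).
  have -> : (1 - (1 - q)) * (2 * (1 - q) ^+ 2) = q * (2 * (1 - q) ^+ 2) by ring.
  have -> : W * ((1 - (1 - q)) * (1 + (1 - q))) = q * (W * (2 - q)) by ring.
  rewrite ler_pM2l//.
  have : 0 <= (1 - 8 * q - W) * (2 - q) by apply: mulr_ge0; lra.
  have := mulr_ge0 (ltW q0) (ltW q0); have := ler_wpM2l (ltW q0) q1; nra.
Qed.

End normal_moments.

(** * Convolution of normal laws, and a reference Gaussian vector *)

Section convolution.
Context {R : realType}.
Local Notation leb := (@lebesgue_measure R).

(** Completing the square in [h]: the product is the density of variance [a^2 + b^2] at [z], times a
    normal density in [h] with mean [z a^2 / c^2] and deviation [a b / c], which integrates to 1. *)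
Lemma normal_pdf_convolution (a b z : R) : 0 < a -> 0 < b ->
  (\int[leb]_h (normal_pdf h b z * normal_pdf 0 a h)%:E =
   (normal_pdf 0 (Num.sqrt (a ^+ 2 + b ^+ 2)) z)%:E)%E.
Proof.
move=> a0 b0; set c := Num.sqrt _.
have a20 : 0 < a ^+ 2 by rewrite exprn_gt0.
have b20 : 0 < b ^+ 2 by rewrite exprn_gt0.
have c2 : c ^+ 2 = a ^+ 2 + b ^+ 2 by rewrite sqr_sqrtr//; lra.
have c0 : 0 < c by rewrite sqrtr_gt0; lra.
have E h : normal_pdf h b z * normal_pdf 0 a h =
    normal_pdf 0 c z * normal_pdf (z * a ^+ 2 / c ^+ 2) (a * b / c) h.
  rewrite !normal_pdfE0// ?divr_gt0 ?mulr_gt0//.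
  rewrite [LHS]mulrACA [RHS]mulrACA; congr (_ * _).
  rewrite [LHS]mulrACA [RHS]mulrACA -!expRD; congr (_ * expR _).
    by field; rewrite !gt_eqF.
  have -> : (h - z * a ^+ 2 / c ^+ 2) / (a * b / c) =
     (h * (a ^+ 2 + b ^+ 2) - z * a ^+ 2) / (a * b * c).
    by rewrite -c2; field; rewrite !gt_eqF.
  rewrite !expr_div_n !exprMn c2 !subr0.
  by field; rewrite !gt_eqF//; lra.
under eq_integral do rewrite E EFinM.
rewrite ge0_integralZl//; last 3 first.
- by apply/measurable_EFinP; exact: measurable_normal_pdf.
- by move=> x _; rewrite lee_fin normal_pdf_ge0.
- by rewrite lee_fin normal_pdf_ge0.
by rewrite integral_normal_pdf mule1.
Qed.

End convolution.

Section convolution.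
Context {R : realType}.
Local Notation leb := (@lebesgue_measure R).

Lemma ge0_integral_normal_affine (h b : R) (g : R -> \bar R) : b != 0 ->
  measurable_fun [set: R] g -> (forall x, 0 <= g x)%E ->
  (\int[normal_prob 0 1]_x g (h + b * x)%R = \int[normal_prob h `|b|]_x g x)%E.
Proof.
move=> b0 mg g0; have nb : 0 < `|b| by rewrite normr_gt0.
have maff : measurable_fun [set: R] (fun x : R => h + b * x).
  by apply: measurable_funD => //; apply: measurable_funM.
have mga : measurable_fun [set: R] (fun x => g (h + b * x)%R).
  exact: measurableT_comp mg maff.
have mp (m s : R) : measurable_fun [set: R] (fun x => (normal_pdf m s x)%:E).
  by apply/measurable_EFinP; exact: measurable_normal_pdf.
have E1 := @ge0_integral_normal R 0 1 _ mga (fun x => g0 _).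
have E2 := @ge0_integral_normal R h `|b| _ mg g0.
have mgp : measurable_fun [set: R] (fun x => (g x * (normal_pdf h `|b| x)%:E)%E).
  exact: emeasurable_funM.
have gp0 x : (0 <= g x * (normal_pdf h `|b| x)%:E)%E.
  by rewrite mule_ge0// lee_fin normal_pdf_ge0.
rewrite E1 E2 (@ge0_integral_affine R h b _ b0 mgp gp0).
rewrite -(@ge0_integralZl _ _ _ leb _ measurableT
  (fun x => (g (h + b * x)%R * (normal_pdf h `|b| (h + b * x))%:E)%E)); last 3 first.
- exact: measurableT_comp mgp maff.
- by move=> x _; exact: gp0.
- by rewrite lee_fin.
apply: eq_integral => x _; rewrite muleCA -EFinM; congr (_ * _%:E)%E.
rewrite !normal_pdfE0// [RHS]mulrCA; congr (_ * _).
rewrite mulrA mulfV ?gt_eqF// invr1; congr (_ * expR _).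
rewrite subr0 mulr1 addrAC subrr add0r expr_div_n real_normK ?num_real//.
by field.
Qed.

Lemma measurable_normal_pdf2 (s : R) : 0 < s ->
  measurable_fun [set: R * R] (fun z => normal_pdf z.1 s z.2).
Proof.
move=> s0; under eq_fun do rewrite normal_pdfE0//.
apply: measurable_funM => //; apply: measurable_funM => //.
apply: measurableT_comp => //; apply: measurable_funM => //.
apply: measurableT_comp => //; apply: measurable_funX => //.
by apply: measurable_funM => //; apply: measurable_funB.
Qed.

(** Given [t], the sum is normal with mean [S t] and deviation [|b|]; averaging over the law of [S]
    and exchanging the integrals leaves the convolution of two densities. The cases [b = 0] and
    [v = 0] are separate, since a point mass has no density. *)
Lemma normal_law_convolution d (T : measurableType d) (G : probability T R)
    (S : T -> R) (v b : R) : 0 <= v ->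
  measurable_fun [set: T] S ->
  (forall B, measurable B -> G (S @^-1` B) = normal_law 0 v B) ->
  forall B, measurable B ->
  (G \x normal_prob 0 1)%E
    ((fun z : T * measurableTypeR R => S z.1 + b * (z.2 : R)) @^-1` B) =
  normal_law 0 (v + b ^+ 2) B.
Proof.
move=> v0 mS lS B mB; rewrite /product_measure1 /=.
set f := fun z : T * measurableTypeR R => _.
have xsec t : xsection (f @^-1` B) t = (fun x : R => S t + b * x) @^-1` B.
  by apply/seteqP; split => x; rewrite /xsection /= ?inE.
have mB' : measurable (B : set (measurableTypeR R)) by [].
have [b0|b0] := eqVneq b 0.
  rewrite b0 expr0n addr0 -lS//.
  rewrite -[in RHS](setIT (S @^-1` B)) -integral_indic//; last first.
    by rewrite -[X in measurable X]setTI; exact: mS.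
  apply: eq_integral => t _; rewrite xsec b0 indicE.
  rewrite (_ : (fun x : R => _) = cst (S t)); last by apply/funext => x; rewrite mul0r addr0.
  rewrite preimage_cst.
  have -> : (S t \in B) = (t \in S @^-1` B) by apply/idP/idP; rewrite !inE.
  by case: ifPn => tB; [exact: probability_setT|exact: measure0].
have nb : 0 < `|b| by rewrite normr_gt0.
pose phi (h : measurableTypeR R) := normal_prob h `|b| B.
have phiE (h : R) : normal_prob 0 1 ((fun x : R => h + b * x) @^-1` B) = phi h.
  have maff : measurable_fun [set: measurableTypeR R]
      (fun x : measurableTypeR R => (h + b * x : measurableTypeR R)).
    by apply: measurable_funD => //; apply: measurable_funM.
  have mpre : measurable ((fun x : measurableTypeR R => (h + b * x : measurableTypeR R)) @^-1` B).
    by rewrite -[X in measurable X]setTI; exact: maff.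
  have mB1 : measurable_fun [set: R] (fun x : R => (\1_B x : R)%:E).
    by apply/measurable_EFinP; exact: measurable_indic.
  transitivity (\int[normal_prob 0 1]_x (\1_B (h + b * x)%R : R)%:E)%E.
    by rewrite (integral_indic _ measurableT mpre) setIT.
  rewrite (ge0_integral_normal_affine h b0 mB1)//.
  by rewrite (integral_indic _ measurableT mB') setIT.
transitivity (\int[G]_t phi (S t))%E.
  by apply: eq_integral => t _; rewrite xsec phiE.
have phi0 h : (0 <= phi h)%E by exact: measure_ge0.
have mf2 : measurable_fun [set: measurableTypeR R * measurableTypeR R]
    (fun z => (\1_B z.2 * normal_pdf z.1 `|b| z.2)%:E).
  apply/measurable_EFinP; apply: measurable_funM.
   by apply: measurableT_comp.
   exact: measurable_normal_pdf2.
have phiI h : phi h = (\int[leb]_z (\1_B z * normal_pdf h `|b| z)%:E)%E.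
  rewrite /phi /normal_prob integral_mkcond; apply: eq_integral => z _.
  by rewrite patchE indicE; case: ifP; rewrite ?mul1r ?mul0r.
have f20 z : (0 <= (\1_B z.2 * normal_pdf z.1 `|b| z.2)%:E)%E.
  by rewrite lee_fin mulr_ge0// normal_pdf_ge0.
have mphi : measurable_fun [set: measurableTypeR R] phi.
  rewrite (funext phiI).
  exact: (@measurable_fun_fubini_tonelli_F _ _ _ _ _ leb _ mf2 f20).
rewrite /normal_law.
have [v_eq0|v_neq0] := eqVneq v 0.
  rewrite v_eq0 add0r sqrf_eq0 (negbTE b0) sqrtr_sqr.
  have lS0 A : measurable A -> G (S @^-1` A) = \d_(0 : R) A.
    by move=> mA; rewrite lS// /normal_law v_eq0 eqxx.
  rewrite (ge0_integral_law mS lS0 mphi phi0) integral_dirac//.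
  by rewrite diracT mul1e.
have v_gt0 : 0 < v by rewrite lt_neqAle eq_sym v_neq0.
have lS1 A : measurable A -> G (S @^-1` A) = normal_prob 0 (Num.sqrt v) A.
  by move=> mA; rewrite lS// /normal_law (negbTE v_neq0).
rewrite gt_eqF; last by rewrite ltr_wpDr// sqr_ge0.
rewrite (@ge0_integral_law _ _ _ (measurableTypeR R) _ _ (normal_prob 0 (Num.sqrt v)) _
  mS lS1 _ mphi phi0).
rewrite ge0_integral_normal//.
transitivity (\int[leb]_h \int[leb]_z (\1_B z * normal_pdf h `|b| z *
    normal_pdf 0 (Num.sqrt v) h)%:E)%E.
  apply: eq_integral => h _; rewrite phiI -ge0_integralZr//.
  - exact: (measurableT_comp mf2 (measurable_pair1 h)).
  - by move=> z _; exact: (f20 (h, z)).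
  - by rewrite lee_fin normal_pdf_ge0.
have mF : measurable_fun [set: measurableTypeR R * measurableTypeR R]
    (fun z => (\1_B z.2 * normal_pdf z.1 `|b| z.2 *
       normal_pdf 0 (Num.sqrt v) z.1)%:E).
  apply/measurable_EFinP; apply: measurable_funM.
    exact/measurable_EFinP.
  by apply: measurableT_comp; first exact: measurable_normal_pdf.
have F0 (z : measurableTypeR R * measurableTypeR R) :
    (0 <= (\1_B z.2 * normal_pdf z.1 `|b| z.2 * normal_pdf 0 (Num.sqrt v) z.1)%:E)%E.
  by rewrite lee_fin !mulr_ge0// normal_pdf_ge0.
rewrite (@fubini_tonelli _ _ _ _ _ leb leb _ mF F0) /=.
rewrite /normal_prob [RHS]integral_mkcond; apply: eq_integral => z _.
rewrite patchE.
under eq_integral do rewrite -mulrA EFinM.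
rewrite ge0_integralZl//; last 2 first.
- apply/measurable_EFinP; apply: measurable_funM.
    exact: (measurableT_comp (measurable_normal_pdf2 nb) (measurable_pair2 z)).
  exact: measurable_normal_pdf.
- by move=> h _; rewrite lee_fin mulr_ge0// normal_pdf_ge0.
rewrite normal_pdf_convolution ?sqrtr_gt0// sqr_sqrtr// real_normK ?num_real//.
by rewrite indicE; case: ifP; rewrite ?mul1e ?mul0e.
Qed.
End convolution.

(** Provides the standard Gaussian vector used for comparison. It is built by adjoining one
    independent coordinate at a time, in step with the recursion of [chi_square]. *)
Lemma gaussian_vector_exists (R : realType) (v : nat) :
  exists d (T : measurableType d) (G : probability T R) (V : nat -> T -> R),
  [/\ forall i, measurable_fun [set: T] (V i),
      forall w : nat -> R, forall B, measurable B ->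
        G ((fun t => \sum_(i < v) w i * V i t) @^-1` B) =
        normal_law 0 (\sum_(i < v) w i ^+ 2) B &
      forall B, measurable B ->
        G ((fun t => \sum_(i < v) V i t ^+ 2) @^-1` B) = chi_square v B].
Proof.
elim: v => [|v [d [T [G [V [mV lV cV]]]]]].
  exists _, unit, (\d_tt : probability unit R), (fun _ _ => 0); split => //.
    move=> w B mB; rewrite !big_ord0 /normal_law eqxx (preimage_cst (0 : R)) diracE.
    by case: ifP => _; [exact: probability_setT|exact: measure0].
  move=> B mB; rewrite !big_ord0 (preimage_cst (0 : R)) [RHS]diracE.
  by case: ifP => _; [exact: probability_setT|exact: measure0].
(* Indexing by [nat] keeps the type of [V] fixed along the induction: indices below [v] read the old
   vector, all others the new coordinate. *)
pose V' i (z : T * measurableTypeR R) : R := if (i < v)%N then V i z.1 else z.2.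
exists _, (T * measurableTypeR R)%type, (G \x normal_prob (0 : R) 1)%E, V'.
have V'lt (i : 'I_v) z : V' i z = V i z.1 by rewrite /V' ltn_ord.
have V'v z : V' v z = z.2 by rewrite /V' ltnn.
have mS (f : nat -> R) : measurable_fun [set: T] (fun t => \sum_(i < v) f i * V i t).
  by apply: measurable_sum => i; apply: measurable_funM.
have mQ : measurable_fun [set: T] (fun t => \sum_(i < v) V i t ^+ 2).
  by apply: measurable_sum => i; apply: measurable_funX.
split.
- move=> i; have [iv|iv] := boolP (i < v)%N.
    rewrite (_ : V' i = V i \o fst); first exact: measurableT_comp.
    by apply/funext => z; rewrite /V' iv.
  rewrite (_ : V' i = snd); first exact: measurable_snd.
  by apply/funext => z; rewrite /V' (negbTE iv).
- move=> w B mB; rewrite big_ord_recr /=.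
  have w0 : 0 <= \sum_(i < v) w i ^+ 2 by apply: sumr_ge0 => i _; exact: sqr_ge0.
  apply: etrans (normal_law_convolution (w v) w0 (mS w) (lV w) mB).
  congr (_ (_ @^-1` B)); apply/funext => z; rewrite big_ord_recr /= V'v.
  by under eq_bigr do rewrite V'lt.
move=> B mB /=; rewrite /distribution /pushforward /=.
rewrite /product_measure1 /=.
have mA : measurable (add_square @^-1` B).
  by rewrite -[X in measurable X]setTI; exact: measurable_add_square.
(* [chi_square v.+1] integrates section measures against [chi_square v], which is the law of the old
   squared norm. *)
rewrite -(ge0_integral_law mQ cV (g := fun r => normal_prob 0 1 (xsection (add_square @^-1` B) r))).
- apply: eq_integral => t _; congr (_ _).
  have E x : add_square (\sum_(i < v) V i t ^+ 2, x) = \sum_(i < v.+1) V' i (t, x) ^+ 2.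
    rewrite /add_square big_ord_recr /= V'v.
    by under [in RHS]eq_bigr do rewrite V'lt.
  by apply/seteqP; split => x; rewrite /xsection /= !inE /= E.
- exact: measurable_fun_xsection.
- by move=> r; exact: measure_ge0.
Qed.

(** * Polynomials approximating indicators of rays under the weight [Num.sqrt (1 - s)] *)

Section indicator_approximation.
Context {R : realType}.
Implicit Types s x : R.

Lemma bernoulli_ineq (u : R) m : 0 <= u -> u <= 1 -> 1 - m%:R * u <= (1 - u) ^+ m.
Proof.
move=> u0 u1; elim: m => [|m IH]; first by rewrite mul0r subr0 expr0.
rewrite exprS -natr1; have : 0 <= m%:R * u by rewrite mulr_ge0.
have := ler_wpM2l (_ : 0 <= 1 - u) IH; rewrite subr_ge0 => /(_ u1); nra.
Qed.

Lemma bernoulli_ineq_inv (u : R) m : 0 <= u -> u <= 1 ->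
  (1 - u) ^+ m * (1 + m%:R * u) <= 1.
Proof.
move=> u0 u1; elim: m => [|m IH]; first by rewrite mul0r addr0 expr0 mulr1.
apply: le_trans IH; rewrite exprS -natr1 (mulrC (1 - u)) -mulrA.
apply: ler_wpM2l; first by rewrite exprn_ge0// subr_ge0.
have : 0 <= m%:R * u * u by rewrite !mulr_ge0.
nra.
Qed.

(* Newton's iteration for t^(-1/2), at t = 1 - 'X. *)
Fixpoint rsqrt_poly (n : nat) : {poly R} :=
  if n is n'.+1 then
    (2^-1)%:P * rsqrt_poly n' * (3%:P - (1%:P - 'X) * rsqrt_poly n' ^+ 2)
  else 1.

(** With [e = (1 - s) q^2], one step sends [1 - e] to [(1 - e)^2 (4 - e) / 4]: thus [e] never
    exceeds 1 and the error is at least squared. As the error is at most [s], squaring gains at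
    least one further factor [s]. *)
Lemma rsqrt_polyP s n : 0 <= s -> s < 1 ->
  0 < (rsqrt_poly n).[s] /\
  1 - s ^+ n.+1 <= (1 - s) * (rsqrt_poly n).[s] ^+ 2 <= 1.
Proof.
move=> s0 s1; elim: n => [|n [q0 /andP[qn q1]]].
  by rewrite /= hornerE ltr01 expr1n mulr1 expr1 lexx; split=> //; lra.
have -> : (rsqrt_poly n.+1).[s] = 2^-1 * (rsqrt_poly n).[s] *
    (3 - (1 - s) * (rsqrt_poly n).[s] ^+ 2).
  by rewrite /= !(hornerM, hornerD, hornerN, hornerC, hornerX, horner_exp).
set q := (rsqrt_poly n).[s] in q0 qn q1 *.
set e := (1 - s) * q ^+ 2 in qn q1 *.
have e0 : 0 < e by rewrite mulr_gt0 ?subr_gt0// exprn_gt0.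
split; first by rewrite !mulr_gt0 ?invr_gt0//; lra.
have -> : (1 - s) * (2^-1 * q * (3 - e)) ^+ 2 = e * (3 - e) ^+ 2 / 4.
  by rewrite /e; field.
have d2 : (1 - e) ^+ 2 <= s ^+ n.+2.
  apply: (@le_trans _ _ (s ^+ n.+1 * s)); last by rewrite -exprSr.
  have sn : s ^+ n.+1 <= s by rewrite exprS ler_piMr// exprn_ile1// ltW.
  by rewrite expr2; apply: ler_pM; lra.
have -> : e * (3 - e) ^+ 2 / 4 = 1 - (1 - e) ^+ 2 * (4 - e) / 4 by field.
have := sqr_ge0 (1 - e); set D := (1 - e) ^+ 2 in d2 *; move=> D0.
apply/andP; split; nra.
Qed.

(** With [N = n.+1], the second factor is [(1 - s^N)^M], a power familiar from elementary proofs of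
    the Stone-Weierstrass theorem. [M] is of the order of [N x^(-N)], so [M s^N] is of the order of
    [N (s / x)^N]: it tends to 0 below [x] and is at least [N] from [x] on, the latter thanks to the
    successor of the truncation. The first factor compensates the weight. *)
Definition indicator_poly x n : {poly R} := rsqrt_poly n *
  (1%:P - 'X ^+ n.+1) ^+ (n.+1 * (Num.truncn (x ^- n.+1)).+1).

(** Below [x], Bernoulli's inequality loses [M u <= 2 N (s / x)^N] and Newton's iteration at most
    [u <= N (s / x)^N], whence the 3. From [x] on, [(1 - u)^M <= 1 / (1 + M u)] with [M u >= N]. *)
Lemma indicator_polyP x s n : 0 <= s -> s < 1 -> 0 < x -> x < 1 ->
  0 <= Num.sqrt (1 - s) * (indicator_poly x n).[s] <= 1 /\
  (if s < x then 1 - 3 * n.+1%:R * (s / x) ^+ n.+1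
     <= Num.sqrt (1 - s) * (indicator_poly x n).[s]
   else Num.sqrt (1 - s) * (indicator_poly x n).[s] <= n.+1%:R^-1).
Proof.
move=> s0 s1 x0 x1.
rewrite /indicator_poly !(hornerM, horner_exp, hornerD, hornerN, hornerC, hornerX).
have [q0 /andP[]] := rsqrt_polyP n s0 s1; set q := (rsqrt_poly n).[s] in q0 *.
set e := (1 - s) * q ^+ 2 => en e1.
set N := n.+1; set u := s ^+ N; set M := (N * _)%N.
have u0 : 0 <= u by rewrite exprn_ge0.
have u1 : u <= 1 by rewrite exprn_ile1// ltW.
have xN0 : 0 < x ^+ N by rewrite exprn_gt0.
have xV0 : 0 <= x ^- N by rewrite invr_ge0 ltW.
have /andP[Mu Ml] := truncn_itv xV0.
have e0 : 0 <= e by rewrite mulr_ge0 ?subr_ge0 ?sqr_ge0// ltW.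
have sqE : Num.sqrt (1 - s) * q = Num.sqrt e.
  by rewrite /e sqrtrM ?subr_ge0 1?ltW// sqrtr_sqr gtr0_norm.
have se : e <= Num.sqrt e.
  rewrite -{1}(sqr_sqrtr e0) expr2 ler_piMl ?sqrtr_ge0//.
  by rewrite -sqrtr1 ler_sqrt.
have se1 : Num.sqrt e <= 1 by rewrite -sqrtr1 ler_sqrt.
have g0 : 0 <= (1 - u) ^+ M by rewrite exprn_ge0// subr_ge0.
have g1 : (1 - u) ^+ M <= 1 by rewrite exprn_ile1 ?subr_ge0//; lra.
rewrite mulrA sqE; split.
  by rewrite mulr_ge0 ?sqrtr_ge0//= mulr_ile1// sqrtr_ge0.
have ME : M%:R = N%:R * (Num.truncn (x ^- N)).+1%:R :> R by rewrite -natrM.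
have : (Num.truncn (x ^- N)).+1%:R <= x ^- N + 1 by rewrite -natr1 lerD2r.
set tr := (Num.truncn _).+1%:R in Ml ME * => Mu'.
have zE : (s / x) ^+ N = u * x ^- N by rewrite expr_div_n.
have N1 : 1 <= N%:R :> R by rewrite ler1n.
case: ifPn => [sx|]; last rewrite -leNgt => xs.
  have := bernoulli_ineq M u0 u1.
  rewrite zE ME => gl; have xN1 : u <= u * x ^- N.
    by rewrite ler_peMr// invf_ge1// exprn_ile1// ltW.
  set z := u * x ^- N in xN1 *.
  have tu : tr * u <= 2 * z.
    have := ler_wpM2r u0 Mu'; rewrite mulrDl mul1r (mulrC (x ^- N) u) -/z; lra.
  have Ntu : N%:R * tr * u <= 2 * N%:R * z.
    by rewrite -mulrA (mulrC 2) -mulrA ler_pM2l//; lra.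
  have Nz : z <= N%:R * z by rewrite ler_peMl//; lra.
  have : (1 - Num.sqrt e) * (1 - u) ^+ M <= 1 - Num.sqrt e.
    by rewrite ler_piMr// subr_ge0.
  rewrite -/N -/u in en.
  lra.
have gM := bernoulli_ineq_inv M u0 u1; rewrite ME in gM.
have zu : N%:R <= N%:R * tr * u.
  rewrite -mulrA ler_peMr//.
  apply: (@le_trans _ _ (x ^- N * u)); last by rewrite ler_wpM2r// ltW.
  by rewrite mulrC ler_pdivlMr// mul1r /u lerXn2r// ?nnegrE// ltW.
have gN : (1 - u) ^+ M * N%:R <= 1.
  apply: le_trans gM; apply: ler_wpM2l => //; lra.
apply: (@le_trans _ _ ((1 - u) ^+ M)); first by rewrite ler_piMl.
by rewrite -[leRHS]mul1r ler_pdivlMr//; lra.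
Qed.

(** Half of the decay absorbs the linear factor: with [y] the square root of [z], [n y^n] stays
    below [1 / (1 - y)], and another [y^n] is left. *)
Lemma cvg_geometric_linear (z : R) : 0 <= z -> z < 1 ->
  n.+1%:R * z ^+ n.+1 @[n --> \oo] --> (0 : R).
Proof.
move=> z0 z1; pose y := Num.sqrt z.
have y0 : 0 <= y by exact: sqrtr_ge0.
have y1 : y < 1 by rewrite -sqrtr1 ltr_sqrt.
have zE : z = y * y by rewrite -expr2 sqr_sqrtr.
have bound n : n%:R * y ^+ n * (1 - y) <= 1.
  have yn : 0 <= y ^+ n by rewrite exprn_ge0.
  have [y_eq0|y_gt0] := eqVneq y 0.
    case: n {yn} => [|n]; first by rewrite !mul0r.
    by rewrite y_eq0 exprS !mul0r mulr0 mul0r.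
  have {}y_gt0 : 0 < y by rewrite lt_neqAle eq_sym y_gt0.
  have := @bernoulli_ineq_inv (1 - y) n; rewrite subKr subr_ge0 => /(_ (ltW y1)).
  by move=> h; have := h ltac:(lra); nra.
apply: (@squeeze_cvgr _ _ _ _ (cst 0) (fun n => (1 - y)^-1 * y ^+ n.+1)).
- apply: nearW => n /=; rewrite mulr_ge0 ?exprn_ge0//= zE exprMn mulrA.
  apply: ler_wpM2r; first by rewrite exprn_ge0.
  by rewrite -[leRHS]mul1r ler_pdivlMr ?subr_gt0.
- exact: cvg_cst.
- rewrite -[X in _ --> X](mulr0 (1 - y)^-1); apply: cvgM; first exact: cvg_cst.
  have := @cvg_expr R y; rewrite ger0_norm// => /(_ y1).
  by rewrite -(cvg_shiftS (fun n => y ^+ n)).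
Qed.

Lemma cvg_indicator_poly (x s : R) : 0 <= s -> s < 1 -> 0 < x -> x < 1 ->
  Num.sqrt (1 - s) * (indicator_poly x n).[s] @[n --> \oo] --> ((s < x)%R%:R : R).
Proof.
move=> s0 s1 x0 x1; have P n := indicator_polyP n s0 s1 x0 x1.
case: (ltP s x) P => sx P.
  apply: (@squeeze_cvgr _ _ _ _ (fun n => 1 - 3 * (n.+1%:R * (s / x) ^+ n.+1)) (cst 1)).
  - apply: nearW => n /=; have [/andP[_ ->] h] := P n; rewrite andbT.
    by rewrite mulrA.
  - rewrite -[X in _ --> X]subr0; apply: cvgB; first exact: cvg_cst.
    rewrite -[X in _ --> X](mulr0 3); apply: cvgM; first exact: cvg_cst.
    apply: cvg_geometric_linear; first by rewrite divr_ge0// ltW.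
    by rewrite ltr_pdivrMr// mul1r.
  - exact: cvg_cst.
apply: (@squeeze_cvgr _ _ _ _ (cst 0) (fun n => n.+1%:R^-1)).
- by apply: nearW => n /=; have [/andP[-> _] ->] := P n.
- exact: cvg_cst.
- exact: cvg_harmonic.
Qed.

End indicator_approximation.

Lemma Rintegral_sum d (T : measurableType d) (R : realType)
    (P : {measure set T -> \bar R}) (I : Type) (r : seq I) (F : I -> T -> R) :
  (forall i, P.-integrable setT (EFin \o F i)) ->
  P.-integrable setT (EFin \o (fun t => \sum_(i <- r) F i t)) /\
  \int[P]_t (\sum_(i <- r) F i t) = \sum_(i <- r) \int[P]_t F i t.
Proof.
move=> iF; elim: r => [|i r [IH1 IH2]].
  under eq_fun do rewrite big_nil; rewrite big_nil; split.
    exact: integrable0.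
  by rewrite /Rintegral integral0.
under eq_fun do rewrite big_cons; rewrite big_cons; split.
  exact: (integrableD measurableT (iF i) IH1).
by rewrite RintegralD// IH2.
Qed.

Lemma integrable_prob_bounded d (T : measurableType d) (R : realType)
    (P : probability T R) (f : T -> R) (c : R) : measurable_fun setT f ->
  (forall t, `|f t| <= c) -> P.-integrable setT (EFin \o f).
Proof.
move=> mf fc.
apply: (@le_integrable _ _ _ P setT measurableT _ (EFin \o cst c)) => //.
- exact/measurable_EFinP.
- move=> t _ /=; rewrite lee_fin; exact: le_trans (fc t) (ler_norm c).
- exact: finite_measure_integrable_cst.
Qed.

(** * A law on the half line is determined by its weighted moments *)

Section law_determined.
Context {R : realType}.
Implicit Types r : R.

(* The absolute value only serves measurability: [squash] is applied to
   nonnegative reals. *)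
Definition squash r := r / (1 + `|r|).

Lemma squash_ge0 r : 0 <= r -> 0 <= squash r.
Proof. by move=> r0; rewrite divr_ge0// addr_ge0. Qed.

Lemma squash_lt1 r : 0 <= r -> squash r < 1.
Proof. by move=> r0; rewrite /squash ger0_norm// ltr_pdivrMr ?mul1r; lra. Qed.

Lemma squash_lt r y : 0 <= r -> 0 <= y -> (squash r < squash y) = (r < y).
Proof.
move=> r0 y0; rewrite /squash !ger0_norm// ltr_pdivrMr ?ltr_wpDr//.
rewrite mulrAC ltr_pdivlMr ?ltr_wpDr//.
by rewrite !mulrDr !mulr1 (mulrC y r) ltrD2r.
Qed.

Lemma measurable_squash : measurable_fun [set: R] squash.
Proof.
apply: continuous_measurable_fun => x; apply: cvgM; first exact: cvg_id.
apply: cvgV; first by rewrite gt_eqF// ltr_wpDr.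
by apply: cvgD; [exact: cvg_cst|apply: cvg_norm; exact: cvg_id].
Qed.

(** For nonnegative [r] the first factor is [(1 + r)^(-1/2)]. Up to a constant depending on [k],
    this is the expectation of [gauss_test k] under the centered normal law of variance [r]. *)
Definition squash_moment r k := Num.sqrt (1 - squash r) * squash r ^+ k.

Lemma measurable_squash_moment k : measurable_fun [set: R] (squash_moment ^~ k).
Proof.
apply: measurable_funM; last by apply: measurable_funX; exact: measurable_squash.
apply: (measurableT_comp (f := @Num.sqrt R)).
  by apply: continuous_measurable_fun; exact: sqrt_continuous.
by apply: measurable_funB => //; exact: measurable_squash.
Qed.

Lemma squash_moment_bound r k : 0 <= r -> `|squash_moment r k| <= 1.
Proof.
move=> r0; have s0 := squash_ge0 r0; have s1 := squash_lt1 r0.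
rewrite ger0_norm; last by rewrite mulr_ge0 ?sqrtr_ge0 ?exprn_ge0.
apply: mulr_ile1; rewrite ?sqrtr_ge0 ?exprn_ge0//; last first.
  by apply: exprn_ile1 => //; exact: ltW.
by rewrite -[leRHS]sqrtr1 ler_wsqrtr//; lra.
Qed.

Context d (T : measurableType d) (P : probability T R) (X : T -> R).
Hypotheses (mX : measurable_fun [set: T] X) (X0 : forall t, 0 <= X t).

Let iM k : P.-integrable setT (EFin \o (fun t => squash_moment (X t) k)).
Proof.
apply: (@integrable_prob_bounded _ _ _ _ _ 1) => [|t].
  exact: (measurableT_comp (measurable_squash_moment k) mX).
exact: squash_moment_bound.
Qed.

Let iMc k c : P.-integrable setT (EFin \o (fun t => c * squash_moment (X t) k)).
Proof. exact: (integrableZl measurableT c (iM k)). Qed.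

Lemma Rintegral_squash_poly (p : {poly R}) :
  P.-integrable setT (EFin \o
    (fun t => Num.sqrt (1 - squash (X t)) * p.[squash (X t)])) /\
  \int[P]_t (Num.sqrt (1 - squash (X t)) * p.[squash (X t)]) =
  \sum_(i < size p) p`_i * \int[P]_t squash_moment (X t) i.
Proof.
have E : (fun t => Num.sqrt (1 - squash (X t)) * p.[squash (X t)]) =
    (fun t => \sum_(i < size p) p`_i * squash_moment (X t) i).
  apply/funext => t; rewrite horner_coef big_distrr /=; apply: eq_bigr => i _.
  by rewrite mulrCA.
rewrite E.
have [H1 H2] := Rintegral_sum (index_enum 'I_(size p))
  (fun i : 'I_(size p) => iMc i p`_i).
split; first exact: H1.
rewrite [LHS]H2; apply: eq_bigr => i _.
by rewrite RintegralZl//; exact: iM.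
Qed.

(** As [squash] is increasing on nonnegative reals, the limiting event is [X t < y]; the weighted
    polynomials lie in [[0, 1]], so the constant 1 dominates them. *)
Lemma cvg_squash_indicator (y : R) : 0 < y ->
  (\int[P]_t (Num.sqrt (1 - squash (X t)) *
     (indicator_poly (squash y) n).[squash (X t)])%:E)%E @[n --> \oo]
  --> P (X @^-1` `]-oo, y[%classic).
Proof.
move=> y0; have sy0 : 0 < squash y by rewrite divr_gt0// ltr_pwDl.
have sy1 : squash y < 1 by apply: squash_lt1; exact: ltW.
have mpre : measurable (X @^-1` `]-oo, y[%classic).
  by rewrite -[X in measurable X]setTI; exact: mX.
pose f n t := (Num.sqrt (1 - squash (X t)) *
     (indicator_poly (squash y) n).[squash (X t)])%:E.
have [|||||_ _] := @dominated_convergence _ _ _ P setT measurableT f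
  (fun t => (\1_(X @^-1` `]-oo, y[%classic) t)%:E) (cst 1%E).
- move=> n; have [/integrableP[mf _] _] := Rintegral_squash_poly (indicator_poly (squash y) n).
  exact: mf.
- by apply/measurable_EFinP; exact: measurable_indic.
- apply: aeW => t _; apply: cvg_EFin; first exact: nearW.
  have := @cvg_indicator_poly R (squash y) (squash (X t)) (squash_ge0 (X0 t))
    (squash_lt1 (X0 t)) sy0 sy1.
  rewrite squash_lt// ?ltW// indicE.
  have -> : (t \in X @^-1` `]-oo, y[%classic) = (X t < y).
    by apply/idP/idP; rewrite inE /= in_itv.
  by [].
- exact: finite_measure_integrable_cst.
- apply: aeW => t n _; rewrite /f /= lee_fin.
  have [/andP[h0 h1] _] := @indicator_polyP R (squash y) (squash (X t)) n
    (squash_ge0 (X0 t)) (squash_lt1 (X0 t)) sy0 sy1.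
  by rewrite ger0_norm.
- by rewrite integral_indic// setIT.
Qed.

End law_determined.

Lemma law_determined_by_squash_moments (R : realType)
    d1 (T1 : measurableType d1) (P1 : probability T1 R) (X1 : T1 -> R)
    d2 (T2 : measurableType d2) (P2 : probability T2 R) (X2 : T2 -> R) :
  measurable_fun setT X1 -> measurable_fun setT X2 ->
  (forall t, 0 <= X1 t) -> (forall t, 0 <= X2 t) ->
  (forall k, \int[P1]_t squash_moment (X1 t) k =
             \int[P2]_t squash_moment (X2 t) k) ->
  forall B, measurable B -> P1 (X1 @^-1` B) = P2 (X2 @^-1` B).
Proof.
move=> mX1 mX2 X10 X20 h.
have hray y : P1 (X1 @^-1` `]-oo, y[%classic) = P2 (X2 @^-1` `]-oo, y[%classic).
  (* The polynomials need a positive threshold; for other [y] both events are empty, the variables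
     being nonnegative. *)
  have [y0|y0] := leP y 0.
    have pre0 d (T : measurableType d) (X : T -> R) : (forall t, 0 <= X t) ->
        X @^-1` `]-oo, y[%classic = set0.
      move=> X0; apply/seteqP; split => t //=; rewrite in_itv /= => Xy.
      by have := X0 t; rewrite leNgt (lt_le_trans Xy y0).
    by rewrite !pre0// !measure0.
  have := cvg_squash_indicator (P := P1) mX1 X10 y0.
  have := cvg_squash_indicator (P := P2) mX2 X20 y0.
  have -> : (fun n => (\int[P2]_t (Num.sqrt (1 - squash (X2 t)) *
     (indicator_poly (squash y) n).[squash (X2 t)])%:E)%E) =
    (fun n => (\int[P1]_t (Num.sqrt (1 - squash (X1 t)) *
     (indicator_poly (squash y) n).[squash (X1 t)])%:E)%E).
    apply/funext => n; set p := indicator_poly _ n.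
    have [i1 e1] := @Rintegral_squash_poly R _ _ P1 _ mX1 X10 p.
    have [i2 e2] := @Rintegral_squash_poly R _ _ P2 _ mX2 X20 p.
    have := integrable_fin_num measurableT i1.
    have := integrable_fin_num measurableT i2.
    move=> /fineK <- /fineK <-; congr _%:E.
    rewrite [LHS]e2 [RHS]e1; apply: eq_bigr => i _; by rewrite h.
  by move=> c2 c1; exact: (cvg_unique _ c1 c2).
pose m1 := measure_function_pushforward__canonical__measure_function_Measure P1 mX1.
pose m2 := measure_function_pushforward__canonical__measure_function_Measure P2 mX2.
move=> B mB; apply: (@measure_unique _ R _ (@RGenInftyO.G R)
  (fun n => `]-oo, n%:R[%classic) _ _ _ _ m1 m2) => //.
- exact: RGenInftyO.measurableE.
- move=> _ _ [x ->] [y ->]; exists (Num.min x y).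
  apply/seteqP; split => z /=; rewrite !in_itv /= lt_min.
    by move=> [-> ->].
  by move=> /andP[].
- by move=> i; exists i%:R.
- rewrite -subTset => x _; exists (Num.bound `|x|) => //=.
  rewrite in_itv /=; apply: le_lt_trans (ler_norm x) _.
  exact: archi_boundP.
- by move=> _ [x ->]; exact: hray.
- move=> n; apply: le_lt_trans (ltry 1).
  apply: (@probability_le1 _ _ _ P1); rewrite -[X in measurable X]setTI.
  exact: (mX1 measurableT).
Qed.

Lemma integrable_scale d (T : measurableType d) (R : realType)
    (P : {measure set T -> \bar R}) (c : R) (f : T -> R) :
  P.-integrable setT (EFin \o f) -> P.-integrable setT (EFin \o (fun t => c * f t)).
Proof. by move=> fi; exact: (integrableZl measurableT c fi). Qed.

Lemma integrable_add d (T : measurableType d) (R : realType)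
    (P : {measure set T -> \bar R}) (f g : T -> R) :
  P.-integrable setT (EFin \o f) -> P.-integrable setT (EFin \o g) ->
  P.-integrable setT (EFin \o (fun t => f t + g t)).
Proof. by move=> fi gi; exact: (integrableD measurableT fi gi). Qed.

(** * Gaussian test functions and the law of a squared norm *)

Section gaussian_test_functions.
Context {R : realType}.

Definition gauss_test k (x : R) := (x ^+ 2) ^+ k * expR (- x ^+ 2 / 2).

Definition normal_even_moment k : \bar R :=
  (\int[normal_prob 0 1]_x ((x ^+ 2) ^+ k)%:E)%E.

Lemma measurable_even_pow k : measurable_fun [set: R] (fun x => (x ^+ 2) ^+ k).
Proof. by do 2 apply: measurable_funX. Qed.

Lemma measurable_gauss_test k : measurable_fun [set: R] (gauss_test k).
Proof.
apply: measurable_funM; first exact: measurable_even_pow.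
apply: measurableT_comp => //; apply: measurable_funM => //.
by apply: measurableT_comp => //; apply: measurable_funX.
Qed.

Lemma gauss_test_ge0 k x : 0 <= gauss_test k x.
Proof. by rewrite mulr_ge0 ?expR_ge0// exprn_ge0// sqr_ge0. Qed.

(** The bound [y^k <= k! exp y] at [y = x^2 / 4] reduces all even powers to one exponential. *)
Lemma integrable_even_pow k :
  (normal_prob (0 : R) 1).-integrable setT (EFin \o (fun x => (x ^+ 2) ^+ k)).
Proof.
have r0 : 0 < Num.sqrt (2 : R) by rewrite sqrtr_gt0.
(* A coefficient below 1/2 keeps the exponential integrable; with 1/4 the tilted density is the
   normal one of variance 2, of mass [sqrt 2]. *)
pose e (x : R) := x ^+ 2 / 4.
have me : measurable_fun [set: R] e.
  by apply: measurable_funM => //; apply: measurable_funX.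
have E := @integral_exp_tilt R 0 1 e (Num.sqrt 2) 0 (Num.sqrt 2) (ltW r0) me.
have {E} : (\int[normal_prob 0 1]_x (expR (e x))%:E = (Num.sqrt 2)%:E)%E.
  apply: E => x; have := @normal_pdf_rescale R 0 1 (Num.sqrt 2) x ltr01 r0.
  rewrite mul1r => ->; rewrite -(mulrA (Num.sqrt 2)^-1) mulVKf ?gt_eqF//.
  congr (expR _ * _); rewrite sqr_sqrtr// subr0 expr1n /e; by field.
move=> E.
have ie : (normal_prob (0 : R) 1).-integrable setT
    (EFin \o (fun x => (4 ^+ k * k`!%:R) * expR (e x))).
  apply: integrable_scale; apply/integrableP; split.
    by apply/measurable_EFinP; apply: measurableT_comp.
  by under eq_integral do rewrite /= ger0_norm ?expR_ge0//; rewrite E ltry.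
apply: le_integrable ie => //.
  by apply/measurable_EFinP; exact: measurable_even_pow.
move=> x _ /=; rewrite lee_fin [leLHS]ger0_norm; last by apply: exprn_ge0; exact: sqr_ge0.
apply: le_trans (ler_norm _).
have e0 : 0 <= e x by rewrite divr_ge0 ?sqr_ge0.
have -> : x ^+ 2 = 4 * e x by rewrite /e; field.
rewrite exprMn -mulrA; apply: ler_wpM2l; first by rewrite exprn_ge0.
case: k => [|k]; first by rewrite fact0 mul1r expr0 -expR0 ler_expR.
rewrite mulrC -ler_pdivrMr ?ltr0n ?fact_gt0//.
by have := expR_ge1Dxn k e0; lra.
Qed.

(** Bernoulli's inequality [1 + k (y - 1) <= y^k] at [y = x^2], integrated with unit variance. The
    bound makes the constant cancellable without its exact value. *)
Lemma normal_even_moment_ge1 k : (1 <= normal_even_moment k)%E.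
Proof.
pose N := normal_prob (0 : R) 1 : probability (measurableTypeR R) R.
have i1 : N.-integrable setT (EFin \o (fun x : measurableTypeR R => x : R)).
  have iC : N.-integrable setT (EFin \o (fun=> 1)).
    exact: finite_measure_integrable_cst.
  have i3 : N.-integrable setT
      (EFin \o (fun x : measurableTypeR R => ((x : R) ^+ 2) ^+ 1 + 1)).
    exact: integrable_add (integrable_even_pow 1) iC.
  apply: le_integrable i3 => //; first exact/measurable_EFinP.
  move=> x _ /=; rewrite lee_fin expr1.
  apply: le_trans (ler_norm _).
  have [x0|x0] := leP 0 (x : R); [rewrite ger0_norm//|rewrite ltr0_norm//]; nra.
have i2 : N.-integrable setT (EFin \o (fun x : measurableTypeR R => (x : R) ^+ 2)).
  exact: integrable_even_pow 1.
have V1 : \int[N]_x ((x : R) ^+ 2) = 1.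
  have := @normal_variance _ (measurableTypeR R) R N (fun x => x) 0 1
    (@measurable_id _ _ setT) ltr01 (fun _ _ => erefl) i1 i2.
  by under eq_Rintegral do rewrite subr0; rewrite expr1n.
have b (y : R) : 0 <= y -> 1 + k%:R * (y - 1) <= y ^+ k.
  move=> y0; elim: k => [|k IH]; first by rewrite mul0r addr0 expr0.
  rewrite exprS -natr1; have := ler_wpM2l y0 IH.
  have : 0 <= k%:R * (y - 1) ^+ 2 by rewrite mulr_ge0// sqr_ge0.
  nra.
have ik : N.-integrable setT (EFin \o (fun x => (x ^+ 2) ^+ k)).
  exact: integrable_even_pow.
have ic : N.-integrable setT (EFin \o cst (1 - k%:R)).
  exact: finite_measure_integrable_cst.
have il : N.-integrable setT (EFin \o (fun x => k%:R * x ^+ 2)).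
  exact: integrable_scale.
have <- : ((\int[N]_x ((x : R) ^+ 2) ^+ k)%:E = normal_even_moment k)%E.
  exact: (fineK (integrable_fin_num measurableT ik)).
rewrite lee_fin.
have := @le_Rintegral _ _ R N setT (fun x => (1 - k%:R) + k%:R * x ^+ 2)
  (fun x => (x ^+ 2) ^+ k) measurableT (integrableD measurableT ic il) ik.
rewrite RintegralD// Rintegral_prob_cst RintegralZl// V1 mulr1 subrK; apply.
by move=> x _; have := b (x ^+ 2) (sqr_ge0 x); lra.
Qed.

Lemma normal_even_moment_fin_num k : normal_even_moment k \is a fin_num.
Proof. exact: (integrable_fin_num measurableT (integrable_even_pow k)). Qed.

(** The factor [expR (- x^2 / 2)] turns the density of variance [v] into [(1 + v)^(-1/2)] times that
    of variance [v / (1 + v)], which is [squash v]; the even moment then scales by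
    [squash v ^+ k]. *)
Lemma integral_gauss_test d (T : measurableType d) (P : probability T R)
    (Y : T -> R) (v : R) k : 0 <= v -> measurable_fun [set: T] Y ->
  (forall B, measurable B -> P (Y @^-1` B) = normal_law 0 v B) ->
  (\int[P]_t (gauss_test k (Y t))%:E =
   (squash_moment v k)%:E * normal_even_moment k)%E.
Proof.
move=> v0 mY law.
have mg : measurable_fun [set: R] (fun x => (gauss_test k x)%:E).
  by apply/measurable_EFinP; exact: measurable_gauss_test.
have g0 x : (0 <= (gauss_test k x)%:E)%E by rewrite lee_fin gauss_test_ge0.
(* At variance 0 there is no density, but both sides reduce to [0 ^+ k], the standard moment being 1
   for [k = 0]. *)
have [v_eq0|v_neq0] := eqVneq v 0.
  have lS0 A : measurable A -> P (Y @^-1` A) = \d_(0 : R) A.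
    by move=> mA; rewrite law// /normal_law v_eq0 eqxx.
  rewrite (ge0_integral_law mY lS0 mg g0) integral_dirac// diracT mul1e.
  rewrite /squash_moment v_eq0 /squash mul0r subr0 sqrtr1 mul1r.
  rewrite /gauss_test expr0n /= oppr0 mul0r expR0 mulr1.
  case: k {mg g0} => [|k]; last by rewrite exprS !mul0r mul0e.
  rewrite !expr0 mul1e /normal_even_moment.
  under eq_integral do rewrite expr0.
  by rewrite integral_cst// mul1e; apply/esym/probability_setT.
have v_gt0 : 0 < v by rewrite lt_neqAle eq_sym v_neq0.
have s0 : 0 < Num.sqrt v by rewrite sqrtr_gt0.
have lS1 A : measurable A -> P (Y @^-1` A) = normal_prob 0 (Num.sqrt v) A.
  by move=> mA; rewrite law// /normal_law (negbTE v_neq0).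
rewrite (@ge0_integral_law _ _ _ (measurableTypeR R) _ _ (normal_prob 0 (Num.sqrt v)) _
  mY lS1 _ mg g0).
have v1 : 0 < 1 + v by lra.
set r := Num.sqrt (1 - squash v).
have rE : 1 - squash v = (1 + v)^-1 by rewrite /squash ger0_norm//; field; lra.
have r2 : r ^+ 2 = (1 + v)^-1 by rewrite /r rE sqr_sqrtr// invr_ge0 ltW.
have r0 : 0 < r by rewrite /r rE sqrtr_gt0 invr_gt0.
rewrite (ge0_integral_normal 0 (Num.sqrt v) mg g0).
have E x : gauss_test k x * normal_pdf 0 (Num.sqrt v) x =
    r * ((x ^+ 2) ^+ k * normal_pdf 0 (Num.sqrt v * r) x).
  rewrite (normal_pdf_rescale _ _ s0 r0) (mulrCA r) -(mulrA r^-1) mulVKf ?gt_eqF//.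
  rewrite /gauss_test -mulrA; congr (_ * (expR _ * _)).
  by rewrite r2 sqr_sqrtr// invrK subr0; field; lra.
under eq_integral do rewrite -EFinM E EFinM.
have mp s : measurable_fun [set: R] (fun x => ((x ^+ 2) ^+ k * normal_pdf 0 s x)%:E).
  apply/measurable_EFinP; apply: measurable_funM; first exact: measurable_even_pow.
  exact: measurable_normal_pdf.
rewrite ge0_integralZl//; last 3 first.
- exact: mp.
- by move=> x _; rewrite lee_fin mulr_ge0 ?normal_pdf_ge0// exprn_ge0// sqr_ge0.
- by rewrite lee_fin ltW.
have me : measurable_fun [set: R] (fun x : R => ((x ^+ 2) ^+ k)%:E).
  by apply/measurable_EFinP; exact: measurable_even_pow.
have e0 (x : R) : (0 <= ((x ^+ 2) ^+ k)%:E)%E by rewrite lee_fin exprn_ge0// sqr_ge0.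
have sr0 : 0 < Num.sqrt v * r by rewrite mulr_gt0.
have := ge0_integral_normal_affine 0 (lt0r_neq0 sr0) me e0.
rewrite (gtr0_norm sr0) (ge0_integral_normal 0 (Num.sqrt v * r) me e0).
under [in X in _ = X -> _]eq_integral do rewrite -EFinM.
move=> <-; rewrite /squash_moment EFinM -muleA; congr (_ * _)%E.
have -> : squash v = (Num.sqrt v * r) ^+ 2.
  by rewrite exprMn sqr_sqrtr// r2 /squash ger0_norm.
transitivity (\int[normal_prob 0 1]_x
    ((((Num.sqrt v * r) ^+ 2) ^+ k)%:E * ((x ^+ 2) ^+ k)%:E))%E.
  by apply: eq_integral => x _; rewrite add0r -EFinM -!exprMn.
by rewrite ge0_integralZl.
Qed.

End gaussian_test_functions.

Lemma gaussian_sqnorm_law (R : realType) d (T : measurableType d)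
    (P : probability T R) (v : nat) (tau : R) (W : nat -> T -> R) :
  0 <= tau ->
  (forall i, measurable_fun setT (W i)) ->
  (forall w : nat -> R, forall B, measurable B ->
    P ((fun t => \sum_(i < v) w i * W i t) @^-1` B) =
    normal_law 0 (tau * \sum_(i < v) w i ^+ 2) B) ->
  forall B, measurable B ->
  P ((fun t => \sum_(i < v) W i t ^+ 2) @^-1` B) = scaled_chi_square tau v B.
Proof.
move=> tau0 mW lW B mB.
have [d' [S [G [V [mV lV cV]]]]] := gaussian_vector_exists R v.
have mtau : measurable_fun setT (fun x : R => tau * x) by exact: measurable_funM.
have mtB : measurable ((fun x => tau * x) @^-1` B).
  by rewrite -[X in measurable X]setTI; exact: mtau.
rewrite /scaled_chi_square -cV// -comp_preimage.
have msq d0 (T0 : measurableType d0) (Z : nat -> T0 -> R) :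
    (forall i, measurable_fun setT (Z i)) ->
    measurable_fun setT (fun t => \sum_(i < v) Z i t ^+ 2).
  by move=> mZ; apply: measurable_sum => i; apply: measurable_funX.
have sq0 (f : nat -> R) : 0 <= \sum_(i < v) f i ^+ 2.
  by apply: sumr_ge0 => i _; exact: sqr_ge0.
apply: law_determined_by_squash_moments mB => [||t|t|k];
  [exact: msq|exact: measurableT_comp mtau (msq _ _ _ mV)|exact: (sq0 (W ^~ t))|
   exact: mulr_ge0 tau0 (sq0 (V ^~ t))|].
pose F (z : T * S) := (gauss_test k (\sum_(i < v) W i z.1 * V i z.2))%:E.
have mF : measurable_fun setT F.
  apply/measurable_EFinP; apply: measurableT_comp; first exact: measurable_gauss_test.
  apply: measurable_sum => i; apply: measurable_funM.
    exact: measurableT_comp (mW i) measurable_fst.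
  exact: measurableT_comp (mV i) measurable_snd.
have F0 z : (0 <= F z)%E by rewrite lee_fin gauss_test_ge0.
have := @fubini_tonelli _ _ _ _ R P G F mF F0.
have mS d0 (T0 : measurableType d0) (Z : nat -> T0 -> R) (f : nat -> R) :
    (forall i, measurable_fun setT (Z i)) ->
    measurable_fun setT (fun t => \sum_(i < v) f i * Z i t).
  by move=> mZ; apply: measurable_sum => i; apply: measurable_funM.
(* For fixed [t] the numbers [W i t] are coefficients of a linear combination of [V], whose variance
   is the squared norm of [W] at [t]. *)
under eq_integral => t _.
  rewrite (integral_gauss_test k (sq0 (W ^~ t)) (mS _ _ _ (W ^~ t) mV) (lV (W ^~ t))).
  over.
(* For fixed [g] the roles are exchanged, and the hypothesis on the linear combinations of [W] gives
   variance [tau] times the squared norm of [V]. *)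
under [X in _ = X -> _]eq_integral => g _.
  rewrite /F /=; under eq_integral do under eq_bigr do rewrite mulrC.
  rewrite (integral_gauss_test k (mulr_ge0 tau0 (sq0 (V ^~ g)))
    (mS _ _ _ (V ^~ g) mW) (lW (V ^~ g))).
  over.
have mM d0 (T0 : measurableType d0) (f : T0 -> R) : measurable_fun setT f ->
    measurable_fun setT (fun t => (squash_moment (f t) k)%:E).
  move=> mf; apply/measurable_EFinP.
  exact: measurableT_comp (measurable_squash_moment k) mf.
have M0 (r : R) : 0 <= r -> (0 <= (squash_moment r k)%:E)%E.
  by move=> r0; rewrite lee_fin mulr_ge0 ?sqrtr_ge0// exprn_ge0// squash_ge0.
have mW2 := msq _ _ _ mW.
have mV2 : measurable_fun setT (fun t => tau * \sum_(i < v) V i t ^+ 2).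
  exact: measurableT_comp mtau (msq _ _ _ mV).
have W20 t : 0 <= \sum_(i < v) W i t ^+ 2 by exact: (sq0 (W ^~ t)).
have V20 t : 0 <= tau * \sum_(i < v) V i t ^+ 2.
  exact: mulr_ge0 tau0 (sq0 (V ^~ t)).
have c1 := @normal_even_moment_ge1 R k.
have cf := @normal_even_moment_fin_num R k.
rewrite !ge0_integralZr//; last 6 first.
- exact: mM.
- by move=> g _; exact: M0.
- exact: le_trans c1.
- exact: mM.
- by move=> t _; exact: M0.
- exact: le_trans c1.
have E d0 (T0 : measurableType d0) (P0 : probability T0 R) (f : T0 -> R) :
    measurable_fun setT f -> (forall t, 0 <= f t) ->
    ((\int[P0]_t squash_moment (f t) k)%:E = \int[P0]_t (squash_moment (f t) k)%:E)%E.
  move=> mf f0; apply: fineK; apply: (@integrable_fin_num _ _ _ P0) => //.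
  apply: (@integrable_prob_bounded _ _ _ _ _ 1); first exact/measurable_EFinP/mM.
  by move=> t; apply: squash_moment_bound.
rewrite -[X in (X * _)%E = _](E _ _ P _ mW2 W20) -[X in _ = (X * _)%E](E _ _ G _ mV2 V20).
(* The standard normal moment is a common factor, finite and positive. *)
rewrite -(fineK cf) -!EFinM => -[]; apply: mulIf.
by rewrite gt_eqF// -lte_fin (fineK cf) (lt_le_trans _ c1)// lte01.
Qed.

(** * Degenerate kernels *)

Section law_transfer.
Context d d' (T : measurableType d) (U : measurableType d') (R : realType).
Variables (P : {measure set T -> \bar R}) (nu : {measure set U -> \bar R}).
Variables (Y : T -> U) (mY : measurable_fun [set: T] Y).
Hypothesis law : forall B, measurable B -> P (Y @^-1` B) = nu B.

Lemma integrable_law (g : U -> \bar R) : measurable_fun [set: U] g ->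
  P.-integrable setT (g \o Y) <-> nu.-integrable setT g.
Proof.
move=> mg; have mg' : measurable_fun setT (fun u => `|g u|%E).
  exact: measurableT_comp.
have E := ge0_integral_law mY law mg' (fun=> abse_ge0 _).
split=> /integrableP[_ h]; apply/integrableP; split => //.
- by rewrite -E.
- exact: measurableT_comp.
- by rewrite /= E.
Qed.

Lemma integral_law (g : U -> \bar R) : measurable_fun [set: U] g ->
  P.-integrable setT (g \o Y) -> (\int[P]_w g (Y w) = \int[nu]_x g x)%E.
Proof.
move=> mg ig; transitivity (\int[pushforward P Y]_x g x)%E.
  by rewrite [RHS]integral_pushforward.
by apply: eq_measure_integral => // B mB _; rewrite -law.
Qed.

End law_transfer.

(** * Conditional expectations of kernels *)

Section condexp_version.
Context d (T : measurableType d) (R : realType) (P : probability T R).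

(** The event where one version is below the other lies in the sigma-algebra of [Z], so both
    versions have the same integral on it; a positive difference with zero integral lives on a null
    set. The reverse inequality is symmetric. *)
Lemma condexp_ae_unique (X Z : T -> R) (W1 W2 : T -> R) :
  measurable_fun setT Z ->
  is_condexp P X Z W1 -> is_condexp P X Z W2 -> ae_eq P setT W1 W2.
Proof.
move=> mZ [i1 m1 e1] [i2 m2 e2].
have sigma_meas A : g_sigma_algebra_preimage Z A -> measurable A.
  by move=> [B mB <-]; exact: mZ.
(* The same space with the sigma-algebra of [Z], in which comparing two measurable functions gives
   an event of that sigma-algebra. *)
pose TZ := g_sigma_algebra_preimageType Z.
have mW (W : T -> R) :
    (forall B, measurable B -> g_sigma_algebra_preimage Z (W @^-1` B)) ->
    measurable_fun [set: TZ] (W : TZ -> R).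
  by move=> h _ B mB; rewrite setTI; exact: h.
have mlt (V W : T -> R) :
    (forall B, measurable B -> g_sigma_algebra_preimage Z (V @^-1` B)) ->
    (forall B, measurable B -> g_sigma_algebra_preimage Z (W @^-1` B)) ->
    g_sigma_algebra_preimage Z [set w | V w < W w].
  move=> mV mW'; have := measurable_fun_ltr (mW V mV) (mW W mW').
  by move=> /(_ measurableT [set true] I); rewrite setTI.
have half (V W : T -> R) : is_condexp P X Z V -> is_condexp P X Z W ->
    {ae P, forall w, ~ (V w < W w)}.
  move=> [iV mV eV] [iW mW' eW]; pose A := [set w | V w < W w].
  have sA : g_sigma_algebra_preimage Z A by exact: mlt.
  have mA := sigma_meas _ sA.
  have iVA := integrableS measurableT mA (@subsetT _ _) iV.
  have iWA := integrableS measurableT mA (@subsetT _ _) iW.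
  have iD : P.-integrable A (fun w => ((W w)%:E - (V w)%:E)%E).
    exact: integrableB.
  have E0 : (\int[P]_(w in A) ((W w)%:E - (V w)%:E) = 0)%E.
    rewrite integralB// eW// eV// subee//.
    by have := integrable_fin_num mA iVA; rewrite /= eV.
  have : (\int[P]_(w in A) `|(W w)%:E - (V w)%:E| = 0)%E.
    rewrite -E0; apply: eq_integral => w; rewrite inE => Aw.
    by rewrite gee0_abs// -EFinB lee_fin subr_ge0 ltW.
  have [mD _] := integrableP _ _ _ iD.
  move=> /(ae_eq_integral_abs P mA mD).
  apply: filterS => w /= h VW; have := h VW.
  by rewrite -EFinB => -[] /eqP; rewrite subr_eq0 gt_eqF.
have h1 := half _ _ (And3 i1 m1 e1) (And3 i2 m2 e2).
have h2 := half _ _ (And3 i2 m2 e2) (And3 i1 m1 e1).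
apply: filterS2 h1 h2 => w /negP; rewrite -leNgt => l1 /negP; rewrite -leNgt => l2 _.
by apply/eqP; rewrite eq_le l1 l2.
Qed.

End condexp_version.

Section kernel_projection.
Context (R : realType) (nu : probability R R) (k : R -> R -> R).
Hypothesis mk : measurable_fun [set: R * R] (fun z => k z.1 z.2).
Hypothesis ik : (nu \x nu)%E.-integrable setT (fun z => (k z.1 z.2)%:E).

Definition kernel_proj (u : R) : R := \int[nu]_v k u v.

Definition kernel_mean : R := \int[nu]_u kernel_proj u.

(** The second-order Hoeffding component of [k] under [nu]; it is the deterministic function behind
    [double_centered]. *)
Definition centered_kernel (u v : R) : R :=
  k u v - kernel_proj u - kernel_proj v + kernel_mean.

Lemma measurable_kernel_proj : measurable_fun setT kernel_proj.
Proof. by apply: measurableT_comp (measurable_fubini_F ik). Qed.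

Lemma kernel_section_integrable :
  {ae nu, forall u, nu.-integrable setT (fun v => (k u v)%:E)}.
Proof. exact: (ae_integrable1 ik). Qed.

(** A real-valued integral is finite by construction, so it agrees with the extended one only where
    the section is integrable, which Fubini's theorem grants almost everywhere. *)
Lemma kernel_proj_ae :
  {ae nu, forall u, (\int[nu]_v (k u v)%:E = (kernel_proj u)%:E)%E}.
Proof.
apply: filterS kernel_section_integrable => u iu.
by rewrite /kernel_proj /Rintegral fineK// integrable_fin_num.
Qed.

Lemma integrable_kernel_proj : nu.-integrable setT (EFin \o kernel_proj).
Proof.
have mp : measurable_fun setT (EFin \o kernel_proj).
  by apply/measurable_EFinP; exact: measurable_kernel_proj.
have /integrableP[mF iF] := integrable_fubini_F ik.
apply/integrableP; split=> //; apply: le_lt_trans iF.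
rewrite le_eqVlt; apply/orP; left; apply/eqP.
apply: ae_eq_integral => //; [exact: measurableT_comp|exact: measurableT_comp|].
by apply: filterS kernel_proj_ae => u h _; rewrite /fubini_F /= h.
Qed.

Lemma measurable_centered_kernel :
  measurable_fun [set: R * R] (fun z => centered_kernel z.1 z.2).
Proof.
apply: measurable_funD => //; apply: measurable_funB.
  apply: measurable_funB => //.
  exact: measurableT_comp measurable_kernel_proj measurable_fst.
exact: measurableT_comp measurable_kernel_proj measurable_snd.
Qed.

Lemma kernel_meanE : (kernel_mean)%:E = (\int[(nu \x nu)%E]_z (k z.1 z.2)%:E)%E.
Proof.
rewrite -(integral12_prod_meas1 ik).
rewrite /kernel_mean /Rintegral fineK; last first.
  exact: (integrable_fin_num measurableT integrable_kernel_proj).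
apply: ae_eq_integral => //.
- by apply/measurable_EFinP; exact: measurable_kernel_proj.
- exact: measurable_fubini_F ik.
- by apply: filterS kernel_proj_ae => u h _; rewrite /fubini_F /= h.
Qed.

Lemma centered_kernel_degenerate : {ae nu, forall u,
  nu.-integrable setT (fun v => (centered_kernel u v)%:E) /\
  (\int[nu]_v (centered_kernel u v)%:E = 0)%E}.
Proof.
apply: filterS kernel_section_integrable => u iu.
have iN : nu.-integrable setT (EFin \o (fun v => -1 * kernel_proj v)).
  by apply: integrable_scale; exact: integrable_kernel_proj.
pose c := kernel_mean - kernel_proj u.
have iC : nu.-integrable setT (EFin \o cst c).
  exact: finite_measure_integrable_cst.
have iNC := integrable_add iN iC.
have E : centered_kernel u = (fun v => k u v + (-1 * kernel_proj v + c)).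
  by apply/funext => v; rewrite /centered_kernel /c; ring.
rewrite E; split; first exact: integrable_add.
have := integrable_fin_num measurableT (integrable_add iu iNC).
move=> /fineK <-; rewrite -[fine _]/(\int[nu]_v (k u v + (-1 * kernel_proj v + c))).
rewrite RintegralD// RintegralD// RintegralZl//; last exact: integrable_kernel_proj.
rewrite Rintegral_prob_cst -/(kernel_proj u) -/kernel_mean; congr _%:E.
by rewrite /c; ring.
Qed.

Context d (T : measurableType d) (P : probability T R).

Lemma condexp_kernel (x y : T -> R) :
  measurable_fun setT x -> measurable_fun setT y ->
  (forall C, measurable C -> P ((fun w => (x w, y w)) @^-1` C) = (nu \x nu)%E C) ->
  is_condexp P (fun w => k (x w) (y w)) x (kernel_proj \o x).
Proof.
move=> mx my law.
have mxy : measurable_fun [set: T] (fun w => (x w, y w)) by exact: measurable_fun_pair.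
have lawx B : measurable B -> P (x @^-1` B) = nu B.
  move=> mB; have -> : x @^-1` B = (fun w => (x w, y w)) @^-1` (B `*` setT).
    by apply/seteqP; split => w //= [].
  rewrite law; last exact: measurableX.
  rewrite product_measure1E//; transitivity (nu B * 1)%E; last by rewrite mule1.
  by congr (_ * _)%E; exact: probability_setT.
have mp := measurable_kernel_proj.
have mpE : measurable_fun setT (EFin \o kernel_proj) by exact/measurable_EFinP.
have iP : P.-integrable setT (EFin \o (kernel_proj \o x)).
  exact: (proj2 (integrable_law mx lawx mpE) integrable_kernel_proj).
split.
- exact: iP.
- move=> B mB; exists (kernel_proj @^-1` B); last by rewrite setTI comp_preimage.
  by rewrite -[X in measurable X]setTI; exact: measurable_kernel_proj.
move=> _ [B mB <-]; rewrite setTI.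
have mxB : measurable (x @^-1` B) by rewrite -[X in measurable X]setTI; exact: mx.
have m1B : measurable_fun setT (fun u : R => \1_B u : R) by exact: measurable_indic.
have EI (f : T -> R) : (\int[P]_(w in x @^-1` B) (f w)%:E =
    \int[P]_w (\1_B (x w) * f w)%:E)%E.
  rewrite integral_mkcond; apply: eq_integral => w _; rewrite patchE indicE.
  have -> : (w \in x @^-1` B) = (x w \in B) by apply/idP/idP; rewrite !inE.
  by case: ifP; rewrite ?mul1r ?mul0r.
have bnd (f : T -> R) : P.-integrable setT (EFin \o f) ->
    P.-integrable setT (fun w => (\1_B (x w) * f w)%:E).
  move=> fi; have /integrableP[/measurable_EFinP mf _] := fi.
  apply: le_integrable fi => //.
    apply/measurable_EFinP; apply: measurable_funM => //.
    exact: measurableT_comp m1B mx.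
  move=> w _ /=; rewrite lee_fin normrM indicE.
  by case: (_ \in _); rewrite ?normr1 ?normr0 ?mul1r ?mul0r.
rewrite !EI.
have mkE : measurable_fun setT (fun z : R * R => (k z.1 z.2)%:E).
  exact/measurable_EFinP.
have iK : P.-integrable setT (EFin \o (fun w => k (x w) (y w))).
  exact: (proj2 (integrable_law mxy law mkE) ik).
pose g1 u := (\1_B u * kernel_proj u)%:E.
pose g2 (z : R * R) := (\1_B z.1 * k z.1 z.2)%:E.
have mg1 : measurable_fun setT g1.
  by apply/measurable_EFinP; exact: measurable_funM.
have mg2 : measurable_fun setT g2.
  apply/measurable_EFinP; apply: measurable_funM => //.
  exact: measurableT_comp m1B measurable_fst.
rewrite (integral_law mx lawx mg1); last exact: bnd iP.
rewrite (integral_law mxy law mg2); last exact: bnd iK.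
have ig2 : (nu \x nu)%E.-integrable setT g2.
  by apply: (proj1 (integrable_law mxy law mg2)); exact: bnd iK.
rewrite -(integral12_prod_meas1 ig2); apply: ae_eq_integral => //.
  exact: measurable_fubini_F ig2.
apply: filterS kernel_proj_ae => u h _.
rewrite /g1 /fubini_F /g2 /= indicE; case: (u \in B).
  by under eq_integral do rewrite mul1r; rewrite h mul1r.
by under eq_integral do rewrite mul0r; rewrite integral0 mul0r.
Qed.

(** [condexp] is a chosen version, known only through its defining property; almost sure uniqueness
    replaces it by [kernel_proj]. Symmetry of [k] covers the conditioning on the second variable. *)
Lemma double_centered_ae (x y : T -> R) : (forall u v, k u v = k v u) ->
  measurable_fun setT x -> measurable_fun setT y ->
  (forall C, measurable C -> P ((fun w => (x w, y w)) @^-1` C) = (nu \x nu)%E C) ->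
  (forall C, measurable C -> P ((fun w => (y w, x w)) @^-1` C) = (nu \x nu)%E C) ->
  ae_eq P setT (double_centered P k x y) (fun w => centered_kernel (x w) (y w)).
Proof.
move=> k_sym mx my lxy lyx.
have cx := condexp_kernel mx my lxy.
have cy : is_condexp P (fun w => k (x w) (y w)) y (kernel_proj \o y).
  have := condexp_kernel my mx lyx.
  by rewrite (_ : (fun w => k (y w) (x w)) = (fun w => k (x w) (y w)))//; apply/funext => w.
have Ex := condexp_ae_unique mx (xgetI (cst 0) cx : is_condexp P _ x (condexp P _ x)) cx.
have Ey := condexp_ae_unique my (xgetI (cst 0) cy : is_condexp P _ y (condexp P _ y)) cy.
have mxy : measurable_fun [set: T] (fun w => (x w, y w)) by exact: measurable_fun_pair.
have mkE : measurable_fun setT (fun z : R * R => (k z.1 z.2)%:E).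
  exact/measurable_EFinP.
have Em : fine 'E_P[fun w => k (x w) (y w)]%E = kernel_mean.
  rewrite unlock (integral_law mxy lxy mkE) -?kernel_meanE//.
  exact: (proj2 (integrable_law mxy lxy mkE) ik).
apply: filterS2 Ex Ey => w /(_ I) /= ex /(_ I) /= ey _.
by rewrite /double_centered /= Em ex ey.
Qed.

End kernel_projection.

(** * Independence of one observation from the others *)

Section independent_family.
Context d d' (T : measurableType d) (S : measurableType d') (R : realType).
Context (P : probability T R) (n : nat) (Z : 'I_n -> {RV P >-> S}).
Hypothesis indep : mutually_independent Z.

(** A pi-system generating the information of all observations but [t]. Keeping the index [t] with
    the full space lets the product formula over all indices apply as it stands. *)
Definition cylinders (t : 'I_n) : set (set T) :=
  [set E | exists A : 'I_n -> set S, [/\ forall s, measurable (A s),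
     A t = setT & E = \bigcap_(s in [set: 'I_n]) (Z s @^-1` A s)]].

Let mZ s A : measurable A -> measurable (Z s @^-1` A).
Proof. by move=> mA; rewrite -[X in measurable X]setTI; exact: measurable_funP. Qed.

Let mbig (A : 'I_n -> set S) : (forall s, measurable (A s)) ->
  measurable (\bigcap_(s in [set: 'I_n]) (Z s @^-1` A s)).
Proof.
by move=> mA; apply: fin_bigcap_measurable => [|s _]; [exact: finite_finset|exact: mZ].
Qed.

(** On cylinders, putting [B] in place of the trivial factor at [t] reduces the claim to mutual
    independence; uniqueness of measures extends it to the generated sigma-algebra. *)
Lemma cylinders_indep (t : 'I_n) (B : set S) (E : set T) :
  measurable B -> <<s cylinders t >> E ->
  P (E `&` Z t @^-1` B) = (P E * P (Z t @^-1` B))%E.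
Proof.
move=> mB sE; have mtB := mZ t mB.
pose c := fine (P (Z t @^-1` B)).
have c0 : 0 <= c by rewrite fine_ge0.
have cE : P (Z t @^-1` B) = c%:E by rewrite /c fineK// fin_num_measure.
have mcyl F : cylinders t F -> measurable F by move=> [A [mA _ ->]]; exact: mbig.
(* Both sides are read as finite measures in [E]: a restriction of [P] and a multiple of [P]. *)
rewrite cE muleC -[LHS]/(mrestr P mtB E) -[RHS]/(mscale (NngNum c0) P E).
apply: (g_sigma_algebra_measure_unique (cylinders t) mcyl (fun=> setT)) sE => //.
- move=> _; exists (fun=> setT); split=> //; apply/seteqP.
  by split=> // w _ s _.
- by rewrite -subTset => w _; exists 0%N.
- move=> _ _ [A1 [mA1 A1t ->]] [A2 [mA2 A2t ->]].
  exists (fun s => A1 s `&` A2 s); split.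
  + by move=> s; exact: measurableI.
  + by rewrite A1t A2t setIT.
  + by rewrite -bigcapI; apply: eq_bigcapr => s _; rewrite preimage_setI.
- move=> _ [A [mA At ->]].
  pose A' s := if s == t then B else A s.
  have mA' s : measurable (A' s) by rewrite /A'; case: ifP.
  set E0 := \bigcap_(s in _) _.
  suff H : P (E0 `&` Z t @^-1` B) = (c%:E * P E0)%E by exact: H.
  rewrite -cE /E0.
  have -> : (\bigcap_(s in [set: 'I_n]) (Z s @^-1` A s)) `&` Z t @^-1` B =
      \bigcap_(s in [set: 'I_n]) (Z s @^-1` A' s).
    apply/seteqP; split => w.
      by move=> [h b] s _; rewrite /A'; case: eqP => [->//|_]; exact: h.
    move=> h; split; last by have := h t I; rewrite /A' /= eqxx.
    move=> s _; have := h s I; rewrite /A' /=; case: eqP => // -> _.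
    by rewrite At.
  rewrite !indep// (bigD1 t)//= [in RHS](bigD1 t)//= /A' eqxx At preimage_setT.
  rewrite probability_setT mul1e; congr (_ * _)%E.
  by apply: eq_bigr => s /negbTE ->.
- move=> _; suff H : (P (setT `&` Z t @^-1` B) < +oo)%E by exact: H.
  by rewrite setTI cE ltry.
Qed.

Lemma cylinder_measurable d1 (V : measurableType d1) (t s : 'I_n) (f : S -> V) :
  s != t -> measurable_fun setT f ->
  measurable_fun [set: g_sigma_algebraType (cylinders t)]
    ((fun w => f (Z s w)) : g_sigma_algebraType (cylinders t) -> V).
Proof.
move=> st mf _ C mC; rewrite setTI; apply: sub_sigma_algebra.
exists (fun r => if r == s then f @^-1` C else setT); split.
- by move=> r; case: ifP => // _; rewrite -[X in measurable X]setTI; exact: mf.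
- by rewrite eq_sym (negbTE st).
apply/seteqP; split => w.
  by move=> h r _ /=; case: eqP => // ->.
by move=> /(_ s I) /=; rewrite eqxx.
Qed.

(** Measurability of [Y] with respect to the cylinders expresses that it depends on the other
    observations only; the two laws then agree on rectangles. *)
Lemma cylinder_joint_law d1 (U : measurableType d1) (t : 'I_n)
    (Y : g_sigma_algebraType (cylinders t) -> U) (f : S -> R)
    (rho : probability U R) (nu : probability R R) :
  measurable_fun setT Y -> measurable_fun setT f ->
  (forall A, measurable A -> P (Y @^-1` A) = rho A) ->
  (forall B, measurable B -> P ((fun w => f (Z t w)) @^-1` B) = nu B) ->
  forall C, measurable C ->
  P ((fun w : T => (Y w, f (Z t w))) @^-1` C) = (rho \x nu)%E C.
Proof.
move=> mY mf lY lf C mC.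
have mcyl F : cylinders t F -> measurable F by move=> [A [mA _ ->]]; exact: mbig.
have sY A : measurable A -> <<s cylinders t >> (Y @^-1` A).
  by move=> mA; have := mY measurableT A mA; rewrite setTI.
have mY' : measurable_fun [set: T] (Y : T -> U).
  move=> _ A mA; rewrite setTI; have := sY A mA.
  by apply: smallest_sub => //; exact: sigma_algebra_measurable.
have mf' : measurable_fun [set: T] (fun w => f (Z t w)) by exact: measurableT_comp.
have mYf : measurable_fun [set: T] (fun w => (Y w : U, f (Z t w))).
  exact: measurable_fun_pair.
pose m' := measure_function_pushforward__canonical__measure_function_Measure P mYf.
apply/esym; apply: (@product_measure_unique _ _ _ _ _ rho nu m') => // A B mA mB.
have mfB : measurable (f @^-1` B) by rewrite -[X in measurable X]setTI; exact: mf.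
transitivity (P (Y @^-1` A) * P ((fun w => f (Z t w)) @^-1` B))%E.
  by rewrite -[RHS](cylinders_indep mfB (sY A mA)).
by congr (_ * _)%E; [exact: lY|exact: lf].
Qed.

End independent_family.

Section degenerate_kernel_orthogonality.
Context d d' (T : measurableType d) (S : measurableType d') (R : realType).
Context (P : probability T R) (n : nat) (Z : 'I_n -> {RV P >-> S}).
Hypothesis indep : mutually_independent Z.
Context (nu : probability R R) (k : R -> R -> R) (phi : S -> R).
Hypothesis mk : measurable_fun [set: R * R] (fun z => k z.1 z.2).
Hypothesis ik : (nu \x nu)%E.-integrable setT (fun z => (k z.1 z.2)%:E).
Hypothesis mphi : measurable_fun setT phi.
Hypothesis lphi : forall s B, measurable B ->
  P ((fun w => phi (Z s w)) @^-1` B) = nu B.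

(** The observation [t] occurs in the centered kernel alone, so integrating over it first gives 0 by
    degeneracy. *)
Lemma degenerate_kernel_orthogonal (s t u v : 'I_n) (psi : S -> R)
    (g : R -> R -> R) :
  s != t -> u != t -> v != t ->
  measurable_fun setT psi -> measurable_fun [set: R * R] (fun z => g z.1 z.2) ->
  P.-integrable setT (EFin \o (fun w =>
    centered_kernel nu k (phi (Z s w)) (phi (Z t w)) * g (psi (Z u w)) (psi (Z v w)))) ->
  \int[P]_w (centered_kernel nu k (phi (Z s w)) (phi (Z t w)) *
    g (psi (Z u w)) (psi (Z v w))) = 0.
Proof.
move=> st ut vt mpsi mg iF.
have mZ (r : 'I_n) d1 (V : measurableType d1) (f : S -> V) :
    measurable_fun setT f -> measurable_fun [set: T] (fun w => f (Z r w)).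
  by move=> mf; exact: measurableT_comp.
(* Everything but the observation [t]. The indices [s], [u], [v] may coincide, so only the joint law
   [rho] of the triple is used. *)
pose Y (w : T) : R * (R * R) := (phi (Z s w), (psi (Z u w), psi (Z v w))).
have mY : measurable_fun [set: T] Y.
  by do 2 (apply: measurable_fun_pair; first exact: mZ); exact: mZ.
have mYc : measurable_fun [set: g_sigma_algebraType (cylinders Z t)] Y.
  apply: measurable_fun_pair; first exact: cylinder_measurable.
  by apply: measurable_fun_pair; exact: cylinder_measurable.
pose Ym : {mfun T >-> (R * (R * R))%type} := HB.pack Y (isMeasurableFun.Build _ _ _ _ _ mY).
pose rho : probability (R * (R * R))%type R := distribution P Ym.
pose F (z : (R * (R * R)) * R) :=
  (centered_kernel nu k z.1.1 z.2 * g z.1.2.1 z.1.2.2)%:E.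
have m1 : measurable_fun setT (fun z : (R * (R * R)) * R => (z.1.1, z.2)).
  by apply: measurable_fun_pair => //; exact: measurableT_comp measurable_fst _.
have m2 : measurable_fun setT (fun z : (R * (R * R)) * R => (z.1.2.1, z.1.2.2)).
  have m12 : measurable_fun setT (fun z : (R * (R * R)) * R => z.1.2).
    exact: measurableT_comp measurable_snd _.
  apply: measurable_fun_pair; first exact: measurableT_comp measurable_fst m12.
  exact: measurableT_comp measurable_snd m12.
have mF : measurable_fun setT F.
  apply/measurable_EFinP; apply: measurable_funM.
    exact: measurableT_comp (measurable_centered_kernel mk ik) m1.
  exact: measurableT_comp mg m2.
have mYf : measurable_fun [set: T] (fun w => (Y w, phi (Z t w))).
  by apply: measurable_fun_pair => //; exact: mZ.
have law C : measurable C ->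
    P ((fun w : T => (Y w, phi (Z t w))) @^-1` C) = (rho \x nu)%E C.
  by apply: (cylinder_joint_law indep mYc mphi) => // B mB; exact: lphi.
have iF' : (rho \x nu)%E.-integrable setT F.
  exact: (proj1 (integrable_law mYf law mF) iF).
rewrite /Rintegral (integral_law mYf law mF iF) -(integral12_prod_meas1 iF').
suff -> : (\int[rho]_y fubini_F nu F y = \int[rho]_y (cst 0%E) y)%E.
  by rewrite integral0.
apply: ae_eq_integral => //; first exact: measurable_fubini_F iF'.
(* Degeneracy fails at most on a [nu]-null set of first coordinates; its preimage is [rho]-null
   since [nu] is the law of that coordinate. *)
have [N [mN N0 subN]] := centered_kernel_degenerate ik.
exists (fst @^-1` N); split.
- by rewrite -[X in measurable X]setTI; exact: measurable_fst.
- by have := lphi s mN; rewrite N0.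
move=> y /=; apply: contra_notP => ny _.
have [iy y0] : nu.-integrable setT (fun v => (centered_kernel nu k y.1 v)%:E) /\
    (\int[nu]_v (centered_kernel nu k y.1 v)%:E = 0)%E.
  by apply: contrapT => h; apply: ny; exact: subN.
rewrite /fubini_F /F /=; under eq_integral do rewrite EFinM.
by rewrite integralZr// y0 mul0e.
Qed.

End degenerate_kernel_orthogonality.

(** Fatou's lemma for convergence in distribution: the truncations [min (g, m)] are bounded and
    continuous, so their expectations pass to the limit, and monotone convergence removes [m]. *)
Lemma cvg_in_dist_le (R : realType) (V : topologicalType)
    (d : nat -> nat -> measure_display) (T : forall p q, measurableType (d p q))
    (P : forall p q, probability (T p q) R) (Z : forall p q, T p q -> V)
    (d' : measure_display) (T' : measurableType d') (Q : probability T' R)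
    (Zlim : T' -> V) (g : V -> R) (L : R) :
  cvg_in_dist P Z Q Zlim -> continuous g -> (forall z, 0 <= g z) ->
  (forall p q, measurable_fun setT (g \o Z p q)) ->
  measurable_fun setT (g \o Zlim) ->
  (forall e, 0 < e -> \forall pq \near filter_prod \oo \oo,
     (\int[P pq.1 pq.2]_w (g (Z pq.1 pq.2 w))%:E <= (L + e)%:E)%E) ->
  (\int[Q]_w (g (Zlim w))%:E <= L%:E)%E.
Proof.
move=> ZZ cg g0 mgZ mgl hL.
have mmin d0 (T0 : measurableType d0) (f : T0 -> R) m : measurable_fun setT f ->
    measurable_fun setT (fun w => (Num.min (f w) m%:R)%:E).
  by move=> mf; apply/measurable_EFinP; exact: measurable_minr.
have min0 z m : 0 <= Num.min (g z) m%:R by rewrite le_min g0 ler0n.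
have trunc m : (\int[Q]_w (Num.min (g (Zlim w)) m%:R)%:E <= L%:E)%E.
  apply/lee_addgt0Pr => e e0; rewrite -EFinD.
  have := ZZ (fun z => Num.min (g z) m%:R).
  have cmin : continuous (fun z => Num.min (g z) m%:R).
    move=> z; apply: (@continuous_min R V g (cst m%:R) z); first exact: cg.
    exact: cst_continuous.
  have bmin : bounded_fun (fun z => Num.min (g z) m%:R).
    exists m%:R; split; first exact: num_real.
    move=> M mM z _; rewrite /= ger0_norm//.
    by rewrite (le_trans _ (ltW mM))// ge_min lexx orbT.
  move=> /(_ cmin bmin); rewrite unlock => c.
  apply: cvge_to_le c _; near=> pq.
  apply: (@le_trans _ _ (\int[P pq.1 pq.2]_w (g (Z pq.1 pq.2 w))%:E)%E).
    apply: ge0_le_integral => //.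
    - by move=> w _; rewrite lee_fin.
    - exact: mmin (mgZ _ _).
    - by apply/measurable_EFinP; exact: mgZ.
    - by move=> w _; rewrite lee_fin ge_min lexx.
  near: pq; exact: hL.
have -> : (\int[Q]_w (g (Zlim w))%:E =
    limn (fun m => \int[Q]_w (Num.min (g (Zlim w)) m%:R)%:E))%E.
  rewrite -monotone_convergence//.
  - apply: eq_integral => w _; apply/esym/cvg_lim => //.
    apply: cvg_near_cst; exists (Num.bound (g (Zlim w))) => //= m /= bm.
    congr _%:E; apply/min_idPl; apply: ltW.
    apply: lt_le_trans (archi_boundP (g0 (Zlim w))) _; by rewrite ler_nat.
  - by move=> m; exact: mmin.
  - by move=> m w _; rewrite lee_fin.
  - move=> w _ m m' mm'; rewrite lee_fin le_min ge_min lexx /= ge_min.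
    by rewrite ler_nat mm' orbT.
apply: lime_le; last exact: nearW.
apply: ereal_nondecreasing_is_cvgn => m m' mm'; apply: ge0_le_integral => //.
- by move=> w _; rewrite lee_fin.
- exact: mmin.
- exact: mmin.
- move=> w _; rewrite lee_fin le_min ge_min lexx /= ge_min.
  by rewrite ler_nat mm' orbT.
Unshelve. all: by end_near.
Qed.

(** * Double-centered kernels of the sample *)

Section double_centering.
Context d (T : measurableType d) (R : realType) (P : probability T R).

Lemma double_centeredC (k : R -> R -> R) (x y : T -> R) :
  (forall u v, k u v = k v u) -> double_centered P k x y = double_centered P k y x.
Proof.
move=> ks; apply/funext => w; rewrite /double_centered /=.
have -> : (fun w' => k (y w') (x w')) = (fun w' => k (x w') (y w')).
  by apply/funext => w'; exact: ks.
by rewrite [k (y w) _]ks; congr (_ + _); rewrite addrAC.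
Qed.

Context d' (S : measurableType d') (n : nat) (Z : 'I_n -> {RV P >-> S}).
Hypothesis indep : mutually_independent Z.
Context (mu : probability S R).
Hypothesis lZ : forall s A, measurable A -> distribution P (Z s) A = mu A.

Section one_kernel.
Context (k : R -> R -> R) (phi : S -> R).
Hypothesis k_sym : forall u v, k u v = k v u.
Hypothesis mk : measurable_fun [set: R * R] (fun z => k z.1 z.2).
Hypothesis mphi : measurable_fun setT phi.
Hypothesis k_int : forall s t : 'I_n, s != t ->
  P.-integrable setT (fun w => (k (phi (Z s w)) (phi (Z t w)))%:E).

Let phim : {mfun S >-> R} := HB.pack phi (isMeasurableFun.Build _ _ _ _ _ mphi).
Let nu : probability R R := distribution mu phim.

Let mphiZ s : measurable_fun setT (fun w => phi (Z s w)).
Proof. exact: measurableT_comp. Qed.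

Let lphi s B : measurable B -> P ((fun w => phi (Z s w)) @^-1` B) = nu B.
Proof.
move=> mB; rewrite -[RHS]/(mu (phi @^-1` B)) -(lZ s)//.
by rewrite -[X in measurable X]setTI; exact: mphi.
Qed.

Let joint (s t : 'I_n) : s != t -> forall C, measurable C ->
  P ((fun w => (phi (Z s w), phi (Z t w))) @^-1` C) = (nu \x nu)%E C.
Proof.
move=> st; apply: (cylinder_joint_law indep (Y := fun w => phi (Z s w))) => //.
- exact: cylinder_measurable.
- by move=> B mB; exact: (lphi s mB).
- by move=> B mB; exact: (lphi t mB).
Qed.

Let mkE : measurable_fun setT (fun z : R * R => (k z.1 z.2)%:E).
Proof. exact/measurable_EFinP. Qed.

Let ik (s t : 'I_n) : s != t -> (nu \x nu)%E.-integrable setT (fun z => (k z.1 z.2)%:E).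
Proof.
move=> st; apply: (proj1 (integrable_law _ (joint st) mkE)); last exact: k_int.
exact: measurable_fun_pair.
Qed.

Let D s t := double_centered P k (fun w => phi (Z s w)) (fun w => phi (Z t w)).

(** Conditional expectations preserve the mean [m], so the four terms integrate to
    [m - m - m + m]. *)
Lemma double_centered_mean0 (s t : 'I_n) : s != t ->
  P.-integrable setT (EFin \o D s t) /\ \int[P]_w D s t w = 0.
Proof.
move=> st.
have cx := condexp_kernel mk (ik st) (mphiZ s) (mphiZ t) (joint st).
(* The chosen version has its defining property because a version exists, namely [kernel_proj] of
   the variable. *)
have [iWx _ ex] := xgetI (cst 0) cx : is_condexp P _ _ (condexp P _ _).
have ts : t != s by rewrite eq_sym.
have := condexp_kernel mk (ik ts) (mphiZ t) (mphiZ s) (joint ts).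
rewrite (_ : (fun w => k (phi (Z t w)) (phi (Z s w))) =
             (fun w => k (phi (Z s w)) (phi (Z t w)))); last first.
  by apply/funext => w; exact: k_sym.
move=> cy; have [iWy _ ey] := xgetI (cst 0) cy : is_condexp P _ _ (condexp P _ _).
have sT (f : T -> R) : g_sigma_algebra_preimage f setT.
  by exists setT; rewrite ?preimage_setT ?setTI.
have {}ex := ex setT (sT _); have {}ey := ey setT (sT _).
set kxy := fun w => k _ _ in ex ey iWx iWy cx cy.
set m := fine 'E_P[kxy]%E.
have mE : m = \int[P]_w kxy w by rewrite /m unlock.
have i1 : P.-integrable setT (EFin \o kxy) by exact: k_int.
have iC : P.-integrable setT (EFin \o cst m) by exact: finite_measure_integrable_cst.
have i2 := integrable_add (integrable_add i1 (integrable_scale (-1) iWx))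
  (integrable_add (integrable_scale (-1) iWy) iC).
set Wx := condexp P kxy (fun w => phi (Z s w)) in ex iWx i2.
set Wy := condexp P kxy (fun w => phi (Z t w)) in ey iWy i2.
have E : D s t = (fun w => (kxy w + -1 * Wx w) + (-1 * Wy w + m)).
  by apply/funext => w; rewrite -[D s t w]/(kxy w - Wx w - Wy w + m); ring.
rewrite E; split; first exact: i2.
have iWx' := integrable_scale (-1) iWx; have iWy' := integrable_scale (-1) iWy.
rewrite RintegralD//; [|exact: integrable_add|exact: integrable_add].
rewrite RintegralD// RintegralD// !RintegralZl// Rintegral_prob_cst -mE.
have -> : \int[P]_w Wx w = m by rewrite /Rintegral ex mE.
have -> : \int[P]_w Wy w = m by rewrite /Rintegral ey mE.
ring.
Qed.

(** One of [s], [t] is absent from [u], [v]; by symmetry of the kernel it may be taken to be [t].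
    The other factor is known only up to a null set, whence the almost sure hypothesis on [E]. *)
Lemma double_centered_orthogonal (s t u v : 'I_n) (E : T -> R) (psi : S -> R)
    (g : R -> R -> R) :
  s != t -> ~~ [&& (s \in [:: u; v]) & (t \in [:: u; v])] ->
  measurable_fun setT psi -> measurable_fun [set: R * R] (fun z => g z.1 z.2) ->
  measurable_fun setT E ->
  ae_eq P setT E (fun w => g (psi (Z u w)) (psi (Z v w))) ->
  P.-integrable setT (EFin \o (fun w => D s t w * E w)) ->
  \int[P]_w (D s t w * E w) = 0.
Proof.
wlog tuv : s t / t \notin [:: u; v].
  move=> H st suv; have := suv; rewrite negb_and => /orP[|] h; last exact: H.
  have Dst : D s t = D t s by exact: double_centeredC.
  by rewrite Dst; apply: H => //; rewrite 1?eq_sym// negb_and h ?orbT.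
move=> st _ mpsi mg mE Eg iDE.
have ts : t != s by rewrite eq_sym.
have lts := joint ts; have lst := joint st.
have Dae := double_centered_ae mk (ik st) k_sym (mphiZ s) (mphiZ t) lst lts.
have mC := measurable_centered_kernel mk (ik st).
pose F w := centered_kernel nu k (phi (Z s w)) (phi (Z t w)) *
  g (psi (Z u w)) (psi (Z v w)).
have mF : measurable_fun setT F.
  apply: measurable_funM.
    exact: measurableT_comp mC (measurable_fun_pair (mphiZ s) (mphiZ t)).
  have mpsiZ r : measurable_fun setT (fun w => psi (Z r w)) by exact: measurableT_comp.
  exact: measurableT_comp mg (measurable_fun_pair (mpsiZ u) (mpsiZ v)).
have DEF : ae_eq P setT (EFin \o (fun w => D s t w * E w)) (EFin \o F).
  apply: filterS2 Dae Eg => w /(_ I) h1 /(_ I) h2 _ /=.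
  by rewrite /F -h1 -h2.
have /integrableP[mDE _] := iDE.
have mFE : measurable_fun setT (EFin \o F) by exact/measurable_EFinP.
have iF : P.-integrable setT (EFin \o F).
  apply/integrableP; split => //; have /integrableP[_] := iDE.
  rewrite (_ : (\int[P]_x `|_ x| = \int[P]_w `|(EFin \o F) w|)%E)//.
  apply: ae_eq_integral => //; [exact: measurableT_comp|exact: measurableT_comp|].
  by apply: filterS DEF => w /(_ I) -> _.
transitivity (\int[P]_w F w).
  by congr fine; apply: ae_eq_integral.
have [ut vt] : u != t /\ v != t.
  by move: tuv; rewrite !inE negb_or !(eq_sym t) => /andP.
exact: (degenerate_kernel_orthogonal indep mk (ik st) mphi lphi st ut vt mpsi mg iF).
Qed.

(** Hides the law of the coordinate, so that two kernels whose coordinates have different laws can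
    meet in one covariance. *)
Lemma double_centered_version (s t : 'I_n) : s != t ->
  exists2 g : R -> R -> R, measurable_fun [set: R * R] (fun z => g z.1 z.2) &
    ae_eq P setT (D s t) (fun w => g (phi (Z s w)) (phi (Z t w))).
Proof.
move=> st; have ts : t != s by rewrite eq_sym.
exists (centered_kernel nu k); first exact: measurable_centered_kernel mk (ik st).
have lts := joint ts; have lst := joint st.
exact: (double_centered_ae mk (ik st) k_sym (mphiZ s) (mphiZ t) lst lts).
Qed.

End one_kernel.
End double_centering.

(** * Covariance of the limit *)

Lemma integrable_mul_sqr d (T : measurableType d) (R : realType)
    (P : {measure set T -> \bar R}) (X Y : T -> R) :
  measurable_fun setT X -> measurable_fun setT Y ->
  P.-integrable setT (EFin \o (fun w => X w ^+ 2)) ->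
  P.-integrable setT (EFin \o (fun w => Y w ^+ 2)) ->
  P.-integrable setT (EFin \o (fun w => X w * Y w)).
Proof.
move=> mX mY iX iY; have iXY := integrable_add iX iY.
apply: le_integrable iXY => //.
  by apply/measurable_EFinP; exact: measurable_funM.
move=> w _ /=; rewrite lee_fin; apply: le_trans (ler_norm _).
have h1 := sqr_ge0 (X w - Y w); have h2 := sqr_ge0 (X w + Y w).
by rewrite ler_norml; apply/andP; split; nra.
Qed.

Lemma linear_form_sqr d (T : measurableType d) (R : realType)
    (P : {measure set T -> \bar R}) m (Z : T -> 'cV[R]_m) (a : 'cV[R]_m) :
  (forall k, measurable_fun setT (fun w => Z w k 0)) ->
  (forall k, P.-integrable setT (EFin \o (fun w => Z w k 0 ^+ 2))) ->
  P.-integrable setT (EFin \o (fun w => (a^T *m Z w) 0 0 ^+ 2)) /\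
  \int[P]_w ((a^T *m Z w) 0 0 ^+ 2) =
  \sum_k \sum_l a k 0 * a l 0 * \int[P]_w (Z w k 0 * Z w l 0).
Proof.
move=> mZ iZ.
have iZZ k l : P.-integrable setT (EFin \o (fun w => Z w k 0 * Z w l 0)).
  exact: integrable_mul_sqr.
have E : (fun w => (a^T *m Z w) 0 0 ^+ 2) =
    (fun w => \sum_k \sum_l a k 0 * a l 0 * (Z w k 0 * Z w l 0)).
  apply/funext => w; rewrite mxE expr2 big_distrlr /=.
  by apply: eq_bigr => k _; apply: eq_bigr => l _; rewrite !mxE mulrACA.
rewrite E.
have iaZZ k l := integrable_scale (a k 0 * a l 0) (iZZ k l).
have s1 k := Rintegral_sum (index_enum 'I_m) (iaZZ k).
have [i2 e2] := Rintegral_sum (index_enum 'I_m) (fun k => (s1 k).1).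
split; first exact: i2.
rewrite [LHS]e2; apply: eq_bigr => k _; rewrite [LHS](s1 k).2.
by apply: eq_bigr => l _; rewrite RintegralZl.
Qed.

Lemma cvg_finite_sum (R : realType) (T : Type) (F : set_system T) (FF : Filter F)
    (I : Type) (r : seq I) (f : I -> T -> R) (l : I -> R) :
  (forall i, f i x @[x --> F] --> l i) ->
  (\sum_(i <- r) f i x) @[x --> F] --> \sum_(i <- r) l i.
Proof.
move=> fl; elim: r => [|i r IH].
  under eq_fun do rewrite big_nil; rewrite big_nil; exact: cvg_cst.
by under eq_fun do rewrite big_cons; rewrite big_cons; exact: cvgD.
Qed.

Lemma quadratic_formE (R : realType) m (S : 'M[R]_m) (a : 'cV[R]_m) :
  (a^T *m S *m a) 0 0 = \sum_k \sum_l a k 0 * a l 0 * S k l.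
Proof.
rewrite mxE exchange_big /=; apply: eq_bigr => l _.
by rewrite mxE mulr_suml; apply: eq_bigr => k _; rewrite !mxE mulrAC.
Qed.

Lemma quadratic_form_delta (R : realType) m (S : 'M[R]_m) (k l : 'I_m) :
  ((delta_mx k 0 : 'cV[R]_m)^T *m S *m (delta_mx l 0 : 'cV[R]_m)) 0 0 = S k l.
Proof. by rewrite trmx_delta -rowE -colE !mxE. Qed.

(** At [delta_k + delta_l] and [delta_k - delta_l] the form equals [2 S k l] and [- 2 S k l], both
    of which are nonnegative. *)
Lemma psd_diag0 (R : realType) m (S : 'M[R]_m) :
  S^T = S -> (forall a : 'cV[R]_m, 0 <= (a^T *m S *m a) 0 0) ->
  (forall k, S k k = 0) -> S = 0.
Proof.
move=> St S0 Sd; apply/matrixP => k l.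
have Slk : S l k = S k l by rewrite -{1}St mxE.
have expand (e : R) : ((delta_mx k 0 + e *: delta_mx l 0 : 'cV[R]_m)^T *m S *m
    (delta_mx k 0 + e *: delta_mx l 0 : 'cV[R]_m)) 0 0 =
    S k k + e * S k l + (e * S l k + e * e * S l l).
  have -> : (delta_mx k 0 + e *: delta_mx l 0 : 'cV[R]_m)^T =
      (delta_mx k 0 : 'cV[R]_m)^T + e *: (delta_mx l 0 : 'cV[R]_m)^T.
    by apply/matrixP => i j; rewrite !mxE.
  rewrite !mulmxDl !mulmxDr -!scalemxAl -!scalemxAr.
  rewrite [LHS]mxE; congr (_ + _); rewrite [LHS]mxE [X in _ + X = _]mxE.
    by congr (_ + _ * _); exact: quadratic_form_delta.
  rewrite [X in X + _ = _]mxE [X in _ + _ * X = _]mxE mulrA.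
  by congr (_ * _ + _ * _); exact: quadratic_form_delta.
have := S0 (delta_mx k 0 + 1 *: delta_mx l 0).
have := S0 (delta_mx k 0 + (-1) *: delta_mx l 0).
by rewrite !expand !Sd Slk mxE => h1 h2; lra.
Qed.

Lemma continuous_linear_form_sqr (R : realType) m (a : 'cV[R]_m) :
  continuous (fun z : 'cV[R]_m => (a^T *m z) 0 0 ^+ 2).
Proof.
have -> : (fun z : 'cV[R]_m => (a^T *m z) 0 0 ^+ 2) =
    (fun z : 'cV[R]_m => (\sum_k a k 0 * z k 0) ^+ 2).
  by apply/funext => z; rewrite mxE; congr (_ ^+ 2); apply: eq_bigr => k _; rewrite mxE.
move=> z; apply: (@continuous_comp _ _ _ (fun z : 'cV[R]_m => \sum_k a k 0 * z k 0)
  (fun x : R => x ^+ 2)); last exact: exprn_continuous.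
have zF : Filter (nbhs (z : 'cV[R]_m)) by exact: nbhs_filter.
apply: (@cvg_finite_sum R 'cV[R]_m (nbhs z) zF 'I_m _
  (fun k (z : 'cV[R]_m) => a k 0 * z k 0)) => k.
apply: cvgM; first exact: cvg_cst.
exact: coord_continuous.
Qed.

Section limit_covariance.
Context (R : realType) (m : nat).
Context (d : nat -> nat -> measure_display) (T : forall p q, measurableType (d p q)).
Context (P : forall p q, probability (T p q) R) (Z : forall p q, T p q -> 'cV[R]_m).
Context (d' : measure_display) (T' : measurableType d') (Q : probability T' R).
Context (Zlim : T' -> 'cV[R]_m) (Sigma : 'M[R]_m).
Arguments Z : clear implicits.
Hypothesis Zcvg : cvg_in_dist P Z Q Zlim.
Hypothesis mZ : forall p q k, measurable_fun setT (fun w => Z p q w k 0).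
Hypothesis mZlim : forall k, measurable_fun setT (fun w => Zlim w k 0).
Hypothesis iZ : \forall pq \near filter_prod \oo \oo, forall k,
  (P pq.1 pq.2).-integrable setT (EFin \o (fun w => Z pq.1 pq.2 w k 0 ^+ 2)).
Hypothesis cZ : forall k l, \int[P pq.1 pq.2]_w (Z pq.1 pq.2 w k 0 * Z pq.1 pq.2 w l 0)
  @[pq --> filter_prod \oo \oo] --> Sigma k l.
Hypothesis varZ : forall k, ('V_Q[fun w => (Zlim w k 0)%R])%E = (Sigma k k)%:E.

Let form (a : 'cV[R]_m) := (a^T *m Sigma *m a) 0 0.

Let le_form (a : 'cV[R]_m) :
  (\int[Q]_w ((a^T *m Zlim w) 0 0 ^+ 2)%:E <= (form a)%:E)%E.
Proof.
have mform d0 (T0 : measurableType d0) (Y : T0 -> 'cV[R]_m) :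
    (forall k, measurable_fun setT (fun w => Y w k 0)) ->
    measurable_fun setT (fun w => (a^T *m Y w) 0 0 ^+ 2).
  move=> mY; apply: measurable_funX.
  under eq_fun do rewrite mxE; apply: measurable_sum => k.
  by apply: measurable_funM.
apply: (cvg_in_dist_le Zcvg (@continuous_linear_form_sqr R m a)).
- by move=> z; exact: sqr_ge0.
- by move=> p q; exact: mform.
- exact: mform.
move=> e e0.
have c : (\sum_k \sum_l a k 0 * a l 0 *
    \int[P pq.1 pq.2]_w (Z pq.1 pq.2 w k 0 * Z pq.1 pq.2 w l 0))
    @[pq --> filter_prod \oo \oo] --> form a.
  rewrite /form quadratic_formE.
  apply: cvg_finite_sum => k; apply: cvg_finite_sum => l.
  by apply: cvgM; [exact: cvg_cst|exact: cZ].
have /cvgrPdist_le/(_ e e0) c' := c.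
near=> pq.
have i2 : forall k, (P pq.1 pq.2).-integrable setT
    (EFin \o (fun w => Z pq.1 pq.2 w k 0 ^+ 2)) by near: pq.
have [i3 e3] := linear_form_sqr a (@mZ pq.1 pq.2) i2.
have := fineK (integrable_fin_num measurableT i3) => /= <-.
rewrite lee_fin -[X in X <= _]/(\int[P pq.1 pq.2]_w _) [X in X <= _]e3 -lerBlDl.
apply: le_trans (ler_norm _) _; rewrite distrC.
by near: pq.
Unshelve. all: by end_near.
Qed.

Let fE (k : 'I_m) : form (delta_mx k 0) = Sigma k k.
Proof. exact: quadratic_form_delta. Qed.

Let coordE (k : 'I_m) w : ((delta_mx k 0 : 'cV[R]_m)^T *m Zlim w) 0 0 = Zlim w k 0.
Proof.
rewrite mxE (bigD1 k)//= !mxE !eqxx mul1r big1 ?addr0// => l /negbTE lk.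
by rewrite !mxE lk mul0r.
Qed.

Let le_sqr k : (\int[Q]_w (Zlim w k 0 ^+ 2)%:E <= (Sigma k k)%:E)%E.
Proof.
rewrite -fE (_ : (\int[Q]_w _ =
  \int[Q]_w (((delta_mx k 0 : 'cV[R]_m)^T *m Zlim w) 0 0 ^+ 2)%:E)%E)//.
by apply: eq_integral => w _; rewrite coordE.
Qed.

Lemma limit_sqr_integrable k : Q.-integrable setT (EFin \o (fun w => Zlim w k 0 ^+ 2)).
Proof.
apply/integrableP; split.
  by apply/measurable_EFinP; exact: measurable_funX.
under eq_integral do rewrite /= ger0_norm ?sqr_ge0//.
exact: le_lt_trans (le_sqr k) (ltry _).
Qed.

Lemma limit_integrable k : Q.-integrable setT (EFin \o (fun w => Zlim w k 0)).
Proof.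
have i1 : Q.-integrable setT (EFin \o (fun=> 1 ^+ 2 : R)).
  exact: finite_measure_integrable_cst.
have := integrable_mul_sqr (mZlim k) (@measurable_cst _ _ _ _ setT (1 : R))
  (limit_sqr_integrable k) i1.
by under [X in Q.-integrable _ (EFin \o X)]eq_fun do rewrite mulr1.
Qed.

Lemma limit_mean_var k : \int[Q]_w Zlim w k 0 = 0 /\
  \int[Q]_w (Zlim w k 0 ^+ 2) = Sigma k k.
Proof.
have i2 := limit_sqr_integrable k; have i1 := limit_integrable k.
have le2 : \int[Q]_w (Zlim w k 0 ^+ 2) <= Sigma k k.
  have := fineK (integrable_fin_num measurableT i2) => /= E2.
  by rewrite -lee_fin E2.
have := varZ k; rewrite /variance unlock !unlock /=.
set M := fine _.
have ME : M = \int[Q]_w Zlim w k 0 by [].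
move=> V.
have {}V : (\int[Q]_w (Zlim w k 0 ^+ 2 + (- (2 * M) * Zlim w k 0 + M ^+ 2))%:E =
    (Sigma k k)%:E)%E.
  rewrite -V; apply: eq_integral => w _; congr _%:E.
  by rewrite -[RHS]/((Zlim w k 0 - M) * (Zlim w k 0 - M)); ring.
have {}V : \int[Q]_w (Zlim w k 0 ^+ 2) - M ^+ 2 = Sigma k k.
  have iC : Q.-integrable setT (EFin \o (fun=> M ^+ 2)).
    exact: finite_measure_integrable_cst.
  have iL := integrable_scale (- (2 * M)) i1.
  have E : \int[Q]_w (Zlim w k 0 ^+ 2 + (- (2 * M) * Zlim w k 0 + M ^+ 2)) = Sigma k k.
    by rewrite /Rintegral V.
  rewrite -E RintegralD//; last exact: integrable_add.
  rewrite RintegralD// RintegralZl// Rintegral_prob_cst -ME; ring.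
(* The second moment exceeds [Sigma k k] by [M ^+ 2], yet is bounded by it. *)
have M0 : M = 0.
  by apply/eqP; rewrite -sqrf_eq0 eq_le sqr_ge0 andbT; lra.
by rewrite -ME; split => //; rewrite -V M0 expr0n subr0.
Qed.

Hypothesis Sigma_sym : Sigma^T = Sigma.

Lemma limit_linear_form (a : 'cV[R]_m) :
  \int[Q]_w (a^T *m Zlim w) 0 0 = 0 /\
  \int[Q]_w ((a^T *m Zlim w) 0 0 ^+ 2) = (a^T *m Sigma *m a) 0 0.
Proof.
have [i2 _] := linear_form_sqr a mZlim limit_sqr_integrable.
split.
  under eq_Rintegral do rewrite mxE.
  have [_ e1] := Rintegral_sum (index_enum 'I_m)
    (fun k => integrable_scale (a^T 0 k) (limit_integrable k)).
  rewrite [LHS]e1 big1// => k _; rewrite RintegralZl//; last exact: limit_integrable.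
  by rewrite (limit_mean_var k).1 mulr0.
pose C : 'M[R]_m := \matrix_(k, l) \int[Q]_w (Zlim w k 0 * Zlim w l 0).
have CE (b : 'cV[R]_m) : \int[Q]_w ((b^T *m Zlim w) 0 0 ^+ 2) = (b^T *m C *m b) 0 0.
  have [_ ->] := linear_form_sqr b mZlim limit_sqr_integrable.
  rewrite quadratic_formE; apply: eq_bigr => k _; apply: eq_bigr => l _.
  by rewrite mxE.
suff -> : Sigma = C by rewrite CE.
apply/eqP; rewrite -subr_eq0; apply/eqP; apply: psd_diag0.
- rewrite linearB /= Sigma_sym; congr (_ - _); apply/matrixP => k l; rewrite !mxE.
  by apply: eq_Rintegral => w _; rewrite mulrC.
- move=> b; rewrite mulmxBr mulmxBl [X in _ <= X]mxE [X in _ <= _ + X]mxE -CE subr_ge0.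
  have [j2 _] := linear_form_sqr b mZlim limit_sqr_integrable.
  rewrite -lee_fin (fineK (integrable_fin_num measurableT j2)).
  exact: le_form.
- move=> k; rewrite !mxE; have [_ <-] := limit_mean_var k.
  by rewrite subrr.
Qed.

Hypothesis gaussian : jointly_gaussian Q Zlim.

(** Joint Gaussianity leaves the two parameters of each linear form open; its first two moments,
    already computed, determine them. *)
Lemma limit_multinormal : multinormal Q Zlim 0 Sigma.
Proof.
move=> a; have [e1 e2] := limit_linear_form a.
have [i2 _] := linear_form_sqr a mZlim limit_sqr_integrable.
have mY : measurable_fun setT (fun w => (a^T *m Zlim w) 0 0).
  under eq_fun do rewrite mxE; apply: measurable_sum => k.
  by apply: measurable_funM.
have i1 : Q.-integrable setT (EFin \o (fun w => (a^T *m Zlim w) 0 0)).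
  have iC : Q.-integrable setT (EFin \o (fun=> 1 ^+ 2 : R)).
    exact: finite_measure_integrable_cst.
  have := integrable_mul_sqr mY (@measurable_cst _ _ _ _ setT (1 : R)) i2 iC.
  by under [X in Q.-integrable _ (EFin \o X)]eq_fun do rewrite mulr1.
rewrite -e2; split.
  by apply: Rintegral_ge0 => // w _; exact: sqr_ge0.
rewrite mulmx0 [X in normal_law X]mxE.
have [mu [s [s0 law]]] := gaussian a.
suff [mu0 sE] : mu = 0 /\ s = \int[Q]_w (a^T *m Zlim w) 0 0 ^+ 2.
  by move=> B mB; rewrite -sE -mu0; exact: law.
move: law; rewrite /normal_law; have [->|s_neq0] := eqVneq s 0 => law.
  (* At variance 0 the law is a point mass, and moments are values at [mu]. *)
  have lawI (g : R -> R) : measurable_fun setT g ->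
      Q.-integrable setT (EFin \o (fun w => g ((a^T *m Zlim w) 0 0))) ->
      \int[Q]_w g ((a^T *m Zlim w) 0 0) = g mu.
    move=> mg ig; have mgE : measurable_fun setT (EFin \o g) by exact/measurable_EFinP.
    rewrite /Rintegral (integral_law mY law mgE ig) integral_dirac//.
    by rewrite diracT mul1e.
  have mu0 : mu = 0 by rewrite -[LHS](lawI id)// e1.
  split; first exact: mu0.
  rewrite (lawI (fun x => x ^+ 2)); [by rewrite mu0 expr0n| |exact: i2].
  by apply: measurable_funX; exact: measurable_id.
have sp : 0 < Num.sqrt s by rewrite sqrtr_gt0 lt_neqAle eq_sym s_neq0.
have muE := normal_mean mY sp law i1.
have sE := normal_variance mY sp law i1 i2.
have mu0 : mu = 0 by rewrite -[LHS]muE e1.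
split; first exact: mu0.
rewrite -[LHS]sqr_sqrtr// -sE; apply: eq_Rintegral => w _.
by rewrite mu0 subr0.
Qed.

End limit_covariance.

Section mean0.
Context d (T : measurableType d) (R : realType) (P : probability T R).
Implicit Types U V : T -> R.

Lemma covariance_mean0 U V : \int[P]_w U w = 0 -> \int[P]_w V w = 0 ->
  (covariance P U V = \int[P]_w (U w * V w)%:E)%E.
Proof.
move=> U0 V0; rewrite unlock !unlock.
have hU : fine (\int[P]_w (U w)%:E)%E = 0 by [].
have hV : fine (\int[P]_w (V w)%:E)%E = 0 by [].
rewrite hU hV; apply: eq_integral => w _; congr _%:E.
by rewrite -[LHS]/((U w - 0) * (V w - 0)) !subr0.
Qed.

(** A finite sum of extended reals has finite terms, and the diagonal terms are the second moments.
    The factor [c] must be positive, as 0 times infinity is 0. *)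
Lemma sum_covariance_sqr_integrable p (U : 'I_p -> T -> R) (c : R) :
  0 < c -> (forall i, P.-integrable setT (EFin \o U i)) ->
  (forall i, \int[P]_w U i w = 0) ->
  (c%:E * \sum_(i < p) \sum_(j < p) covariance P (U i) (U j))%E \is a fin_num ->
  forall i, P.-integrable setT (EFin \o (fun w => U i w ^+ 2)).
Proof.
move=> c0 iU U0 fS i.
have {}fS : (\sum_(i < p) \sum_(j < p) covariance P (U i) (U j))%E \is a fin_num.
  case: (\sum_(i < p) _)%E fS => //=.
  - by rewrite gt0_muley ?lte_fin.
  - by rewrite gt0_muleNy ?lte_fin.
have /sum_fin_numP/(_ i (mem_index_enum _) isT) := fS.
move=> /sum_fin_numP/(_ i (mem_index_enum _) isT).
rewrite covariance_mean0// => f2.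
have /integrableP[/measurable_EFinP mU _] := iU i.
apply/integrableP; split.
  by apply/measurable_EFinP; exact: measurable_funX.
under eq_integral do rewrite /= ger0_norm ?sqr_ge0// expr2.
by rewrite ltey_eq f2.
Qed.

Lemma cross_moment p q (U : 'I_p -> T -> R) (V : 'I_q -> T -> R) (c c' : R) :
  (forall i, measurable_fun setT (U i)) -> (forall j, measurable_fun setT (V j)) ->
  (forall i, \int[P]_w U i w = 0) -> (forall j, \int[P]_w V j w = 0) ->
  (forall i, P.-integrable setT (EFin \o (fun w => U i w ^+ 2))) ->
  (forall j, P.-integrable setT (EFin \o (fun w => V j w ^+ 2))) ->
  P.-integrable setT (EFin \o (fun w => c * (\sum_i U i w) * (c' * (\sum_j V j w)))) /\
  ((\int[P]_w (c * (\sum_i U i w) * (c' * (\sum_j V j w))))%:E =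
   (c * c')%:E * \sum_(i < p) \sum_(j < q) covariance P (U i) (V j))%E.
Proof.
move=> mU mV U0 V0 iU iV.
have iUV i j := integrable_mul_sqr (mU i) (mV j) (iU i) (iV j).
have E : (fun w => c * (\sum_i U i w) * (c' * (\sum_j V j w))) =
    (fun w => c * c' * \sum_i \sum_j (U i w * V j w)).
  by apply/funext => w; rewrite mulrACA big_distrlr.
rewrite E.
have s1 i := Rintegral_sum (index_enum 'I_q) (iUV i).
have [i2 e2] := Rintegral_sum (index_enum 'I_p) (fun i => (s1 i).1).
split; first exact: integrable_scale.
rewrite RintegralZl// EFinM; congr (_ * _)%E; rewrite [X in X%:E]e2 -sumEFin.
apply: eq_bigr => i _; rewrite [X in X%:E](s1 i).2 -sumEFin; apply: eq_bigr => j _.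
by rewrite covariance_mean0// fineK//; exact: integrable_fin_num (iUV i j).
Qed.

End mean0.

(** The real integral equals the extended covariance sum as soon as the squares are integrable,
    which is an eventual property; hence the near-equality. *)
Lemma cross_moment_cvg (R : realType)
    (d : nat -> nat -> measure_display) (T : forall p q, measurableType (d p q))
    (P : forall p q, probability (T p q) R) (a b : nat -> nat -> nat)
    (U : forall p q, 'I_(a p q) -> T p q -> R)
    (V : forall p q, 'I_(b p q) -> T p q -> R) (c c' : nat -> nat -> R) (L : R) :
  (forall p q i, measurable_fun setT (U p q i)) ->
  (forall p q j, measurable_fun setT (V p q j)) ->
  (forall p q i, \int[P p q]_w U p q i w = 0) ->
  (forall p q j, \int[P p q]_w V p q j w = 0) ->
  (\forall pq \near filter_prod \oo \oo, forall i, (P pq.1 pq.2).-integrable setT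
     (EFin \o (fun w => U pq.1 pq.2 i w ^+ 2))) ->
  (\forall pq \near filter_prod \oo \oo, forall j, (P pq.1 pq.2).-integrable setT
     (EFin \o (fun w => V pq.1 pq.2 j w ^+ 2))) ->
  ((c pq.1 pq.2 * c' pq.1 pq.2)%:E * \sum_i \sum_j
     covariance (P pq.1 pq.2) (U pq.1 pq.2 i) (V pq.1 pq.2 j))%E
     @[pq --> filter_prod \oo \oo] --> L%:E ->
  \int[P pq.1 pq.2]_w (c pq.1 pq.2 * (\sum_i U pq.1 pq.2 i w) *
                      (c' pq.1 pq.2 * (\sum_j V pq.1 pq.2 j w)))
    @[pq --> filter_prod \oo \oo] --> L.
Proof.
move=> mU mV U0 V0 iU iV /fine_cvg; apply: cvg_trans; apply: near_eq_cvg.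
near=> pq.
have iU' : forall i, (P pq.1 pq.2).-integrable setT
     (EFin \o (fun w => U pq.1 pq.2 i w ^+ 2)) by near: pq.
have iV' : forall i, (P pq.1 pq.2).-integrable setT
     (EFin \o (fun w => V pq.1 pq.2 i w ^+ 2)) by near: pq.
rewrite /=.
have [_ <-] := cross_moment (c pq.1 pq.2) (c' pq.1 pq.2) (@mU pq.1 pq.2)
  (@mV pq.1 pq.2) (@U0 pq.1 pq.2) (@V0 pq.1 pq.2) iU' iV'.
by [].
Unshelve. all: by end_near.
Qed.

Lemma double_centered_uncorrelated d (T : measurableType d) (R : realType)
    (P : probability T R) d' (S : measurableType d') (n : nat)
    (Z : 'I_n -> {RV P >-> S}) (mu : probability S R) (k l : R -> R -> R)
    (phi psi : S -> R) (s t u v : 'I_n) :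
  let D s t := double_centered P k (fun w => phi (Z s w)) (fun w => phi (Z t w)) in
  let E u v := double_centered P l (fun w => psi (Z u w)) (fun w => psi (Z v w)) in
  mutually_independent Z ->
  (forall s A, measurable A -> distribution P (Z s) A = mu A) ->
  (forall x y, k x y = k y x) -> (forall x y, l x y = l y x) ->
  measurable_fun [set: R * R] (fun z => k z.1 z.2) ->
  measurable_fun [set: R * R] (fun z => l z.1 z.2) ->
  measurable_fun setT phi -> measurable_fun setT psi ->
  (forall s t : 'I_n, s != t ->
    P.-integrable setT (fun w => (k (phi (Z s w)) (phi (Z t w)))%:E)) ->
  (forall s t : 'I_n, s != t ->
    P.-integrable setT (fun w => (l (psi (Z s w)) (psi (Z t w)))%:E)) ->
  s != t -> u != v -> ~~ [&& s \in [:: u; v] & t \in [:: u; v]] ->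
  P.-integrable setT (EFin \o (fun w => D s t w ^+ 2)) ->
  P.-integrable setT (EFin \o (fun w => E u v w ^+ 2)) ->
  covariance P (D s t) (E u v) = 0.
Proof.
move=> D E indep lZ ks ls mk ml mphi mpsi ik il st uv h iD iE.
have [iD1 D0] := double_centered_mean0 indep lZ ks mk mphi ik st.
have [iE1 E0] := double_centered_mean0 indep lZ ls ml mpsi il uv.
have /integrableP[/measurable_EFinP mD _] := iD1.
have /integrableP[/measurable_EFinP mE _] := iE1.
have [g mg gE] := double_centered_version indep lZ ls ml mpsi il uv.
have iDE := integrable_mul_sqr mD mE iD iE.
rewrite covariance_mean0//.
have := double_centered_orthogonal indep lZ ks mk mphi ik st h mpsi mg mE gE iDE.
move=> I0; rewrite -[LHS]fineK; last exact: integrable_fin_num iDE.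
by rewrite [X in X%:E]I0.
Qed.

(** * From the scaled pair sums to uCov and its limit laws *)

Lemma cvg_in_dist_comp (R : realType) (V W : topologicalType)
    (d : nat -> nat -> measure_display) (T : forall p q, measurableType (d p q))
    (P : forall p q, probability (T p q) R) (Z : forall p q, T p q -> V)
    (d' : measure_display) (T' : measurableType d') (Q : probability T' R)
    (Zlim : T' -> V) (h : V -> W) :
  cvg_in_dist P Z Q Zlim -> continuous h ->
  cvg_in_dist P (fun p q w => h (Z p q w)) Q (fun w => h (Zlim w)).
Proof.
move=> ZZ ch f cf bf; apply: (ZZ (f \o h)).
  by move=> z; apply: continuous_comp; [exact: ch|exact: cf].
have [M [Mr hM]] := bf; exists M; split => // y My z _.
exact: (hM y My (h z) I).
Qed.

Lemma continuous_bilinear_coord (R : realType) m m1 m2 (M : 'M[R]_(m1, m2))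
    (f : 'I_m1 -> 'I_m) (g : 'I_m2 -> 'I_m) :
  continuous (fun z : 'cV[R]_m =>
    ((\col_k z (f k) 0)^T *m M *m \col_l z (g l) 0) 0 0).
Proof.
have -> : (fun z : 'cV[R]_m => ((\col_k z (f k) 0)^T *m M *m \col_l z (g l) 0) 0 0) =
    (fun z : 'cV[R]_m => \sum_l \sum_k z (f k) 0 * M k l * z (g l) 0).
  apply/funext => z; rewrite mxE; apply: eq_bigr => l _.
  by rewrite !mxE mulr_suml; apply: eq_bigr => k _; rewrite !mxE.
move=> z; have zF : Filter (nbhs (z : 'cV[R]_m)) by exact: nbhs_filter.
apply: (@cvg_finite_sum R 'cV[R]_m (nbhs z) zF 'I_m2 _
  (fun l (z : 'cV[R]_m) => \sum_k z (f k) 0 * M k l * z (g l) 0)) => l.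
apply: (@cvg_finite_sum R 'cV[R]_m (nbhs z) zF 'I_m1 _
  (fun k (z : 'cV[R]_m) => z (f k) 0 * M k l * z (g l) 0)) => k.
apply: cvgM; last exact: coord_continuous.
by apply: cvgM; [exact: coord_continuous|exact: cvg_cst].
Qed.

Lemma uCov2_pair_sums (R : realType) (n : nat) (hn : (4 <= n)%N) p q
    (K : 'I_p -> 'M[R]_n) (L : 'I_q -> 'M[R]_n) :
  (forall i, hollow_symmetric (K i)) -> (forall j, hollow_symmetric (L j)) ->
  uCov2 K L = ((n * (n - 3))./2)%:R^-1 *
    ((scaled_pair_sums K)^T *m ucenter_proj *m scaled_pair_sums L) 0 0.
Proof.
move=> hK hL.
have sE r (A : 'I_r -> 'M[R]_n) :
    scaled_pair_sums A = (Num.sqrt r%:R)^-1 *: \sum_i pair_vec (A i).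
  apply/matrixP => e j; rewrite !mxE summxE; congr (_ * _).
  by apply: eq_bigr => i _; rewrite mxE.
rewrite !sE [(_ *: _)^T]linearZ /= -!scalemxAl -scalemxAr [in RHS]mxE [in RHS]mxE.
rewrite /uCov2 sqrtrM ?ler0n// invfM -mulrA [RHS]mulrCA; congr (_ * _).
rewrite [RHS]mulrCA; congr (_ * _).
rewrite [(\sum_i _)^T]linear_sum /= !mulmx_suml summxE mulr_sumr; apply: eq_bigr => i _.
rewrite mulmx_sumr summxE mulr_sumr; apply: eq_bigr => j _.
exact: udot_ucenter.
Qed.

(** With [M = U^T U], the form divided by [v] is the squared norm of [U c / sqrt v]. Since
    [U U^T = 1], the map [U^T] preserves norms, so the linear combinations of this vector have the
    variances required with [tau = s2 / v]. *)
Lemma quadratic_form_law d (T : measurableType d) (R : realType)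
    (P : probability T R) m v (M : 'M[R]_m) (c : T -> 'cV[R]_m) (s2 : R) :
  is_projection_mx M -> \tr M = v%:R -> (0 < v)%N -> 0 <= s2 ->
  (forall k, measurable_fun setT (fun w => c w k 0)) ->
  (forall (a : 'cV[R]_m) B, measurable B ->
    P ((fun w => (a^T *m c w) 0 0) @^-1` B) =
    normal_law 0 (s2 * (a^T *m a) 0 0) B) ->
  forall B, measurable B ->
    P ((fun w => v%:R^-1 * ((c w)^T *m M *m c w) 0 0) @^-1` B) =
    scaled_chi_square (s2 / v%:R) v B.
Proof.
move=> Mproj Mtr v0 s0 mc law B mB.
have [U [UUT UTU]] := orthonormal_factor Mproj Mtr.
have vR : 0 < v%:R :> R by rewrite ltr0n.
(* Indices from [v] on are padded with 0, to fit the [nat]-indexed families of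
   [gaussian_sqnorm_law]. *)
pose W (i : nat) w : R := if insub i is Some j then
  (Num.sqrt v%:R)^-1 * (U *m c w) j 0 else 0.
have WE (j : 'I_v) w : W j w = (Num.sqrt v%:R)^-1 * (U *m c w) j 0.
  by rewrite /W valK.
have mW i : measurable_fun setT (W i).
  rewrite /W; case: insubP => [j _ _|_]; last exact: measurable_cst.
  apply: measurable_funM => //; under eq_fun do rewrite mxE.
  by apply: measurable_sum => k; apply: measurable_funM.
have lW (b : nat -> R) C : measurable C ->
    P ((fun w => \sum_(i < v) b i * W i w) @^-1` C) =
    normal_law 0 (s2 / v%:R * \sum_(i < v) b i ^+ 2) C.
  move=> mC; pose u : 'cV[R]_v := \col_(i < v) b i.
  pose a : 'cV[R]_m := (Num.sqrt v%:R)^-1 *: (U^T *m u).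
  have aT : a^T = (Num.sqrt v%:R)^-1 *: (u^T *m U).
    by rewrite /a linearZ /= trmx_mul trmxK.
  have -> : (fun w => \sum_(i < v) b i * W i w) = (fun w => (a^T *m c w) 0 0).
    apply/funext => w; rewrite aT -scalemxAl mxE -mulmxA mxE mulr_sumr.
    by apply: eq_bigr => i _; rewrite WE !mxE mulrCA.
  rewrite (law a C mC); congr (normal_law 0 _ C).
  rewrite -mulrA; congr (_ * _).
  rewrite aT /a -scalemxAl -scalemxAr scalerA mxE mulmxA -(mulmxA u^T) UUT mulmx1.
  rewrite -invfM -expr2 sqr_sqrtr ?ler0n//; congr (_ * _).
  by rewrite mxE; apply: eq_bigr => i _; rewrite !mxE expr2.
have tau0 : 0 <= s2 / v%:R by rewrite divr_ge0// ler0n.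
have -> : (fun w => v%:R^-1 * ((c w)^T *m M *m c w) 0 0) =
    (fun w => \sum_(i < v) W i w ^+ 2).
  apply/funext => w.
  rewrite -UTU mulmxA -mulmxA -trmx_mul mxE mulr_sumr; apply: eq_bigr => i _.
  by rewrite WE [in LHS]mxE exprMn exprVn sqr_sqrtr ?ler0n// expr2.
exact: (gaussian_sqnorm_law tau0 mW lW mB).
Qed.

Lemma eq_cvg_in_dist (R : realType) (V : topologicalType)
    (d : nat -> nat -> measure_display) (T : forall p q, measurableType (d p q))
    (P : forall p q, probability (T p q) R) (Z Z' : forall p q, T p q -> V)
    (d' : measure_display) (T' : measurableType d') (Q : probability T' R)
    (Y Y' : T' -> V) :
  (forall p q w, Z p q w = Z' p q w) -> (forall w, Y w = Y' w) ->
  cvg_in_dist P Z Q Y -> cvg_in_dist P Z' Q Y'.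
Proof.
move=> ZZ' YY'; have -> : Y' = Y by apply/funext => w; rewrite YY'.
suff -> : Z' = Z by [].
apply: functional_extensionality_dep => p; apply: functional_extensionality_dep => q.
by apply/funext => w; rewrite ZZ'.
Qed.

(** If both ends of [e] were ends of [f], the ordering inside each pair would force the two pairs to
    coincide. This is the separation that orthogonality asks for. *)
Lemma pair_of_separated n (e f : 'I_((n * n.-1)./2)) : e != f ->
  ~~ [&& (pair_of e).1 \in [:: (pair_of f).1; (pair_of f).2] &
         (pair_of e).2 \in [:: (pair_of f).1; (pair_of f).2]].
Proof.
apply: contraNN; have := lt_pair_of e; have := lt_pair_of f.
move E : (pair_of e) => [s t]; move F : (pair_of f) => [u v] /= uv st.
rewrite !inE => /andP[/orP[]/eqP s_ /orP[]/eqP t_]; move: st; rewrite s_ t_ ?ltnn//.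
  by move=> _; apply/eqP; apply: pair_of_inj; rewrite E F s_ t_.
by move=> vu; have := ltn_trans uv vu; rewrite ltnn.
Qed.

Theorem theorem2p2p1 (R : realType) (n : nat) (hn : (4 <= n)%N)
  (k l : R -> R -> R)
  (k_sym : forall x y, k x y = k y x) (l_sym : forall x y, l x y = l y x)
  (k_meas : measurable_fun [set: R * R] (fun z => k z.1 z.2))
  (l_meas : measurable_fun [set: R * R] (fun z => l z.1 z.2))
  (* the law of (X, Y), and the sample (X_s, Y_s), s < n *)
  (law : forall p q : nat, probability (p.-tuple R * q.-tuple R)%type R)
  (dO : nat -> nat -> measure_display)
  (Omega : forall p q : nat, measurableType (dO p q))
  (P : forall p q : nat, probability (Omega p q) R)
  (XY : forall p q : nat,
     'I_n -> {RV (P p q) >-> (p.-tuple R * q.-tuple R)%type})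
  (XY_indep : forall p q, mutually_independent (XY p q))
  (XY_law : forall p q s (A : set (p.-tuple R * q.-tuple R)), measurable A ->
     distribution (P p q) (XY p q s) A = law p q A) :
  let v := ((n * (n - 3))./2)%N in
  let N := ((n * n.-1)./2)%N in
  let x := fun p q (i : 'I_p) (s : 'I_n) (w : Omega p q) =>
    tnth (XY p q s w).1 i in
  let y := fun p q (j : 'I_q) (s : 'I_n) (w : Omega p q) =>
    tnth (XY p q s w).2 j in
  let kst := fun p q (s t : 'I_n) (i : 'I_p) =>
    double_centered (P p q) k (x p q i s) (x p q i t) in
  let lst := fun p q (s t : 'I_n) (j : 'I_q) =>
    double_centered (P p q) l (y p q j s) (y p q j t) in
  let K := fun p q (w : Omega p q) (i : 'I_p) =>
    kernel_mx (P p q) k (x p q i) w in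
  let L := fun p q (w : Omega p q) (j : 'I_q) =>
    kernel_mx (P p q) l (y p q j) w in
  forall
  (k_int : forall p q (s t : 'I_n) (i : 'I_p), s != t ->
     (P p q).-integrable [set: Omega p q]
       (fun w => (k (x p q i s w) (x p q i t w))%:E))
  (l_int : forall p q (s t : 'I_n) (j : 'I_q), s != t ->
     (P p q).-integrable [set: Omega p q]
       (fun w => (l (y p q j s w) (y p q j t w))%:E))
  (a b a' b' : R) (ha : 0 < a) (ha' : 0 < a')
  (x_moments : forall p q (i : 'I_p),
     (a%:E <= 'V_(law p q)[fun z => tnth z.1 i])%E /\
     ('E_(law p q)[fun z => (tnth z.1 i ^+ 2)%R] <= b%:E)%E)
  (y_moments : forall p q (j : 'I_q),
     (a'%:E <= 'V_(law p q)[fun z => tnth z.2 j])%E /\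
     ('E_(law p q)[fun z => (tnth z.2 j ^+ 2)%R] <= b'%:E)%E)
  (* the limit {c_st, d_uv}, of which only the entries s < t, u < v matter *)
  (dQ : measure_display) (OmegaQ : measurableType dQ)
  (Q : probability OmegaQ R)
  (c d : 'I_n -> 'I_n -> {RV Q >-> R}),
  let cvec := fun w : OmegaQ =>
    \col_(e < N) c (pair_of e).1 (pair_of e).2 w in
  let dvec := fun w : OmegaQ =>
    \col_(e < N) d (pair_of e).1 (pair_of e).2 w in
  forall
  (joint_cvg : cvg_in_dist P
     (fun p q w =>
        col_mx (scaled_pair_sums (K p q w)) (scaled_pair_sums (L p q w)))
     Q (fun w => col_mx (cvec w) (dvec w)))
  (cd_gauss : jointly_gaussian Q (fun w => col_mx (cvec w) (dvec w)))
  (sx2 sy2 sxy2 : R)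
  (var_c : forall s t : 'I_n, (s < t)%N -> 'V_Q[c s t] = sx2%:E)
  (var_d : forall s t : 'I_n, (s < t)%N -> 'V_Q[d s t] = sy2%:E)
  (cov_cd : forall s t : 'I_n, (s < t)%N ->
     covariance Q (c s t) (d s t) = sxy2%:E)
  (lim_sx2 : forall s t : 'I_n, (s < t)%N ->
     ((pq.1%:R^-1)%:E * \sum_(i < pq.1) \sum_(j < pq.1)
        covariance (P pq.1 pq.2) (kst pq.1 pq.2 s t i) (kst pq.1 pq.2 s t j))%E
       @[pq --> filter_prod \oo \oo] --> sx2%:E)
  (lim_sy2 : forall s t : 'I_n, (s < t)%N ->
     ((pq.2%:R^-1)%:E * \sum_(i < pq.2) \sum_(j < pq.2)
        covariance (P pq.1 pq.2) (lst pq.1 pq.2 s t i) (lst pq.1 pq.2 s t j))%E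
       @[pq --> filter_prod \oo \oo] --> sy2%:E)
  (lim_sxy2 : forall s t : 'I_n, (s < t)%N ->
     (((Num.sqrt (pq.1%:R * pq.2%:R))^-1)%:E *
        \sum_(i < pq.1) \sum_(j < pq.2)
        covariance (P pq.1 pq.2) (kst pq.1 pq.2 s t i) (lst pq.1 pq.2 s t j))%E
       @[pq --> filter_prod \oo \oo] --> sxy2%:E),
  multinormal Q (fun w => col_mx (cvec w) (dvec w)) 0
    (block_mx sx2%:M sxy2%:M sxy2%:M sy2%:M) /\
  exists M : 'M[R]_N,
    [/\ is_projection_mx M, \rank M = v,
     cvg_in_dist P (fun p q w => uCov2 (K p q w) (L p q w))
       Q (fun w => v%:R^-1 * ((cvec w)^T *m M *m dvec w) 0 0),
     cvg_in_dist P (fun p q w => uCov2 (K p q w) (K p q w))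
       Q (fun w => v%:R^-1 * ((cvec w)^T *m M *m cvec w) 0 0) /\
     (forall B : set R, measurable B ->
        Q ((fun w => v%:R^-1 * ((cvec w)^T *m M *m cvec w) 0 0) @^-1` B) =
        scaled_chi_square (sx2 / v%:R) v B) &
     cvg_in_dist P (fun p q w => uCov2 (L p q w) (L p q w))
       Q (fun w => v%:R^-1 * ((dvec w)^T *m M *m dvec w) 0 0) /\
     (forall B : set R, measurable B ->
        Q ((fun w => v%:R^-1 * ((dvec w)^T *m M *m dvec w) 0 0) @^-1` B) =
        scaled_chi_square (sy2 / v%:R) v B)].
Proof.
move=> v N x y kst lst K L k_int l_int a b a' b' _ _ _ _ dQ OmegaQ Q c d cvec dvec.
move=> joint_cvg cd_gauss sx2 sy2 sxy2 var_c var_d cov_cd lim_sx2 lim_sy2 lim_sxy2.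
have mphi p q (i : 'I_p) :
    measurable_fun setT (fun z : p.-tuple R * q.-tuple R => tnth z.1 i).
  exact: measurableT_comp (measurable_tnth i) measurable_fst.
have mpsi p q (j : 'I_q) :
    measurable_fun setT (fun z : p.-tuple R * q.-tuple R => tnth z.2 j).
  exact: measurableT_comp (measurable_tnth j) measurable_snd.
have kst0 p q s t i : s != t ->
    (P p q).-integrable setT (EFin \o kst p q s t i) /\
    \int[P p q]_w kst p q s t i w = 0.
  exact: (double_centered_mean0 (@XY_indep p q) (@XY_law p q) k_sym k_meas
    (mphi p q i) (fun s t => @k_int p q s t i)).
have lst0 p q s t j : s != t ->
    (P p q).-integrable setT (EFin \o lst p q s t j) /\
    \int[P p q]_w lst p q s t j w = 0.
  exact: (double_centered_mean0 (@XY_indep p q) (@XY_law p q) l_sym l_meas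
    (mpsi p q j) (fun s t => @l_int p q s t j)).
have mkst p q s t i : s != t -> measurable_fun setT (kst p q s t i).
  by move=> st; have [/integrableP[/measurable_EFinP]] := kst0 p q s t i st.
have mlst p q s t j : s != t -> measurable_fun setT (lst p q s t j).
  by move=> st; have [/integrableP[/measurable_EFinP]] := lst0 p q s t j st.
have neq (e : 'I_N) : (pair_of e).1 != (pair_of e).2.
  by rewrite -val_eqE neq_ltn lt_pair_of.
have pos1 : \forall pq \near filter_prod \oo \oo, (0 < pq.1)%N.
  exists ([set p | (0 < p)%N], setT) => [|[p q] []//]; split; last exact: filterT.
  by exists 1%N.
have pos2 : \forall pq \near filter_prod \oo \oo, (0 < pq.2)%N.
  exists (setT, [set q | (0 < q)%N]) => [|[p q] []//]; split; first exact: filterT.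
  by exists 1%N.
(* A finite limit makes the covariance sums finite near infinity, and with them the second
   moments. *)
have ikst (e : 'I_N) : \forall pq \near filter_prod \oo \oo, forall i,
    (P pq.1 pq.2).-integrable setT (EFin \o
      (fun w => kst pq.1 pq.2 (pair_of e).1 (pair_of e).2 i w ^+ 2)).
  have /fine_cvgP[fin _] := lim_sx2 _ _ (lt_pair_of e).
  near=> pq; apply: (@sum_covariance_sqr_integrable _ _ _ _ _ _ pq.1%:R^-1).
  - by rewrite invr_gt0 ltr0n; near: pq.
  - by move=> i; have [] := kst0 pq.1 pq.2 _ _ i (neq e).
  - by move=> i; have [] := kst0 pq.1 pq.2 _ _ i (neq e).
  - by near: pq.
have ilst (e : 'I_N) : \forall pq \near filter_prod \oo \oo, forall j,
    (P pq.1 pq.2).-integrable setT (EFin \o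
      (fun w => lst pq.1 pq.2 (pair_of e).1 (pair_of e).2 j w ^+ 2)).
  have /fine_cvgP[fin _] := lim_sy2 _ _ (lt_pair_of e).
  near=> pq; apply: (@sum_covariance_sqr_integrable _ _ _ _ _ _ pq.2%:R^-1).
  - by rewrite invr_gt0 ltr0n; near: pq.
  - by move=> j; have [] := lst0 pq.1 pq.2 _ _ j (neq e).
  - by move=> j; have [] := lst0 pq.1 pq.2 _ _ j (neq e).
  - by near: pq.
pose Z p q w := col_mx (scaled_pair_sums (K p q w)) (scaled_pair_sums (L p q w)).
have ZuE p q w (e : 'I_N) : Z p q w (lshift N e) 0 =
    (Num.sqrt p%:R)^-1 * \sum_i kst p q (pair_of e).1 (pair_of e).2 i w.
  rewrite col_mxEu mxE; congr (_ * _); apply: eq_bigr => i _.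
  by rewrite mxE (negbTE (neq e)).
have ZdE p q w (e : 'I_N) : Z p q w (rshift N e) 0 =
    (Num.sqrt q%:R)^-1 * \sum_j lst p q (pair_of e).1 (pair_of e).2 j w.
  rewrite col_mxEd mxE; congr (_ * _); apply: eq_bigr => i _.
  by rewrite mxE (negbTE (neq e)).
pose Sigma : 'M[R]_(N + N) := block_mx sx2%:M sxy2%:M sxy2%:M sy2%:M.
have mZ p q h : measurable_fun setT (fun w => Z p q w h 0).
  case: (split_ordP h) => e ->.
    under eq_fun do rewrite ZuE; apply: measurable_funM => //.
    by apply: measurable_sum => i; exact: mkst (neq e).
  under eq_fun do rewrite ZdE; apply: measurable_funM => //.
  by apply: measurable_sum => j; exact: mlst (neq e).
have cvg0 (f : nat * nat -> \bar R) (c0 : nat * nat -> R) :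
    (\forall pq \near filter_prod \oo \oo, f pq = 0%E) ->
    ((c0 pq)%:E * f pq)%E @[pq --> filter_prod \oo \oo] --> 0%:E.
  move=> f0; apply: cvg_near_cst; near=> pq.
  have -> : f pq = 0%E by near: pq.
  by rewrite mule0.
have cuu (e f : 'I_N) : \int[P pq.1 pq.2]_w
    (Z pq.1 pq.2 w (lshift N e) 0 * Z pq.1 pq.2 w (lshift N f) 0)
    @[pq --> filter_prod \oo \oo] --> (sx2%:M : 'M[R]_N) e f.
  have := @cross_moment_cvg R dO Omega P (fun p _ => p) (fun p _ => p)
    (fun p q => kst p q (pair_of e).1 (pair_of e).2)
    (fun p q => kst p q (pair_of f).1 (pair_of f).2)
    (fun p _ => (Num.sqrt p%:R)^-1) (fun p _ => (Num.sqrt p%:R)^-1)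
    ((sx2%:M : 'M[R]_N) e f).
  move=> /(_ (fun p q i => mkst p q _ _ i (neq e)) (fun p q i => mkst p q _ _ i (neq f))).
  move=> /(_ (fun p q i => (kst0 p q _ _ i (neq e)).2)
             (fun p q i => (kst0 p q _ _ i (neq f)).2) (ikst e) (ikst f)).
  move=> h; apply: cvg_trans (h _) => {h}.
    apply: near_eq_cvg; apply: nearW => pq; apply: eq_Rintegral => w _.
    by rewrite !ZuE.
  (* At equal pairs the limit is a hypothesis; at distinct pairs each covariance vanishes as soon as
     the squares are integrable. *)
  have [<-|ef] := eqVneq e f.
    rewrite mxE eqxx mulr1n; have := lim_sx2 _ _ (lt_pair_of e).
    apply: cvg_trans; apply: near_eq_cvg; apply: nearW => pq /=.
    by rewrite -invfM -expr2 sqr_sqrtr// ler0n.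
  rewrite mxE (negbTE ef); apply: cvg0; near=> pq.
  have ie : forall i, (P pq.1 pq.2).-integrable setT (EFin \o
      (fun w => kst pq.1 pq.2 (pair_of e).1 (pair_of e).2 i w ^+ 2)) by near: pq.
  have jf : forall i, (P pq.1 pq.2).-integrable setT (EFin \o
      (fun w => kst pq.1 pq.2 (pair_of f).1 (pair_of f).2 i w ^+ 2)) by near: pq.
  apply: big1 => i _; apply: big1 => j _.
  exact: (double_centered_uncorrelated (@XY_indep _ _) (@XY_law _ _) k_sym k_sym
    k_meas k_meas (mphi _ _ i) (mphi _ _ j) (fun s t => @k_int _ _ s t i)
    (fun s t => @k_int _ _ s t j) (neq e) (neq f) (pair_of_separated ef) (ie i) (jf j)).
have cdd (e f : 'I_N) : \int[P pq.1 pq.2]_w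
    (Z pq.1 pq.2 w (rshift N e) 0 * Z pq.1 pq.2 w (rshift N f) 0)
    @[pq --> filter_prod \oo \oo] --> (sy2%:M : 'M[R]_N) e f.
  have := @cross_moment_cvg R dO Omega P (fun _ q => q) (fun _ q => q)
    (fun p q => lst p q (pair_of e).1 (pair_of e).2)
    (fun p q => lst p q (pair_of f).1 (pair_of f).2)
    (fun _ q => (Num.sqrt q%:R)^-1) (fun _ q => (Num.sqrt q%:R)^-1)
    ((sy2%:M : 'M[R]_N) e f).
  move=> /(_ (fun p q i => mlst p q _ _ i (neq e)) (fun p q i => mlst p q _ _ i (neq f))).
  move=> /(_ (fun p q i => (lst0 p q _ _ i (neq e)).2)
             (fun p q i => (lst0 p q _ _ i (neq f)).2) (ilst e) (ilst f)).
  move=> h; apply: cvg_trans (h _) => {h}.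
    apply: near_eq_cvg; apply: nearW => pq; apply: eq_Rintegral => w _.
    by rewrite !ZdE.
  have [<-|ef] := eqVneq e f.
    rewrite mxE eqxx mulr1n; have := lim_sy2 _ _ (lt_pair_of e).
    apply: cvg_trans; apply: near_eq_cvg; apply: nearW => pq /=.
    by rewrite -invfM -expr2 sqr_sqrtr// ler0n.
  rewrite mxE (negbTE ef); apply: cvg0; near=> pq.
  have ie : forall i, (P pq.1 pq.2).-integrable setT (EFin \o
      (fun w => lst pq.1 pq.2 (pair_of e).1 (pair_of e).2 i w ^+ 2)) by near: pq.
  have jf : forall i, (P pq.1 pq.2).-integrable setT (EFin \o
      (fun w => lst pq.1 pq.2 (pair_of f).1 (pair_of f).2 i w ^+ 2)) by near: pq.
  apply: big1 => i _; apply: big1 => j _.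
  exact: (double_centered_uncorrelated (@XY_indep _ _) (@XY_law _ _) l_sym l_sym
    l_meas l_meas (mpsi _ _ i) (mpsi _ _ j) (fun s t => @l_int _ _ s t i)
    (fun s t => @l_int _ _ s t j) (neq e) (neq f) (pair_of_separated ef) (ie i) (jf j)).
have cud (e f : 'I_N) : \int[P pq.1 pq.2]_w
    (Z pq.1 pq.2 w (lshift N e) 0 * Z pq.1 pq.2 w (rshift N f) 0)
    @[pq --> filter_prod \oo \oo] --> (sxy2%:M : 'M[R]_N) e f.
  have := @cross_moment_cvg R dO Omega P (fun p _ => p) (fun _ q => q)
    (fun p q => kst p q (pair_of e).1 (pair_of e).2)
    (fun p q => lst p q (pair_of f).1 (pair_of f).2)
    (fun p _ => (Num.sqrt p%:R)^-1) (fun _ q => (Num.sqrt q%:R)^-1)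
    ((sxy2%:M : 'M[R]_N) e f).
  move=> /(_ (fun p q i => mkst p q _ _ i (neq e)) (fun p q i => mlst p q _ _ i (neq f))).
  move=> /(_ (fun p q i => (kst0 p q _ _ i (neq e)).2)
             (fun p q i => (lst0 p q _ _ i (neq f)).2) (ikst e) (ilst f)).
  move=> h; apply: cvg_trans (h _) => {h}.
    apply: near_eq_cvg; apply: nearW => pq; apply: eq_Rintegral => w _.
    by rewrite ZuE ZdE.
  have [<-|ef] := eqVneq e f.
    rewrite mxE eqxx mulr1n; have := lim_sxy2 _ _ (lt_pair_of e).
    apply: cvg_trans; apply: near_eq_cvg; apply: nearW => pq /=.
    by rewrite sqrtrM ?ler0n// invfM.
  rewrite mxE (negbTE ef); apply: cvg0; near=> pq.
  have ie : forall i, (P pq.1 pq.2).-integrable setT (EFin \o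
      (fun w => kst pq.1 pq.2 (pair_of e).1 (pair_of e).2 i w ^+ 2)) by near: pq.
  have jf : forall i, (P pq.1 pq.2).-integrable setT (EFin \o
      (fun w => lst pq.1 pq.2 (pair_of f).1 (pair_of f).2 i w ^+ 2)) by near: pq.
  apply: big1 => i _; apply: big1 => j _.
  exact: (double_centered_uncorrelated (@XY_indep _ _) (@XY_law _ _) k_sym l_sym
    k_meas l_meas (mphi _ _ i) (mpsi _ _ j) (fun s t => @k_int _ _ s t i)
    (fun s t => @l_int _ _ s t j) (neq e) (neq f) (pair_of_separated ef) (ie i) (jf j)).
have cZ h h' : \int[P pq.1 pq.2]_w (Z pq.1 pq.2 w h 0 * Z pq.1 pq.2 w h' 0)
    @[pq --> filter_prod \oo \oo] --> Sigma h h'.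
  case: (split_ordP h) => e ->; case: (split_ordP h') => f ->; rewrite /Sigma.
  - rewrite block_mxEul; exact: cuu.
  - rewrite block_mxEur; exact: cud.
  - rewrite block_mxEdl.
    have -> : (sxy2%:M : 'M[R]_N) e f = (sxy2%:M : 'M[R]_N) f e by rewrite !mxE eq_sym.
    apply: cvg_trans (cud f e); apply: near_eq_cvg; apply: nearW => pq.
    by apply: eq_Rintegral => w _; rewrite mulrC.
  - rewrite block_mxEdr; exact: cdd.
have iZ : \forall pq \near filter_prod \oo \oo, forall h,
    (P pq.1 pq.2).-integrable setT (EFin \o (fun w => Z pq.1 pq.2 w h 0 ^+ 2)).
  apply: filter_forall => h; case: (split_ordP h) => e -> .
    near=> pq; have i2 : forall i, (P pq.1 pq.2).-integrable setT (EFin \o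
      (fun w => kst pq.1 pq.2 (pair_of e).1 (pair_of e).2 i w ^+ 2)) by near: pq.
    have m i := mkst pq.1 pq.2 _ _ i (neq e).
    have z i := (kst0 pq.1 pq.2 _ _ i (neq e)).2.
    have [] := cross_moment (Num.sqrt pq.1%:R)^-1 (Num.sqrt pq.1%:R)^-1 m m z z i2 i2.
    move=> + _; congr (_.-integrable _ _); apply/funext => w /=.
    by rewrite ZuE expr2.
  near=> pq; have i2 : forall i, (P pq.1 pq.2).-integrable setT (EFin \o
    (fun w => lst pq.1 pq.2 (pair_of e).1 (pair_of e).2 i w ^+ 2)) by near: pq.
  have m i := mlst pq.1 pq.2 _ _ i (neq e).
  have z i := (lst0 pq.1 pq.2 _ _ i (neq e)).2.
  have [] := cross_moment (Num.sqrt pq.2%:R)^-1 (Num.sqrt pq.2%:R)^-1 m m z z i2 i2.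
  move=> + _; congr (_.-integrable _ _); apply/funext => w /=.
  by rewrite ZdE expr2.
pose Zlim w := col_mx (cvec w) (dvec w).
have ZluE w e : Zlim w (lshift N e) 0 = c (pair_of e).1 (pair_of e).2 w.
  by rewrite col_mxEu mxE.
have ZldE w e : Zlim w (rshift N e) 0 = d (pair_of e).1 (pair_of e).2 w.
  by rewrite col_mxEd mxE.
have mZlim h : measurable_fun setT (fun w => Zlim w h 0).
  case: (split_ordP h) => e ->.
    by under eq_fun do rewrite ZluE; exact: measurable_funPT.
  by under eq_fun do rewrite ZldE; exact: measurable_funPT.
have varZ h : ('V_Q[fun w => (Zlim w h 0)%R])%E = (Sigma h h)%:E.
  rewrite /Sigma; case: (split_ordP h) => e ->.
    rewrite block_mxEul mxE eqxx mulr1n -(var_c _ _ (lt_pair_of e)).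
    by congr ('V_Q[_])%E; apply/funext => w; rewrite ZluE.
  rewrite block_mxEdr mxE eqxx mulr1n -(var_d _ _ (lt_pair_of e)).
  by congr ('V_Q[_])%E; apply/funext => w; rewrite ZldE.
have Ssym : Sigma^T = Sigma by rewrite tr_block_mx !tr_scalar_mx.
have mn : multinormal Q Zlim 0 Sigma.
  exact: (limit_multinormal joint_cvg mZ mZlim iZ cZ varZ Ssym cd_gauss).
split; first exact: mn.
have n4 : (0 < v)%N.
  by rewrite half_gt0 (leq_trans (ltnW (ltnW hn)))// leq_pmulr// subn_gt0.
have hK p q w i : hollow_symmetric (K p q w i).
  split=> [s|s t]; rewrite /K /kernel_mx !mxE ?eqxx// eq_sym.
  by case: ifP => // _; rewrite double_centeredC.
have hL p q w j : hollow_symmetric (L p q w j).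
  split=> [s|s t]; rewrite /L /kernel_mx !mxE ?eqxx// eq_sym.
  by case: ifP => // _; rewrite double_centeredC.
(* Choosing the halves through [f] and [g] treats the three statistics with a single continuous
   map. *)
have bil (f g : 'I_N -> 'I_(N + N)) : cvg_in_dist P
    (fun p q w => v%:R^-1 * ((\col_e Z p q w (f e) 0)^T *m ucenter_proj *m
                             \col_e Z p q w (g e) 0) 0 0)
    Q (fun w => v%:R^-1 * ((\col_e Zlim w (f e) 0)^T *m ucenter_proj *m
                             \col_e Zlim w (g e) 0) 0 0).
  pose H (z : 'cV[R]_(N + N)) : R := v%:R^-1 *
    ((\col_e z (f e) 0)^T *m ucenter_proj *m \col_e z (g e) 0) 0 0.
  apply: (@cvg_in_dist_comp R _ _ _ _ _ _ _ _ _ _ H joint_cvg) => z.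
  have zF : Filter (nbhs (z : 'cV[R]_(N + N))) by exact: nbhs_filter.
  rewrite /continuous_at /H; apply: cvgM; first exact: cvg_cst.
  exact: continuous_bilinear_coord.
have ZK p q w : \col_e Z p q w (lshift N e) 0 = scaled_pair_sums (K p q w).
  by apply/matrixP => e j; rewrite mxE col_mxEu (ord1 j).
have ZL p q w : \col_e Z p q w (rshift N e) 0 = scaled_pair_sums (L p q w).
  by apply/matrixP => e j; rewrite mxE col_mxEd (ord1 j).
have Zc w : \col_e Zlim w (lshift N e) 0 = cvec w.
  by apply/matrixP => e j; rewrite mxE col_mxEu (ord1 j).
have Zd w : \col_e Zlim w (rshift N e) 0 = dvec w.
  by apply/matrixP => e j; rewrite mxE col_mxEd (ord1 j).
have Mproj := @ucenter_proj_projection R n hn.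
have Mtr := @trace_ucenter_proj R n hn.
(* A linear form of one half is a form of the whole vector padded with zeros; the diagonal block
   being scalar, its variance is [sx2] times the squared norm of [u]. *)
have lawc (u : 'cV[R]_N) B : measurable B ->
    Q ((fun w => (u^T *m cvec w) 0 0) @^-1` B) = normal_law 0 (sx2 * (u^T *m u) 0 0) B.
  move=> mB; have [_ /(_ B mB)] := mn (col_mx u 0).
  rewrite (_ : (fun w => ((col_mx u 0)^T *m Zlim w) 0 0) = (fun w => (u^T *m cvec w) 0 0)).
    rewrite mulmx0 mxE tr_col_mx mul_row_block trmx0 !mul0mx !addr0 mul_row_col mulmx0.
    by rewrite addr0 mul_mx_scalar -scalemxAl [X in normal_law _ X _]mxE.
  by apply/funext => w; rewrite tr_col_mx trmx0 mul_row_col mul0mx addr0.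
have lawd (u : 'cV[R]_N) B : measurable B ->
    Q ((fun w => (u^T *m dvec w) 0 0) @^-1` B) = normal_law 0 (sy2 * (u^T *m u) 0 0) B.
  move=> mB; have [_ /(_ B mB)] := mn (col_mx 0 u).
  rewrite (_ : (fun w => ((col_mx 0 u)^T *m Zlim w) 0 0) = (fun w => (u^T *m dvec w) 0 0)).
    rewrite mulmx0 mxE tr_col_mx mul_row_block trmx0 !mul0mx !add0r mul_row_col mulmx0.
    by rewrite add0r mul_mx_scalar -scalemxAl [X in normal_law _ X _]mxE.
  by apply/funext => w; rewrite tr_col_mx trmx0 mul_row_col mul0mx add0r.
(* Some pair [s < t] exists, and the variances at it show that [sx2] and [sy2] are nonnegative. *)
have N0 : (0 < N)%N.
  rewrite half_gt0 (leq_trans (ltnW (ltnW hn)))// leq_pmulr// -subn1 subn_gt0.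
  exact: ltnW (ltnW hn).
have sx0 : 0 <= sx2.
  by rewrite -lee_fin -(var_c _ _ (lt_pair_of (Ordinal N0))); exact: variance_ge0.
have sy0 : 0 <= sy2.
  by rewrite -lee_fin -(var_d _ _ (lt_pair_of (Ordinal N0))); exact: variance_ge0.
have mcvec e : measurable_fun setT (fun w => cvec w e 0).
  by under eq_fun do rewrite mxE; exact: measurable_funPT.
have mdvec e : measurable_fun setT (fun w => dvec w e 0).
  by under eq_fun do rewrite mxE; exact: measurable_funPT.
exists ucenter_proj; split.
- exact: Mproj.
- have [U [UUT UTU]] := orthonormal_factor Mproj Mtr.
  by rewrite -UTU; exact: rank_orthonormal_factor.
- apply: eq_cvg_in_dist (bil (@lshift N N) (@rshift N N)) => [p q w|w].
    by rewrite ZK ZL (uCov2_pair_sums hn).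
  by rewrite Zc Zd.
- split; last exact: (quadratic_form_law Mproj Mtr n4 sx0 mcvec lawc).
  apply: eq_cvg_in_dist (bil (@lshift N N) (@lshift N N)) => [p q w|w].
    by rewrite ZK (uCov2_pair_sums hn).
  by rewrite Zc.
- split; last exact: (quadratic_form_law Mproj Mtr n4 sy0 mdvec lawd).
  apply: eq_cvg_in_dist (bil (@rshift N N) (@rshift N N)) => [p q w|w].
    by rewrite ZL (uCov2_pair_sums hn).
  by rewrite Zd.
Unshelve. all: by end_near.
Qed.
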